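(* Let $N\ge 3$, let $V$ be a non-negative coercive function in $C^0(\mathbb{R}^N)\cap H^2_{\mathrm{loc}}(\mathbb{R}^N)$, and let $W(x)=\Psi(x/|x|)/|x|^{N-2}$, where $\Psi\in C(\mathbb{S}^{N-1})$ is even and positive. Assume that the Fourier transform of $W$ is of the form $\mathcal{F}(W)(\xi)=m(\xi/|\xi|)/|\xi|^2$, where $m\in L^\infty(\mathbb{S}^{N-1})$ satisfies $0<m_0\le m(\omega)\le m_1<\infty$ for all $\omega\in\mathbb{S}^{N-1}$, for some constants $m_0,m_1$. Then the unique minimizer $\mu$ over $\mathscr{P}(\mathbb{R}^N)$ of $$\mathcal{E}(\nu)=\int_{\mathbb{R}^N}\int_{\mathbb{R}^N}W(x-y)\,d\nu(y)\,d\nu(x)+\int_{\mathbb{R}^N}V(x)\,d\nu(x)$$ has $L^2$ density, i.e. $\mu$ is absolutely continuous with respect to the Lebesgue measure and its density belongs to $L^2(\mathbb{R}^N)$.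
   Context: $\mathscr{P}(\mathbb{R}^N)$ is the set of Borel probability measures on $\mathbb{R}^N$. Coercive means $V(x)\to\infty$ as $|x|\to\infty$. We set $W(0)=+\infty$. The Fourier transform is $\mathcal{F}(v)(\xi)=\int_{\mathbb{R}^N}e^{-ix\cdot\xi}v(x)\,dx$, extended to tempered distributions; the identity for $\mathcal{F}(W)$ is in the sense of tempered distributions. Under the stated assumptions $\mathcal{E}$ has a unique minimizer over $\mathscr{P}(\mathbb{R}^N)$, and this minimizer is compactly supported. *)

(* Defs.v *)
From HB Require Import structures.
From mathcomp Require Import all_boot all_order all_algebra.
From mathcomp Require Import complex.
From mathcomp Require Import all_classical all_reals all_analysis measurable_realfun.

Set Implicit Arguments.
Unset Strict Implicit.
Unset Printing Implicit Defensive.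

Import Order.TTheory GRing.Theory Num.Theory.
Import numFieldNormedType.Exports.

Local Open Scope classical_set_scope.
Local Open Scope ring_scope.

(* R^n is 'rV[R]_n. Its topology is the product one, hence the usual one,
   although `|x| is the sup norm. *)
Section borel_rV.
Variables (R : realType) (n : nat).

HB.instance Definition _ := @isMeasurable.Build
  (sigma_display (@open 'rV[R]_n)) 'rV[R]_n <<s @open 'rV[R]_n >>
  (@sigma_algebra0 _ setT (@open 'rV[R]_n))
  (@sigma_algebraC _ (@open 'rV[R]_n))
  (@sigma_algebra_bigcup _ setT (@open 'rV[R]_n)).

Lemma open_measurable_rV (A : set 'rV[R]_n) : open A -> measurable A.
Proof. exact: sub_sigma_algebra. Qed.

Lemma measurable_coord (i : 'I_n) :
  measurable_fun setT (fun x : 'rV[R]_n => x ord0 i).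
Proof.
apply: (measurability _ (RGenOpens.measurableE R)) => _ [_ [a [b ->] <-]].
rewrite setTI; apply: open_measurable_rV.
by move/continuousP: (@coord_continuous R 1 n ord0 i); apply; exact: interval_open.
Qed.

Lemma open_bigcup_rat_ball (U : set 'rV[R]_n) : open U ->
  U = \bigcup_(q in [set q : 'rV[rat]_n * nat |
         ball (map_mx (@ratr R) q.1) (q.2.+1%:R^-1 : R) `<=` U])
      ball (map_mx (@ratr R) q.1) (q.2.+1%:R^-1 : R).
Proof.
move=> oU; apply/seteqP; split=> [x Ux|x [q qU]]; last exact: qU.
have /nbhs_ballP[e /= e0 eU] : nbhs x U by exact: open_nbhs_nbhs.
have [k ke] : exists k : nat, (k.+1%:R^-1 : R) < e / 2.
  have e20 : 0 < e / 2 by rewrite divr_gt0.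
  by have [k _ /(_ k (leqnn k))] := near_infty_natSinv_lt (PosNum e20); exists k.
have k0 : 0 < k.+1%:R^-1 :> R by rewrite invr_gt0.
have /choice[q qx] : forall i, exists r : rat, ball (x ord0 i) (k.+1%:R^-1 : R) (ratr r).
  move=> i; have [||y [By [r _ rE]]] :=
      @dense_rat R (ball (x ord0 i) (k.+1%:R^-1 : R)).
  - by exists (x ord0 i); exact: ballxx.
  - exact: ball_open.
  - by exists r; rewrite rE.
have qx' : ball (map_mx (@ratr R) (\row_i q i)) (k.+1%:R^-1 : R) x.
  by split=> // i j; rewrite !mxE ord1; apply: ball_sym; exact: qx.
exists (\row_i q i, k) => //= y qy; apply: eU.
apply: (@le_ball _ _ _ (k.+1%:R^-1 + k.+1%:R^-1 : R)).
  by rewrite (splitr e) lerD// ltW.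
by apply: ball_triangle qy; exact: ball_sym.
Qed.

Lemma measurable_fun_rV d (T : measurableType d) (f : T -> 'rV[R]_n) :
  (forall i, measurable_fun setT (fun t => f t ord0 i)) -> measurable_fun setT f.
Proof.
move=> mf; apply: (@measurability _ _ _ _ _ f (@open 'rV[R]_n)) => //.
move=> _ [U oU <-]; rewrite setTI (open_bigcup_rat_ball oU) preimage_bigcup.
rewrite bigcup_mkcond; apply: countable_bigcupT_measurable => // q.
case: ifPn => // _.
have -> : f @^-1` ball (map_mx (@ratr R) q.1) (q.2.+1%:R^-1 : R) =
    \bigcap_(i in [set: 'I_n])
      (fun t => f t ord0 i) @^-1` ball (ratr (q.1 ord0 i) : R) (q.2.+1%:R^-1 : R).
  apply/seteqP; split => t /=.
    by case=> _ h i _; have := h ord0 i; rewrite mxE.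
  by move=> h; split; [rewrite invr_gt0|move=> i j; rewrite ord1 mxE; exact: h].
apply: fin_bigcap_measurable => //.
move=> i _; rewrite -[X in measurable X]setTI; apply: mf => //.
by apply: open_measurable; exact: ball_open.
Qed.

End borel_rV.

Section lebesgue_rV.
Variable R : realType.

Definition cons_rV n (p : R * 'rV[R]_n) : 'rV[R]_n.+1 := row_mx p.1%:M p.2.

Lemma cons_rV0 n (x : R) (v : 'rV[R]_n) : cons_rV (x, v) ord0 ord0 = x.
Proof.
rewrite /cons_rV (_ : ord0 = lshift n (ord0 : 'I_1)); last exact: val_inj.
by rewrite (row_mxEl (x%:M : 'M[R]_1) v ord0 ord0) mxE eqxx mulr1n.
Qed.

Lemma cons_rV1 n (x : R) (v : 'rV[R]_n) i :
  cons_rV (x, v) ord0 (lift ord0 i) = v ord0 i.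
Proof.
rewrite /cons_rV (_ : lift ord0 i = rshift 1 i); last exact: val_inj.
by rewrite (row_mxEr (x%:M : 'M[R]_1) v ord0 i).
Qed.

Lemma measurable_cons_rV n : measurable_fun setT (@cons_rV n).
Proof.
apply: measurable_fun_rV => i; have [j ->|->] := unliftP ord0 i.
  rewrite (_ : (fun _ => _) = (fun x : 'rV[R]_n => x ord0 j) \o snd).
    exact: measurableT_comp (measurable_coord j) measurable_snd.
  by apply/funext => -[x v]; rewrite cons_rV1.
rewrite (_ : (fun _ => _) = fst); first exact: measurable_fst.
by apply/funext => -[x v]; rewrite cons_rV0.
Qed.

Section step.
Variables (n : nat) (mu : {sigma_finite_measure set 'rV[R]_n -> \bar R}).

Definition lebesgue_step : set 'rV[R]_n.+1 -> \bar R :=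
  pushforward ((@lebesgue_measure R) \x mu)%E (@cons_rV n).

Let lebesgue_step0 : lebesgue_step set0 = 0%E.
Proof. by rewrite /lebesgue_step /pushforward preimage_set0 measure0. Qed.

Let lebesgue_step_ge0 A : (0 <= lebesgue_step A)%E.
Proof. exact: integral_ge0. Qed.

Let lebesgue_step_sigma_additive : semi_sigma_additive lebesgue_step.
Proof.
apply: (@measure_semi_sigma_additive _ _ _ (pushforward _ _)).
exact: measurable_cons_rV.
Qed.

HB.instance Definition _ := isMeasure.Build _ _ _ lebesgue_step
  lebesgue_step0 lebesgue_step_ge0 lebesgue_step_sigma_additive.

Let lebesgue_step_sigma_finite : sigma_finite setT lebesgue_step.
Proof.
have /sigma_finiteP[F [TF ndF Foo]] := sigma_finiteT (@lebesgue_measure R).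
have /sigma_finiteP[G [TG ndG Goo]] := sigma_finiteT mu.
pose h (v : 'rV[R]_n.+1) : R * 'rV[R]_n := (v ord0 ord0, \row_i v ord0 (lift ord0 i)).
have hK : cancel (@cons_rV n) h.
  move=> [x v]; rewrite /h cons_rV0; congr pair.
  by apply/rowP => i; rewrite mxE cons_rV1.
have mh : measurable_fun setT h.
  apply/measurable_fun_pairP; split; first exact: measurable_coord.
  apply: measurable_fun_rV => i; under eq_fun do rewrite mxE.
  exact: measurable_coord.
exists (fun k => h @^-1` (F k `*` G k)).
  rewrite -preimage_bigcup; apply/esym/seteqP; split => // v _.
  have [i _ Fi] : (\bigcup_i F i) (h v).1 by rewrite -TF.
  have [j _ Gj] : (\bigcup_i G i) (h v).2 by rewrite -TG.
  exists (maxn i j) => //; split.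
    by move: Fi; exact/subsetPset/ndF/leq_maxl.
  by move: Gj; exact/subsetPset/ndG/leq_maxr.
move=> k; have [mF Foo'] := Foo k; have [mG Goo'] := Goo k; split.
  by rewrite -[X in measurable X]setTI; apply: mh => //; exact: measurableX.
rewrite /lebesgue_step /pushforward -comp_preimage.
rewrite (_ : h \o @cons_rV n = id); last exact/funext.
by rewrite preimage_id product_measure1E// lte_mul_pinfty// ge0_fin_numE.
Qed.

HB.instance Definition _ := Measure_isSigmaFinite.Build _ _ _ lebesgue_step
  lebesgue_step_sigma_finite.

End step.

Fixpoint lebesgue_rV (n : nat) : {sigma_finite_measure set 'rV[R]_n -> \bar R} :=
  if n is k.+1 then lebesgue_step (lebesgue_rV k) else \d_(0 : 'rV[R]_0).

Lemma lebesgue_rV_box (n : nat) (A : 'I_n -> set R) :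
  (forall i, measurable (A i)) ->
  lebesgue_rV n [set x | forall i, A i (x ord0 i)] =
  (\prod_(i < n) lebesgue_measure (A i))%E.
Proof.
elim: n A => [|n IH] A mA.
  by rewrite big_ord0 /= diracE mem_set//=; case.
pose B := [set x : 'rV[R]_n | forall i, A (lift ord0 i) (x ord0 i)].
have mB : measurable B.
  rewrite (_ : B = \bigcap_(i in [set: 'I_n])
      (fun x : 'rV[R]_n => x ord0 i) @^-1` A (lift ord0 i)); last first.
    by apply/seteqP; split => x Bx i; [move=> _|]; exact: Bx.
  apply: fin_bigcap_measurable => // i _.
  by rewrite -[X in measurable X]setTI; exact: measurable_coord.
rewrite big_ord_recl -IH; last by move=> i.
transitivity ((@lebesgue_measure R \x lebesgue_rV n)%E (A ord0 `*` B)); last first.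
  rewrite (product_measure1E (@lebesgue_measure R) (lebesgue_rV n)) //; exact: mA.
rewrite /= /lebesgue_step /pushforward.
congr (product_measure1 (@lebesgue_measure R) (lebesgue_rV n) _).
apply/seteqP; split => -[x v] /=.
  move=> h; split => [|i]; first by rewrite -(cons_rV0 x v); exact: h.
  by rewrite -(cons_rV1 x v); exact: h.
move=> [Ax Bv] i; have [j ->|->] := unliftP ord0 i; last by rewrite cons_rV0.
by rewrite cons_rV1; exact: Bv.
Qed.

End lebesgue_rV.

Section euclidean.
Variables (R : realType) (n : nat).
Implicit Types x y : 'rV[R]_n.

Definition dotp x y : R := \sum_i x ord0 i * y ord0 i.

Definition enorm x : R := Num.sqrt (dotp x x).

Definition usphere : set 'rV[R]_n := [set x | enorm x = 1].

(* x |-> g(x/|x|) / |x|^k; the value at 0 is a dummy one. *)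
Definition homogeneous (g : 'rV[R]_n -> R) (k : nat) x : R :=
  g ((enorm x)^-1 *: x) / enorm x ^+ k.

Definition coercive (V : 'rV[R]_n -> R) :=
  forall M : R, exists r : R, forall x, r <= enorm x -> M <= V x.

End euclidean.

Section smooth.
Variables (R : realType) (n : nat).
Implicit Types f g phi : 'rV[R]_n -> R.

(* partial [:: i1; ...; ik] f = d_i1 (... (d_ik f)); lists of directions play
   the role of multi-indices, with |alpha| = size s. *)
Definition partial (s : seq 'I_n) f : 'rV[R]_n -> R :=
  foldr (fun i g x => 'D_(delta_mx ord0 i) g x) f s.

Definition smooth f := forall s x, differentiable (partial s f) x.

Definition test_function phi :=
  smooth phi /\ compact (closure [set x | phi x != 0]).

Definition rapidly_decreasing f :=
  forall s (k : nat), exists C : R, forall x, enorm x ^+ k * `|partial s f x| <= C.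

Definition weak_partial (s : seq 'I_n) f g :=
  forall phi, test_function phi ->
    \int[lebesgue_rV R n]_x (f x * partial s phi x) =
    (-1) ^+ size s * \int[lebesgue_rV R n]_x (g x * phi x).

Definition L2loc f :=
  measurable_fun setT f /\
  forall K, compact K -> (\int[lebesgue_rV R n]_(x in K) (f x ^+ 2)%:E < +oo)%E.

Definition Hloc (k : nat) f :=
  L2loc f /\
  forall s : seq 'I_n, (size s <= k)%N -> exists2 g, L2loc g & weak_partial s f g.

End smooth.

Section fourier.
Variables (R : realType) (n : nat).
Implicit Types u v phi : 'rV[R]_n -> R[i].

Definition cintegral u : R[i] :=
  Complex (\int[lebesgue_rV R n]_x complex.Re (u x))
          (\int[lebesgue_rV R n]_x complex.Im (u x)).

Definition expi (t : R) : R[i] := Complex (cos t) (sin t).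

Definition fourier v (xi : 'rV[R]_n) : R[i] :=
  cintegral (fun x => expi (- dotp x xi) * v x).

Definition schwartz phi :=
  [/\ smooth (fun x => complex.Re (phi x)), smooth (fun x => complex.Im (phi x)),
      rapidly_decreasing (fun x => complex.Re (phi x)) &
      rapidly_decreasing (fun x => complex.Im (phi x))].

(* F(u) = v as tempered distributions, for functions u and v that define
   tempered distributions by integration: <F(u), phi> = <u, F(phi)>. *)
Definition distributional_fourier u v :=
  forall phi, schwartz phi ->
    cintegral (fun x => u x * fourier phi x) =
    cintegral (fun xi => v xi * phi xi).

End fourier.

Section energy.
Variables (R : realType) (n : nat).

Definition kernelW (Psi : 'rV[R]_n -> R) (x : 'rV[R]_n) : \bar R :=
  if x == 0 then +oo%E else (homogeneous Psi (n - 2) x)%:E.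

Definition energy (W : 'rV[R]_n -> \bar R) (V : 'rV[R]_n -> R)
    (nu : probability 'rV[R]_n R) : \bar R :=
  (\int[nu]_x \int[nu]_y W (x - y)%R + \int[nu]_x (V x)%:E)%E.

Definition minimizer (E : probability 'rV[R]_n R -> \bar R)
    (mu : probability 'rV[R]_n R) := forall nu, (E mu <= E nu)%E.

Definition has_L2_density (mu : probability 'rV[R]_n R) :=
  mu `<< lebesgue_rV R n /\
  exists2 f : 'rV[R]_n -> R, (forall x, 0 <= f x) /\ f \in Lfun (lebesgue_rV R n) 2%:E &
    forall A, measurable A -> mu A = (\int[lebesgue_rV R n]_(x in A) (f x)%:E)%E.

End energy.

(* Main.v *)
(* Write f_t for the heat regularization of mu, A(t) for the integral of f_t^2, J(t)
   for the interaction energy of f_t and Phi(t) for its potential energy, V being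
   truncated by a smooth cutoff. Coercivity makes mu compactly supported, so that
   the normalized restriction of f_t to a large ball is a competitor up to O(t):
   E(mu) <= J(t) + Phi(t) + C t, while J(t) + Phi(t) tends to E(mu) as t tends to 0.
   In Fourier variables J' <= - m0 A, because |xi|^2 F(W) >= m0; by the heat
   equation Phi' is half the integral of (Delta V) f_t up to O(1), hence at most
   (m0 / 2) A + C because Delta V is locally square integrable. The mean value
   theorem then gives r_k -> 0 with A(r_k) <= C. Passing to the limit,
   2 int psi dmu <= int psi^2 + C for step functions psi on open sets, then on Borel
   sets by regularity, and this forces mu to have a density of L2 norm at most
   sqrt C. *)
Require Import Defs.
From HB Require Import structures.
From mathcomp Require Import all_boot all_order all_algebra.
From mathcomp Require Import complex.
From mathcomp Require Import all_classical all_reals all_analysis.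
From mathcomp Require Import measurable_realfun ring lra.

Set Implicit Arguments.
Unset Strict Implicit.
Unset Printing Implicit Defensive.

Import Order.TTheory GRing.Theory Num.Theory.
Import numFieldNormedType.Exports.

Local Open Scope classical_set_scope.
Local Open Scope ring_scope.

(** * Integration over row vectors and Gaussian integrals *)

(** Minimality enters only through comparisons with explicit competitors; no Euler-Lagrange equation
    is used. Two obstacles shape the proof. The Fourier hypothesis speaks of Schwartz functions
    only: it is tested against Gaussians times cosines, which yields the transform of the even part
    of the regularized kernel, enough once it is integrated against the symmetric measure mu x mu.
    And V has no pointwise Laplacian: its weak one is reached by taking the heat kernel times the
    cutoff as a test function. By Young's inequality the loss due to V is an arbitrarily small
    multiple of A plus a constant, so half of the gain m0 A survives. The interaction energies
    converge by dominated convergence, because the convolution of W with a heat kernel is at most a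
    constant times W, uniformly in time. The mean value theorem controls A only at some times near
    0, and a sequence of such times is all that the final limit needs. Most identities are proved
    for nonnegative integrands with values in the extended reals, where Tonelli's theorem needs no
    integrability. *)

Section lebesgue_shift.
Variable R : realType.
Implicit Types c : R.

(** Uniqueness of Lebesgue measure: it is determined by its values on half-open intervals, whose
    lengths a translation preserves. *)
Lemma lebesgue_measure_shift c (A : set (measurableTypeR R)) : measurable A ->
  pushforward (@lebesgue_measure R) (fun u : measurableTypeR R => u + c : measurableTypeR R) A = lebesgue_measure A.
Proof.
move=> mA.
have mc : measurable_fun setT (fun u : measurableTypeR R => u + c : measurableTypeR R).
  exact: measurable_funD.
apply/esym.
pose f : {mfun (measurableTypeR R) >-> (measurableTypeR R)} := HB.pack (fun u : measurableTypeR R => u + c : measurableTypeR R) (isMeasurableFun.Build _ _ _ _ _ mc).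
apply: (@lebesgue_measure_unique R (pushforward (@lebesgue_measure R) f)) => //.
move=> X [[a b] /= ab <-].
rewrite /pushforward.
have -> : (fun u : measurableTypeR R => u + c : measurableTypeR R) @^-1` `]a, b]%classic = `](a - c), (b - c)]%classic.
  by apply/seteqP; split=> u /=; by rewrite !in_itv/= ltrBlDr lerBrDr.
rewrite !lebesgue_measure_itv/= !lte_fin ltrD2r -!EFinD.
by case: ifP => // _; congr EFin; lra.
Qed.

Lemma ge0_integral_shift c (h : R -> \bar R) :
  measurable_fun setT h -> (forall u, 0 <= h u)%E ->
  (\int[@lebesgue_measure R]_u h (u + c)%R = \int[@lebesgue_measure R]_u h u)%E.
Proof.
move=> mh h0.
have mc : measurable_fun setT (fun u : measurableTypeR R => u + c : measurableTypeR R).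
  exact: measurable_funD.
pose f : {mfun (measurableTypeR R) >-> (measurableTypeR R)} := HB.pack (fun u : measurableTypeR R => u + c : measurableTypeR R) (isMeasurableFun.Build _ _ _ _ _ mc).
rewrite -[LHS](@ge0_integral_pushforward _ _ _ _ R _ mc lebesgue_measure setT h) //.
apply: (@eq_measure_integral _ _ _ _ _ (pushforward (@lebesgue_measure R) f)) => A mA _.
exact: lebesgue_measure_shift mA.
Qed.

End lebesgue_shift.

Section integral_rV.
Variable R : realType.

Let cons' n : (measurableTypeR R * 'rV[R]_n)%type -> 'rV[R]_n.+1 := @cons_rV R n.

Let measurable_cons' n : measurable_fun setT (@cons' n).
Proof. exact: (@measurable_cons_rV R n). Qed.

(** Tonelli for the first coordinate. Both inductions on the dimension, for translation invariance
    and for Gaussian integrals, go through it. *)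
Lemma ge0_integral_rVS n (h : 'rV[R]_n.+1 -> \bar R) :
  measurable_fun setT h -> (forall x, 0 <= h x)%E ->
  (\int[lebesgue_rV R n.+1]_x h x =
   \int[@lebesgue_measure R]_u \int[lebesgue_rV R n]_v h (cons_rV (u, v)))%E.
Proof.
move=> mh h0.
pose f : {mfun (measurableTypeR R * 'rV[R]_n)%type >-> 'rV[R]_n.+1} :=
  HB.pack (@cons' n) (isMeasurableFun.Build _ _ _ _ _ (@measurable_cons' n)).
transitivity (\int[pushforward (@lebesgue_measure R \x lebesgue_rV R n)%E f]_x h x)%E.
  by apply: eq_measure_integral.
rewrite (ge0_integral_pushforward (@measurable_cons' n)) // preimage_setT.
rewrite (fubini_tonelli1 (h \o @cons' n)) //.
  by apply: (measurableT_comp mh); exact: measurable_cons'.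
by move=> p; exact: h0.
Qed.

Lemma measurable_integral_rV n (h : 'rV[R]_n.+1 -> \bar R) :
  measurable_fun setT h -> (forall x, 0 <= h x)%E ->
  measurable_fun setT (fun u : measurableTypeR R => \int[lebesgue_rV R n]_v h (cons_rV (u, v)))%E.
Proof.
move=> mh h0.
apply: (measurable_fun_fubini_tonelli_F (h \o @cons' n)) => //.
  by apply: (measurableT_comp mh); exact: measurable_cons'.
by move=> p; exact: h0.
Qed.

Lemma ge0_integral_rV0 (h : 'rV[R]_0 -> \bar R) :
  measurable_fun setT h -> (\int[lebesgue_rV R 0]_x h x = h 0%R)%E.
Proof. by move=> mh; rewrite integral_dirac// diracT mul1e. Qed.

Lemma measurable_fun_addrV n (c : 'rV[R]_n) : measurable_fun setT (fun x : 'rV[R]_n => x + c).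
Proof.
apply: measurable_fun_rV => i; under eq_fun do rewrite mxE.
by apply: measurable_funD => //; exact: measurable_coord.
Qed.

Lemma cons_rVD n u u' (v v' : 'rV[R]_n) :
  cons_rV (u, v) + cons_rV (u', v') = cons_rV (u + u', v + v').
Proof.
apply/rowP => i; rewrite mxE; have [j ->|->] := unliftP ord0 i.
  by rewrite !cons_rV1 mxE.
by rewrite !cons_rV0.
Qed.

Lemma cons_rV_surj n (x : 'rV[R]_n.+1) : exists p, x = cons_rV p.
Proof.
exists (x ord0 ord0, \row_i x ord0 (lift ord0 i)).
apply/rowP => i; have [j ->|->] := unliftP ord0 i.
  by rewrite cons_rV1 mxE.
by rewrite cons_rV0.
Qed.

Lemma dotp_cons n u u' (v v' : 'rV[R]_n) :
  dotp (cons_rV (u, v)) (cons_rV (u', v')) = u * u' + dotp v v'.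
Proof.
rewrite /dotp big_ord_recl !cons_rV0; congr (_ + _).
by apply: eq_bigr => i _; rewrite !cons_rV1.
Qed.

Lemma ge0_integral_rV_shift n (c : 'rV[R]_n) (h : 'rV[R]_n -> \bar R) :
  measurable_fun setT h -> (forall x, 0 <= h x)%E ->
  (\int[lebesgue_rV R n]_x h (x + c)%R = \int[lebesgue_rV R n]_x h x)%E.
Proof.
elim: n c h => [|n IH] c h mh h0.
  apply: eq_integral => x _; congr h; apply/rowP; case=> //.
have mhc : measurable_fun setT (fun x : 'rV[R]_n.+1 => h (x + c)).
  by apply: (measurableT_comp mh); exact: measurable_fun_addrV.
rewrite (ge0_integral_rVS mhc); last by move=> x; exact: h0.
rewrite (ge0_integral_rVS mh h0).
have [[u' v'] ->] := cons_rV_surj c.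
rewrite -[RHS](ge0_integral_shift u'); last 2 first.
- exact: measurable_integral_rV.
- by move=> u; exact: integral_ge0.
apply: eq_integral => u _.
under eq_integral do rewrite cons_rVD.
apply: (IH v' (fun v => h (cons_rV (u + u', v)))) => //.
apply: (measurableT_comp mh); apply: (measurableT_comp (@measurable_cons' n)); exact: measurable_fun_pair.
Qed.

End integral_rV.

Section derive_under_integral.
Context {R : realType} d {Y : measurableType d} {mu : {measure set Y -> \bar R}}.

(** Existence and value of the derivative in one statement. The domination is asked only on an
    interval around [a], so that it may degenerate as time tends to 0. *)
Lemma is_derive_under_integral (f df : R -> Y -> R) (G : Y -> R) (a u v : R) :
  u < a < v ->
  (forall x, u < x < v -> mu.-integrable setT (EFin \o f x)) ->
  (forall x y, u < x < v -> is_derive x 1 (f ^~ y) (df x y)) ->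
  mu.-integrable setT (EFin \o G) ->
  (forall x y, u < x < v -> `|df x y| <= G y) ->
  is_derive a 1 (fun x => \int[mu]_y f x y) (\int[mu]_y df a y).
Proof.
move=> auv intf derf intG fG.
have Iauv : `]u, v[%classic a by rewrite /= in_itv.
have IE x : `]u, v[%classic x -> u < x < v by rewrite /= in_itv.
have intf' x : `]u, v[%classic x -> mu.-integrable setT (EFin \o f x) by move/IE; exact: intf.
have der' x y : `]u, v[%classic x -> setT y -> derivable (f ^~ y) x 1.
  by move=> /IE h _; have [] := derf x y h.
have d1E x y : u < x < v -> partial1of2 f x y = df x y.
  by move=> h; rewrite partial1of2E; have [_ ->] := derf x y h.
have G0 y : 0 <= G y by apply: le_trans (fG a y auv).
have Gub x y : `]u, v[%classic x -> setT y -> `|partial1of2 f x y| <= G y.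
  by move=> /IE h _; rewrite d1E// fG.
split; first exact: (derivable_under_integral measurableT Iauv intf' der' G0 intG Gub).
rewrite -derive1E (differentiation_under_integral measurableT Iauv intf' der' G0 intG Gub).
by apply: eq_Rintegral => y _; rewrite d1E.
Qed.

End derive_under_integral.

Lemma measurable_cos (R : realType) : measurable_fun setT (@cos R).
Proof. by apply: continuous_measurable_fun; exact: continuous_cos. Qed.

Lemma measurable_sin (R : realType) : measurable_fun setT (@sin R).
Proof. by apply: continuous_measurable_fun; exact: continuous_sin. Qed.

Section integrable_real.
Context d (T : measurableType d) (R : realType) (mu : {measure set T -> \bar R}).
Implicit Types f G : T -> R.

Lemma integrable_dominated f G :
  measurable_fun setT f -> mu.-integrable setT (EFin \o G) -> (forall x, `|f x| <= G x) ->
  mu.-integrable setT (EFin \o f).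
Proof.
move=> mf iG fG; apply: (le_integrable measurableT _ _ iG) => /=.
  by apply/measurable_EFinP.
by move=> x _; rewrite lee_fin (le_trans (fG x))// ler_norm.
Qed.

Lemma integrable_mulrl (k : R) f :
  mu.-integrable setT (EFin \o f) -> mu.-integrable setT (EFin \o (fun x => k * f x)).
Proof.
move=> fi; have -> : EFin \o (fun x => k * f x) = (fun x => k%:E * (f x)%:E)%E by [].
exact: integrableZl.
Qed.

End integrable_real.

(** * Gaussian integrals in one variable *)

Section gauss_fourier1.
Variables (R : realType) (a : R).
Hypothesis a0 : 0 < a.
Local Notation g u := (expR (- (a * u ^+ 2))).

Lemma expR_ge_id (x : R) : x <= expR x.
Proof. by apply: le_trans (expR_ge1Dx x); lra. Qed.

Lemma integral_gauss1 : (\int[@lebesgue_measure R]_u (g u)%:E = (Num.sqrt (pi / a))%:E)%E.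
Proof.
(* The standard deviation for which the normal density is proportional to exp(-a u^2). *)
pose s := Num.sqrt (2 * a)^-1.
have s2 : s ^+ 2 = (2 * a)^-1 by rewrite sqr_sqrtr// invr_ge0 mulr_ge0// ltW.
have s0 : s != 0 by rewrite gt_eqF// sqrtr_gt0 invr_gt0 mulr_gt0.
have pk : normal_peak s = (Num.sqrt (pi / a))^-1.
  by rewrite /normal_peak s2; congr (_^-1); congr Num.sqrt; field; rewrite gt_eqF.
have pos : 0 < Num.sqrt (pi / a) by rewrite sqrtr_gt0 divr_gt0// pi_gt0.
have := integral_normal_pdf (0 : R) s.
rewrite (normal_pdfE _ s0).
have -> : (fun x => (normal_peak s * normal_fun 0 s x)%:E) = (fun x => (Num.sqrt (pi / a))^-1%:E * (g x)%:E)%E.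
  apply/funext => x; rewrite pk /normal_fun s2 -EFinM; congr (_ * expR _)%:E.
  by rewrite subr0; field; rewrite gt_eqF.
rewrite ge0_integralZl_EFin//; last first.
- by apply/measurable_EFinP; apply: measurableT_comp => //; apply: measurableT_comp => //; apply: measurable_funM => //; exact: measurable_funX.
move=> /(congr1 (fun y => (Num.sqrt (pi / a))%:E * y)%E).
by rewrite muleA -EFinM mulfV ?gt_eqF// mul1e mule1.
Qed.

Lemma measurable_gauss1 : measurable_fun setT (fun u : measurableTypeR R => g u).
Proof.
by apply: measurableT_comp => //; apply: measurableT_comp => //; apply: measurable_funM => //; exact: measurable_funX.
Qed.

Lemma integrable_gauss1 : (@lebesgue_measure R).-integrable setT (fun u => (g u)%:E).
Proof.
apply/integrableP; split; first by apply/measurable_EFinP; exact: measurable_gauss1.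
under eq_integral do rewrite gee0_abs ?lee_fin ?expR_ge0//.
by rewrite integral_gauss1 ltry.
Qed.

End gauss_fourier1.

Section gauss_fourier1_shift.
Variables (R : realType) (a : R).
Hypothesis a0 : 0 < a.
Local Notation g u := (expR (- (a * u ^+ 2))).

Lemma integrable_gauss1_shift c : (@lebesgue_measure R).-integrable setT (fun u => (g (u + c))%:E).
Proof.
apply/integrableP; split.
  apply/measurable_EFinP; apply: (measurableT_comp (measurable_gauss1 a)).
  exact: measurable_funD.
under eq_integral do rewrite gee0_abs ?lee_fin ?expR_ge0//.
rewrite (ge0_integral_shift c (h := fun u => (g u)%:E)); last 2 first.
- by apply/measurable_EFinP; exact: measurable_gauss1.
- by move=> u; rewrite lee_fin expR_ge0.
by rewrite integral_gauss1// ltry.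
Qed.

(** Half of the Gaussian absorbs the linear factor: |w| <= 1 + w^2, and (a/2) w^2 <= exp((a/2)
    w^2). *)
Lemma normr_gauss1_le (w : R) : `|w| * g w <= (1 + 2 / a) * expR (- (a / 2 * w ^+ 2)).
Proof.
have -> : - (a * w ^+ 2) = - (a / 2 * w ^+ 2) + - (a / 2 * w ^+ 2) by lra.
rewrite expRD mulrA ler_wpM2r ?expR_ge0//.
have h1 : a / 2 * w ^+ 2 <= expR (a / 2 * w ^+ 2) by exact: expR_ge_id.
have h2 : `|w| <= 1 + w ^+ 2.
  by rewrite -(real_normK (num_real w)); have := sqr_ge0 (`|w| - 1); have := normr_ge0 w; nra.
have h3 : w ^+ 2 <= 2 / a * expR (a / 2 * w ^+ 2).
  by rewrite mulrAC ler_pdivlMr//; lra.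
have h4 : expR (- (a / 2 * w ^+ 2)) <= 1 by rewrite -expR0 ler_expR oppr_le0 mulr_ge0 ?sqr_ge0// divr_ge0// ltW.
have h5 : expR (- (a / 2 * w ^+ 2)) * expR (a / 2 * w ^+ 2) = 1 by rewrite -expRD addNr expR0.
have h6 : 0 < expR (- (a / 2 * w ^+ 2)) by exact: expR_gt0.
have : `|w| * expR (- (a / 2 * w ^+ 2)) <= (1 + 2 / a * expR (a / 2 * w ^+ 2)) * expR (- (a / 2 * w ^+ 2)).
  by rewrite ler_wpM2r ?expR_ge0//; lra.
move/le_trans; apply.
have -> : (1 + 2 / a * expR (a / 2 * w ^+ 2)) * expR (- (a / 2 * w ^+ 2)) = expR (- (a / 2 * w ^+ 2)) + 2 / a * (expR (- (a / 2 * w ^+ 2)) * expR (a / 2 * w ^+ 2)) by ring.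
by rewrite h5 mulr1; lra.
Qed.

(** A bound uniform in the shift, hence usable as a domination: u^2 <= 2 (u + c)^2 + 2 c^2 trades
    the shift for the constant exp(a/2) and half of the decay rate. *)
Lemma normr_gauss1_shift_le (c u : R) : `|c| <= 1 ->
  `|u + c| * g (u + c) <= (1 + 2 / a) * expR (a / 2) * expR (- (a / 4 * u ^+ 2)).
Proof.
move=> c1; apply: le_trans (normr_gauss1_le _) _.
rewrite -[leRHS]mulrA; apply: ler_wpM2l; first by rewrite addr_ge0// divr_ge0// ltW.
rewrite -expRD ler_expR.
have c2 : c ^+ 2 <= 1 by rewrite -(real_normK (num_real c)) expr_le1.
have h : u ^+ 2 <= 2 * (u + c) ^+ 2 + 2 * c ^+ 2.
  by have := sqr_ge0 (u + 2 * c); nra.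
have := ler_wpM2l (ltW a0) h; have := ler_wpM2l (ltW a0) c2; lra.
Qed.

Lemma gauss1_shift_le (c u : R) : `|c| <= 1 ->
  g (u + c) <= expR (a / 2) * expR (- (a / 4 * u ^+ 2)).
Proof.
move=> c1; rewrite -expRD ler_expR.
have c2 : c ^+ 2 <= 1 by rewrite -(real_normK (num_real c)) expr_le1.
have h : u ^+ 2 <= 2 * (u + c) ^+ 2 + 2 * c ^+ 2.
  by have := sqr_ge0 (u + 2 * c); nra.
have w0 := sqr_ge0 (u + c).
have := ler_wpM2l (ltW a0) h; have := ler_wpM2l (ltW a0) c2; have := mulr_ge0 (ltW a0) w0; lra.
Qed.

Lemma is_derive_gauss1 (x : R) : is_derive x 1 (fun u : R => g u) (- (2 * a * x) * g x).
Proof.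
have h : is_derive x 1 (fun u : R => - (a * u ^+ 2)) (- (2 * a * x)).
  by apply: is_derive_eq; rewrite /GRing.scale/=; ring.
by have h2 := @is_derive1_comp R expR (fun u => - (a * u ^+ 2)) x _ _ (is_derive_expR _) h; apply: (is_derive_eq h2); ring.
Qed.

Lemma is_derive_cos_lin (p q x : R) : is_derive x 1 (fun u : R => cos (p * u + q)) (- (p * sin (p * x + q))).
Proof.
have h : is_derive x 1 (fun u : R => p * u + q) p by apply: is_derive_eq; rewrite /GRing.scale/= mulr1 addr0.
by have h2 := @is_derive1_comp R cos (fun u => p * u + q) x _ _ (is_derive_cos _) h; apply: (is_derive_eq h2); ring.
Qed.

Lemma is_derive_sin_lin (p q x : R) : is_derive x 1 (fun u : R => sin (p * u + q)) (p * cos (p * x + q)).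
Proof.
have h : is_derive x 1 (fun u : R => p * u + q) p by apply: is_derive_eq; rewrite /GRing.scale/= mulr1 addr0.
by have h2 := @is_derive1_comp R sin (fun u => p * u + q) x _ _ (is_derive_sin _) h; apply: (is_derive_eq h2); ring.
Qed.

Lemma integrable_gaussK (K b : R) : 0 < b ->
  (@lebesgue_measure R).-integrable setT (EFin \o (fun u => K * expR (- (b * u ^+ 2)))).
Proof.
by move=> b0; apply: integrable_mulrl; exact: integrable_gauss1.
Qed.

Lemma measurable_affine (p q : R) : measurable_fun setT (fun u : measurableTypeR R => p * u + q).
Proof. by apply: measurable_funD => //; exact: measurable_funM. Qed.

(** An integration by parts in disguise: the integrand is the derivative of sin(z u + th) exp(-a
    u^2), and its integral is the derivative at c = 0 of the integral of the translate by c, which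
    does not depend on c. *)
Lemma integral_sin_gauss1_shift (z th : R) :
  \int[@lebesgue_measure R]_u ((z * cos (z * u + th) - 2 * a * u * sin (z * u + th)) * g u) = 0.
Proof.
pose f c u := sin (z * (u + c) + th) * g (u + c).
pose df c u := (z * cos (z * (u + c) + th) - 2 * a * (u + c) * sin (z * (u + c) + th)) * g (u + c).
pose K := `|z| * expR (a / 2) + 2 * a * ((1 + 2 / a) * expR (a / 2)).
have mlin c : measurable_fun setT (fun u : measurableTypeR R => u + c) by exact: measurable_funD.
have mg c : measurable_fun setT (fun u : measurableTypeR R => g (u + c)).
  exact: (measurableT_comp (measurable_gauss1 a) (mlin c)).
have mf c : measurable_fun setT (f c : measurableTypeR R -> R).
  apply: measurable_funM => //; apply: (measurableT_comp (@measurable_sin R)); apply: measurable_funD => //.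
  by apply: measurable_funM.
have der : is_derive (0 : R) 1 (fun c => \int[@lebesgue_measure R]_u f c u) (\int[@lebesgue_measure R]_u df 0 u).
  apply: (@is_derive_under_integral R _ (measurableTypeR R) (@lebesgue_measure R) f df (fun u => K * expR (- (a / 4 * u ^+ 2))) 0 (-1) 1); first by rewrite ltrN10 ltr01.
  - move=> c _; apply: (integrable_dominated (mf c) (integrable_gauss1_shift c)) => u.
    rewrite normrM (ger0_norm (expR_ge0 _)) ler_piMl ?expR_ge0//.
    by rewrite ler_norml sin_geN1 sin_le1.
  - move=> c u _.
    have e1 : f ^~ u = (fun c => sin (z * c + (z * u + th)) * g (c + u)).
      by apply/funext => c'; rewrite /f; congr (sin _ * expR _); ring.
    rewrite e1.
    have h : is_derive c 1 (fun c : R => c + u) 1 by apply: is_derive_eq; rewrite addr0.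
    have h1 := @is_derive1_comp R (fun c => g c) (fun c => c + u) c _ _ (is_derive_gauss1 _) h.
    have h2 := is_derive_sin_lin z (z * u + th) c.
    have h3 := is_deriveM h2 h1.
    apply: (is_derive_eq h3); rewrite /GRing.scale/= /df.
    have -> : z * c + (z * u + th) = z * (u + c) + th by ring.
    by rewrite (addrC c u); ring.
  - by apply: integrable_gaussK; rewrite divr_gt0.
  - move=> c u /andP[c1 c2]; have cc : `|c| <= 1 by rewrite ler_norml; apply/andP; split; lra.
    rewrite /df mulrBl (le_trans (ler_normB _ _))// !normrM (ger0_norm (expR_ge0 _)) /K [leRHS]mulrDl.
    apply: lerD.
      rewrite -!(mulrA `|z|); apply: ler_wpM2l => //.
      apply: le_trans (gauss1_shift_le u cc).
      by rewrite ler_piMl ?expR_ge0// ler_norml cos_geN1 cos_le1.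
    rewrite (ger0_norm (ltW a0)) (ger0_norm (ler0n R 2)).
    have := ler_wpM2l (ltW (mulr_gt0 (ltr0n R 2) a0)) (normr_gauss1_shift_le u cc).
    rewrite (mulrA (2 * a)) (mulrA (2 * a)); apply: le_trans.
    apply: ler_wpM2r; rewrite ?expR_ge0//.
    by rewrite ler_piMr ?mulr_ge0 ?(ltW a0)// ler_norml sin_geN1 sin_le1.
(* Translation invariance is available for nonnegative functions, so sin is split as (1 + sin) -
   1. *)
have cstf c : \int[@lebesgue_measure R]_u f c u = \int[@lebesgue_measure R]_u f 0 u.
  pose k u := (g u)%:E; pose l u := ((1 + sin (z * u + th)) * g u)%:E.
  have mk : measurable_fun setT k by apply/measurable_EFinP; exact: measurable_gauss1.
  have ml : measurable_fun setT l.
    apply/measurable_EFinP; apply: measurable_funM; last exact: measurable_gauss1.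
    by apply: measurable_funD => //; apply: (measurableT_comp (@measurable_sin R)); exact: measurable_affine.
  have l0 u : (0 <= l u)%E.
    by rewrite lee_fin mulr_ge0 ?expR_ge0//; have := sin_geN1 (z * u + th); lra.
  have k0 u : (0 <= k u)%E by rewrite lee_fin expR_ge0.
  have key c' : \int[@lebesgue_measure R]_u f c' u = fine (\int[@lebesgue_measure R]_u l u) - fine (\int[@lebesgue_measure R]_u k u).
    rewrite -(ge0_integral_shift c' ml l0) -(ge0_integral_shift c' mk k0).
    transitivity (\int[@lebesgue_measure R]_u ((1 + sin (z * (u + c') + th)) * g (u + c') - g (u + c'))).
      by apply: eq_Rintegral => u _; rewrite /f; ring.
    apply: RintegralB => //.
    + have i2 := integrable_gaussK 2 a0.
      apply: (integrable_dominated (G := fun u : measurableTypeR R => 2 * g (u + c'))).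
      * apply: measurable_funM => //; apply: measurable_funD => //; apply: (measurableT_comp (@measurable_sin R)).
        by apply: measurable_funD => //; exact: measurable_funM.
      * by apply: integrable_mulrl; exact: integrable_gauss1_shift.
      * move=> u; rewrite normrM (ger0_norm (expR_ge0 _)); apply: ler_wpM2r; rewrite ?expR_ge0//.
        have := sin_geN1 (z * (u + c') + th); have := sin_le1 (z * (u + c') + th) => h1 h2.
        by rewrite ger0_norm; lra.
    + exact: integrable_gauss1_shift.
  by rewrite !key.
have [_ dE] := der; have := derive_cst (\int[@lebesgue_measure R]_u f 0 u) (0 : R) (1 : R).
rewrite (_ : cst _ = (fun c => \int[@lebesgue_measure R]_u f c u)); last by apply/funext => c; rewrite cstf.
rewrite dE => E0; rewrite -[RHS]E0; apply: eq_Rintegral => u _; rewrite /df !addr0 //.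
Qed.

(** By the previous identity the integral J(z) solves J' = -(z / 2a) J, so J(z) exp(z^2 / 4a) is
    constant, and J(0) is the plain Gaussian integral. The phase [th] makes room for the other
    coordinates in higher dimension. *)
Lemma integral_cos_gauss1 (z th : R) :
  \int[@lebesgue_measure R]_u (cos (z * u + th) * g u) =
  cos th * Num.sqrt (pi / a) * expR (- (z ^+ 2 / (4 * a))).
Proof.
pose J z := \int[@lebesgue_measure R]_u (cos (z * u + th) * g u).
have mcos x : measurable_fun setT (fun u : measurableTypeR R => cos (x * u + th) * g u).
  apply: measurable_funM; last exact: measurable_gauss1.
  by apply: (measurableT_comp (@measurable_cos R)); exact: measurable_affine.
have msin x : measurable_fun setT (fun u : measurableTypeR R => u * sin (x * u + th) * g u).
  apply: measurable_funM; last exact: measurable_gauss1.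
  by apply: measurable_funM => //; apply: (measurableT_comp (@measurable_sin R)); exact: measurable_affine.
have icos x : (@lebesgue_measure R).-integrable setT (EFin \o (fun u => cos (x * u + th) * g u)).
  apply: (integrable_dominated (mcos x) (integrable_gauss1 a0)) => u.
  by rewrite normrM (ger0_norm (expR_ge0 _)) ler_piMl ?expR_ge0// ler_norml cos_geN1 cos_le1.
have bsin x u : `|u * sin (x * u + th) * g u| <= (1 + 2 / a) * expR (- (a / 2 * u ^+ 2)).
  apply: le_trans (normr_gauss1_le u); rewrite !normrM (ger0_norm (expR_ge0 _)).
  apply: ler_wpM2r; rewrite ?expR_ge0//.
  by rewrite ler_piMr// ler_norml sin_geN1 sin_le1.
have isin x : (@lebesgue_measure R).-integrable setT (EFin \o (fun u => u * sin (x * u + th) * g u)).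
  apply: (integrable_dominated (msin x) _ (bsin x)).
  by apply: integrable_gaussK; rewrite divr_gt0.
have derJ (x : R) : is_derive x 1 J (- (x / (2 * a)) * J x).
  have h : is_derive x 1 J (\int[@lebesgue_measure R]_u (- (u * sin (x * u + th) * g u))).
    apply: (@is_derive_under_integral R _ (measurableTypeR R) (@lebesgue_measure R) (fun x u => cos (x * u + th) * g u) (fun x u => - (u * sin (x * u + th) * g u)) (fun u => (1 + 2 / a) * expR (- (a / 2 * u ^+ 2))) x (x - 1) (x + 1)).
    - by apply/andP; split; lra.
    - by move=> y _; exact: icos.
    - move=> y u _.
      have -> : (fun y => cos (y * u + th) * g u) = (fun y => cos (u * y + th) * g u) by apply/funext => y'; rewrite (mulrC y').
      have h1 := is_derive_cos_lin u th y.
      have h2 := is_deriveM h1 (is_derive_cst (g u) y 1).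
      by apply: (is_derive_eq h2); rewrite /GRing.scale/= (mulrC y); ring.
    - by apply: integrable_gaussK; rewrite divr_gt0.
    - by move=> y u _; rewrite normrN.
  apply: (is_derive_eq h).
  have := integral_sin_gauss1_shift x th.
  have -> : \int[@lebesgue_measure R]_u ((x * cos (x * u + th) - 2 * a * u * sin (x * u + th)) * g u) =
     x * J x - 2 * a * \int[@lebesgue_measure R]_u (u * sin (x * u + th) * g u).
    rewrite -!RintegralZl// -RintegralB//.
    - by apply: eq_Rintegral => u _; ring.
    - exact: integrable_mulrl.
    - exact: integrable_mulrl.
  move=> E.
  have -> : \int[@lebesgue_measure R]_u (- (u * sin (x * u + th) * g u)) = - \int[@lebesgue_measure R]_u (u * sin (x * u + th) * g u).
    rewrite -mulN1r -RintegralZl//; by apply: eq_Rintegral => u _; rewrite mulN1r.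
  move: E; set S := \int[_]_u _ => E.
  have a2 : 2 * a != 0 by rewrite gt_eqF// mulr_gt0.
  apply: (mulfI a2); rewrite mulrN -(subr0_eq E); field; rewrite gt_eqF//.
have cstJ : forall x, J x * expR (x ^+ 2 / (4 * a)) = J 0 * expR (0 ^+ 2 / (4 * a)).
  move=> x; apply: (@is_derive_0_is_cst R (fun x => J x * expR (x ^+ 2 / (4 * a)))) => y.
  have h0 : is_derive y 1 (fun x : R => x ^+ 2 / (4 * a)) (2 * y / (4 * a)).
    by apply: is_derive_eq; rewrite /GRing.scale/=; field; rewrite gt_eqF.
  have h1 := @is_derive1_comp R expR (fun x => x ^+ 2 / (4 * a)) y _ _ (is_derive_expR _) h0.
  have h2 := is_deriveM (derJ y) h1.
  by apply: (is_derive_eq h2); rewrite /GRing.scale/=; field; rewrite gt_eqF.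
have J0 : J 0 = cos th * Num.sqrt (pi / a).
  rewrite /J; under eq_Rintegral do rewrite mul0r add0r.
  by rewrite RintegralZl//; [rewrite /Rintegral integral_gauss1|exact: integrable_gauss1].
have := cstJ z; rewrite expr0n mul0r expR0 mulr1 J0 => <-.
by rewrite -mulrA -expRD subrr expR0 mulr1.
Qed.

End gauss_fourier1_shift.

Section gauss_fourier1E.
Variables (R : realType) (a : R).
Hypothesis a0 : 0 < a.

Lemma ge0_integral_cos_gauss1 (z th c d : R) :
  (\int[@lebesgue_measure R]_u ((c + d * cos (z * u + th)) * expR (- (a * u ^+ 2)))%:E =
   (Num.sqrt (pi / a) * (c + d * expR (- (z ^+ 2 / (4 * a))) * cos th))%:E)%E.
Proof.
have mcos : measurable_fun setT (fun u : measurableTypeR R => cos (z * u + th) * expR (- (a * u ^+ 2))).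
  apply: measurable_funM; last exact: measurable_gauss1.
  by apply: (measurableT_comp (@measurable_cos R)); exact: measurable_affine.
have ig := integrable_gauss1 a0.
have icos : (@lebesgue_measure R).-integrable setT (EFin \o (fun u => cos (z * u + th) * expR (- (a * u ^+ 2)))).
  apply: (integrable_dominated mcos ig) => u.
  by rewrite normrM (ger0_norm (expR_ge0 _)) ler_piMl ?expR_ge0// ler_norml cos_geN1 cos_le1.
have ih := integrableD measurableT (integrable_mulrl c ig) (integrable_mulrl d icos).
have E : (fun u : measurableTypeR R => ((c + d * cos (z * u + th)) * expR (- (a * u ^+ 2)))%:E) =
  (EFin \o (fun u => c * expR (- (a * u ^+ 2)))) \+ (EFin \o (fun u => d * (cos (z * u + th) * expR (- (a * u ^+ 2))))).
  by apply/funext => u /=; rewrite -EFinD; congr EFin; ring.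
rewrite E -(fineK (integrable_fin_num measurableT ih)); congr EFin.
rewrite -[LHS]/(\int[@lebesgue_measure R]_x (c * expR (- (a * x ^+ 2)) + d * (cos (z * x + th) * expR (- (a * x ^+ 2))))).
rewrite RintegralD//; [|exact: integrable_mulrl|exact: integrable_mulrl].
rewrite !RintegralZl// integral_cos_gauss1// /Rintegral integral_gauss1//=.
by ring.
Qed.

End gauss_fourier1E.

Section rV_measurable.
Variable R : realType.

Lemma measurable_rV_coord d (T : measurableType d) n (f : T -> 'rV[R]_n) i :
  measurable_fun setT f -> measurable_fun setT (fun t => f t ord0 i).
Proof. by move=> mf; apply: (measurableT_comp (measurable_coord i)). Qed.

Lemma measurable_dotp d (T : measurableType d) n (f g : T -> 'rV[R]_n) :
  measurable_fun setT f -> measurable_fun setT g ->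
  measurable_fun setT (fun t => dotp (f t) (g t)).
Proof.
move=> mf mg; apply: measurable_sum => i; apply: measurable_funM.
  exact: measurable_rV_coord.
exact: measurable_rV_coord.
Qed.

Lemma measurable_rVD d (T : measurableType d) n (f g : T -> 'rV[R]_n) :
  measurable_fun setT f -> measurable_fun setT g -> measurable_fun setT (fun t => f t + g t).
Proof.
move=> mf mg; apply: measurable_fun_rV => i; under eq_fun do rewrite mxE.
by apply: measurable_funD; exact: measurable_rV_coord.
Qed.

Lemma measurable_rVN d (T : measurableType d) n (f : T -> 'rV[R]_n) :
  measurable_fun setT f -> measurable_fun setT (fun t => - f t).
Proof.
move=> mf; apply: measurable_fun_rV => i; under eq_fun do rewrite mxE.
by apply: measurableT_comp => //; exact: measurable_rV_coord.
Qed.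

Lemma measurable_rVB d (T : measurableType d) n (f g : T -> 'rV[R]_n) :
  measurable_fun setT f -> measurable_fun setT g -> measurable_fun setT (fun t => f t - g t).
Proof. by move=> mf mg; apply: measurable_rVD => //; exact: measurable_rVN. Qed.

Lemma measurable_enorm d (T : measurableType d) n (f : T -> 'rV[R]_n) :
  measurable_fun setT f -> measurable_fun setT (fun t => enorm (f t)).
Proof.
move=> mf; apply: (measurableT_comp (continuous_measurable_fun (@sqrt_continuous R))).
exact: measurable_dotp.
Qed.

End rV_measurable.

Section dotp_theory.
Variables (R : realType) (n : nat).
Implicit Types x y z : 'rV[R]_n.

Lemma dotpC x y : dotp x y = dotp y x.
Proof. by apply: eq_bigr => i _; rewrite mulrC. Qed.

Lemma dotpDl x y z : dotp (x + y) z = dotp x z + dotp y z.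
Proof. by rewrite /dotp -big_split; apply: eq_bigr => i _; rewrite mxE mulrDl. Qed.

Lemma dotpDr x y z : dotp z (x + y) = dotp z x + dotp z y.
Proof. by rewrite !(dotpC z) dotpDl. Qed.

Lemma dotpZl k x y : dotp (k *: x) y = k * dotp x y.
Proof. by rewrite /dotp mulr_sumr; apply: eq_bigr => i _; rewrite mxE mulrA. Qed.

Lemma dotpZr k x y : dotp x (k *: y) = k * dotp x y.
Proof. by rewrite dotpC dotpZl dotpC. Qed.

Lemma dotpNl x y : dotp (- x) y = - dotp x y.
Proof. by rewrite -scaleN1r dotpZl mulN1r. Qed.

Lemma dotpNr x y : dotp x (- y) = - dotp x y.
Proof. by rewrite dotpC dotpNl dotpC. Qed.

Lemma dotp_ge0 x : 0 <= dotp x x.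
Proof. by apply: sumr_ge0 => i _; rewrite -expr2 sqr_ge0. Qed.

Lemma dotp_eq0 x : (dotp x x == 0) = (x == 0).
Proof.
apply/eqP/eqP => [/eqP|->]; last by rewrite /dotp big1// => i _; rewrite mxE mul0r.
rewrite psumr_eq0 => [/allP h|i _]; last by rewrite -expr2 sqr_ge0.
apply/rowP => i; rewrite mxE; have := h i (mem_index_enum i).
by rewrite /= -expr2 sqrf_eq0 => /eqP.
Qed.

Lemma sqr_coord_le x i : (x ord0 i) ^+ 2 <= dotp x x.
Proof.
rewrite /dotp (bigD1 i)//= -expr2 lerDl; apply: sumr_ge0 => j _.
by rewrite -expr2 sqr_ge0.
Qed.

Lemma sqr_enorm x : enorm x ^+ 2 = dotp x x.
Proof. by rewrite sqr_sqrtr// dotp_ge0. Qed.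

Lemma enorm_ge0 x : 0 <= enorm x.
Proof. exact: sqrtr_ge0. Qed.

Lemma enorm_eq0 x : (enorm x == 0) = (x == 0).
Proof. by rewrite sqrtr_eq0 -dotp_eq0 eq_le dotp_ge0 andbT. Qed.

Lemma enorm_gt0 x : (0 < enorm x) = (x != 0).
Proof. by rewrite lt_def enorm_ge0 andbT enorm_eq0. Qed.

Lemma enormZ k x : enorm (k *: x) = `|k| * enorm x.
Proof.
by rewrite /enorm dotpZl dotpZr mulrA -expr2 sqrtrM ?sqr_ge0// sqrtr_sqr.
Qed.

Lemma normr_coord_le x i : `|x ord0 i| <= enorm x.
Proof. by rewrite -sqrtr_sqr ler_sqrt ?dotp_ge0// sqr_coord_le. Qed.

End dotp_theory.

(** * The heat kernel *)

Section heat_kernel.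
Variables (R : realType).

(** The Gaussian density of variance t in each coordinate. It solves the heat equation with half the
    Laplacian, which is where the factors 2 in later statements come from. *)
Definition heat n (t : R) (x : 'rV[R]_n) : R :=
  (Num.sqrt (2 * pi * t))^-1 ^+ n * expR (- (dotp x x / (2 * t))).

Lemma measurable_expR_dotp n (k : R) : measurable_fun setT (fun x : 'rV[R]_n => expR (- (k * dotp x x))).
Proof.
apply: measurableT_comp => //; apply: measurableT_comp => //.
by apply: measurable_funM => //; exact: measurable_dotp.
Qed.

(** The condition |d| <= c keeps the integrand nonnegative, so that Tonelli applies. The shape c + d
    cos(. + th) is stable under the induction: the first coordinate enters the phase, and
    integrating out the others only rescales c and d. *)
Lemma ge0_integral_cos_gauss n (a th c d : R) (z : 'rV[R]_n) : 0 < a -> `|d| <= c ->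
  (\int[lebesgue_rV R n]_x ((c + d * cos (dotp z x + th)) * expR (- (a * dotp x x)))%:E =
   (Num.sqrt (pi / a) ^+ n * (c + d * expR (- (dotp z z / (4 * a))) * cos th))%:E)%E.
Proof.
move=> a0; elim: n z th c d => [|n IH] z th c d dc.
  rewrite ge0_integral_rV0.
    by rewrite /dotp !big_ord0 expr0 mul1r mulr0 mul0r oppr0 expR0 !mulr1 add0r.
  apply/measurable_EFinP; apply: measurable_funM; last exact: measurable_expR_dotp.
  apply: measurable_funD => //; apply: measurable_funM => //.
  by apply: (measurableT_comp (@measurable_cos R)); apply: measurable_funD => //; exact: measurable_dotp.
have m1 k th' (w : 'rV[R]_k) : measurable_fun setT (fun x : 'rV[R]_k => ((c + d * cos (dotp w x + th')) * expR (- (a * dotp x x)))%:E).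
  apply/measurable_EFinP; apply: measurable_funM; last exact: measurable_expR_dotp.
  apply: measurable_funD => //; apply: measurable_funM => //.
  by apply: (measurableT_comp (@measurable_cos R)); apply: measurable_funD => //; exact: measurable_dotp.
have p1 u : 0 <= c + d * cos u.
  have : `|d * cos u| <= c.
    by apply: le_trans dc; rewrite normrM ler_piMr// ler_norml cos_geN1 cos_le1.
  by rewrite ler_norml => /andP[h _]; lra.
rewrite ge0_integral_rVS//; last by move=> x; rewrite lee_fin mulr_ge0 ?expR_ge0.
have [[z0 z'] ->] := cons_rV_surj z.
pose P := Num.sqrt (pi / a); pose E' := expR (- (dotp z' z' / (4 * a))).
transitivity (\int[@lebesgue_measure R]_u ((P ^+ n * c + P ^+ n * d * E' * cos (z0 * u + th)) * expR (- (a * u ^+ 2)))%:E)%E.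
  apply: eq_integral => u _.
  transitivity (\int[lebesgue_rV R n]_v ((expR (- (a * u ^+ 2)))%:E * ((c + d * cos (dotp z' v + (z0 * u + th))) * expR (- (a * dotp v v)))%:E))%E.
    apply: eq_integral => v _; rewrite !dotp_cons -EFinM; congr EFin.
    rewrite (_ : - (a * (u * u + dotp v v)) = - (a * u ^+ 2) + - (a * dotp v v)); last by ring.
    rewrite expRD (_ : z0 * u + dotp z' v + th = dotp z' v + (z0 * u + th)); last by ring.
    by ring.
  rewrite ge0_integralZl_EFin ?expR_ge0//; last by move=> v _; rewrite lee_fin mulr_ge0 ?expR_ge0.
  by rewrite IH// -EFinM; congr EFin; rewrite -/P -/E'; ring.
rewrite ge0_integral_cos_gauss1// dotp_cons; congr EFin.
rewrite (_ : - ((z0 * z0 + dotp z' z') / (4 * a)) = - (z0 ^+ 2 / (4 * a)) + - (dotp z' z' / (4 * a))); last by ring.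
by rewrite expRD -/P -/E' (exprS P); ring.
Qed.

Lemma measurable_heat d (T : measurableType d) n t (f : T -> 'rV[R]_n) :
  measurable_fun setT f -> measurable_fun setT (fun x => heat t (f x)).
Proof.
move=> mf; apply: measurable_funM => //; apply: measurableT_comp => //; apply: measurableT_comp => //.
by apply: measurable_funM => //; exact: measurable_dotp.
Qed.

Variables (n : nat) (t : R).
Hypothesis t0 : 0 < t.
Implicit Types x y : 'rV[R]_n.

Let s0 : 0 < Num.sqrt (2 * pi * t).
Proof. by rewrite sqrtr_gt0 !mulr_gt0// pi_gt0. Qed.

Lemma heat_gt0 x : 0 < heat t x.
Proof. by rewrite mulr_gt0 ?expR_gt0// exprn_gt0// invr_gt0. Qed.

Lemma heat_ge0 x : 0 <= heat t x.
Proof. exact/ltW/heat_gt0. Qed.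

Lemma heatN x : heat t (- x) = heat t x.
Proof. by rewrite /heat dotpNl dotpNr opprK. Qed.

Lemma heat_le x : heat t x <= (Num.sqrt (2 * pi * t))^-1 ^+ n.
Proof.
rewrite ler_piMr ?exprn_ge0 ?invr_ge0 ?sqrtr_ge0// -expR0 ler_expR oppr_le0 divr_ge0 ?dotp_ge0//.
by rewrite mulr_ge0// ltW.
Qed.

Lemma integral_heat : (\int[lebesgue_rV R n]_x (heat t x)%:E = 1)%E.
Proof.
have a0 : 0 < (2 * t)^-1 by rewrite invr_gt0 mulr_gt0.
have := @ge0_integral_cos_gauss n _ 0 1 0 0 a0; rewrite normr0 => /(_ ler01).
rewrite mul0r mul0r addr0 mulr1 (_ : pi / (2 * t)^-1 = 2 * pi * t); last by rewrite invrK; ring.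
move=> /(congr1 (fun w : \bar R => ((Num.sqrt (2 * pi * t))^-1 ^+ n)%:E * w)%E).
rewrite -EFinM -exprMn mulVf ?gt_eqF// expr1n => <-.
rewrite -ge0_integralZl_EFin//.
- by apply: eq_integral => x _; rewrite -EFinM; congr EFin; rewrite mul0r addr0 mul1r /heat mulrC (mulrC _ (dotp x x)) mulrC.
- apply/measurable_EFinP; apply: measurable_funM; last exact: measurable_expR_dotp.
  by rewrite (_ : (fun x => _) = cst 1) //; apply/funext => x; rewrite mul0r addr0.
Qed.

Lemma integral_heat_shift y : (\int[lebesgue_rV R n]_x (heat t (x - y)%R)%:E = 1)%E.
Proof.
rewrite (ge0_integral_rV_shift (- y) (h := fun x => (heat t x)%:E)) ?integral_heat//.
  by apply/measurable_EFinP; exact: measurable_heat.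
by move=> x; rewrite lee_fin heat_ge0.
Qed.

End heat_kernel.

(** * Smooth functions *)

Section elementary.
Variable R : realType.

(* S plays the role of the set of all derivatives of phi. *)
Definition bsmooth (phi : R -> R) := exists S : set (R -> R), S phi /\
  forall g, S g -> (exists C, forall x, `|g x| <= C) /\
    exists2 g', S g' & forall x : R, is_derive x 1 g (g' x).

(* A class stable under partial derivatives and of polynomial growth, containing
   the Schwartz and test functions that are needed. *)
Inductive elem n : ('rV[R]_n -> R) -> Prop :=
| elem_cst c : elem (fun=> c)
| elem_coord i : elem (fun x => x ord0 i)
| elem_gauss a c : 0 <= a -> elem (fun x => expR (- (a * dotp (x - c) (x - c))))
| elemD f g : elem f -> elem g -> elem (fun x => f x + g x)
| elemM f g : elem f -> elem g -> elem (fun x => f x * g x)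
| elem_comp phi f : bsmooth phi -> elem f -> elem (fun x => phi (f x)).

Section derive_comp.
Variable n : nat.
Implicit Types f g : 'rV[R]_n -> R.

Lemma differentiable_comp1 f (phi : R -> R) l x : differentiable f x ->
  is_derive (f x) 1 phi l -> differentiable (fun y => phi (f y)) x.
Proof.
move=> df [dphi _]; apply: (@differentiable_comp _ _ _ _ f phi) => //.
exact/derivable1_diffP.
Qed.

Lemma derive_comp1 f (phi : R -> R) l x v : differentiable f x ->
  is_derive (f x) 1 phi l -> 'D_v (fun y => phi (f y)) x = l * 'D_v f x.
Proof.
move=> df [dphi dE]; have dphi' : differentiable phi (f x) by exact/derivable1_diffP.
rewrite deriveE; last exact: (@differentiable_comp _ _ _ _ f phi).
rewrite (diff_comp df dphi') /= (diff1E dphi') deriveE//.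
by rewrite derive1E dE mulrC.
Qed.

Lemma derive_coord i j (x : 'rV[R]_n) :
  'D_(delta_mx ord0 i) (fun y : 'rV[R]_n => y ord0 j) x = (j == i)%:R :> R.
Proof.
have lin : linear (fun y : 'rV[R]_n => y ord0 j : R) by move=> k y z; rewrite !mxE.
pose f : {linear 'rV[R]_n -> R} := HB.pack (fun y : 'rV[R]_n => y ord0 j : R) (GRing.isLinear.Build _ _ _ _ _ lin).
rewrite deriveE; last exact: differentiable_coord.
rewrite -[LHS]/('d f x (delta_mx ord0 i)) diff_lin; last exact: coord_continuous.
by rewrite /= mxE eqxx.
Qed.

Lemma deriveDv f g x v : differentiable f x -> differentiable g x ->
  'D_v (fun y => f y + g y) x = 'D_v f x + 'D_v g x.
Proof. by move=> df dg; rewrite -deriveD//; exact: diff_derivable. Qed.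

Lemma deriveMv f g x v : differentiable f x -> differentiable g x ->
  'D_v (fun y => f y * g y) x = f x * 'D_v g x + g x * 'D_v f x.
Proof. by move=> df dg; rewrite (@deriveM _ _ f g)//; exact: diff_derivable. Qed.

Lemma differentiable_dist2 (c x : 'rV[R]_n) : differentiable (fun y => dotp (y - c) (y - c)) x.
Proof.
rewrite (_ : (fun _ => _) = \sum_i (fun y : 'rV[R]_n => (y ord0 i - c ord0 i) * (y ord0 i - c ord0 i))); last first.
  by apply/funext => y; rewrite fct_sumE; apply: eq_bigr => i _; rewrite !mxE.
apply: differentiable_sum => i.
have h : differentiable (fun y : 'rV[R]_n => y ord0 i - c ord0 i) x.
  by apply: differentiableB; [exact: differentiable_coord|exact: differentiable_cst].
exact: differentiableM.
Qed.

Lemma derive_dist2 (c x : 'rV[R]_n) i :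
  'D_(delta_mx ord0 i) (fun y => dotp (y - c) (y - c)) x = 2 * (x ord0 i - c ord0 i).
Proof.
rewrite (_ : (fun _ => _) = \sum_j (fun y : 'rV[R]_n => (y ord0 j - c ord0 j) * (y ord0 j - c ord0 j))); last first.
  by apply/funext => y; rewrite fct_sumE; apply: eq_bigr => j _; rewrite !mxE.
have h j : differentiable (fun y : 'rV[R]_n => y ord0 j - c ord0 j) x.
  by apply: differentiableB; [exact: differentiable_coord|exact: differentiable_cst].
have hd j : 'D_(delta_mx ord0 i) (fun y : 'rV[R]_n => y ord0 j - c ord0 j) x = (j == i)%:R.
  rewrite (@deriveDv (fun y => y ord0 j) (fun=> - c ord0 j))//; last exact: differentiable_coord.
  by rewrite derive_coord derive_cst addr0.
rewrite derive_sum; last by move=> j; apply: diff_derivable; exact: differentiableM.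
rewrite (bigD1 i)//= big1 ?addr0.
  by rewrite deriveMv// hd eqxx mulr1; ring.
by move=> j /negbTE ji; rewrite deriveMv// hd ji mulr0 addr0.
Qed.

Lemma is_derive_expRN (a u : R) : is_derive u 1 (fun v => expR (- (a * v))) (- a * expR (- (a * u))).
Proof.
have h0 : is_derive u 1 (fun v : R => - (a * v)) (- a).
  by apply: is_derive_eq; rewrite /GRing.scale/= mulr1.
have h1 := @is_derive1_comp R expR (fun v => - (a * v)) u _ _ (is_derive_expR _) h0.
by apply: (is_derive_eq h1); rewrite mulrC.
Qed.

Lemma differentiable_gauss a (c x : 'rV[R]_n) :
  differentiable (fun y => expR (- (a * dotp (y - c) (y - c)))) x.
Proof.
exact: (differentiable_comp1 (differentiable_dist2 c x) (is_derive_expRN a _)).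
Qed.

Lemma derive_gauss a (c x : 'rV[R]_n) i :
  'D_(delta_mx ord0 i) (fun y => expR (- (a * dotp (y - c) (y - c)))) x =
  expR (- (a * dotp (x - c) (x - c))) * (- (2 * a) * (x ord0 i - c ord0 i)).
Proof.
rewrite (derive_comp1 _ (differentiable_dist2 c x) (is_derive_expRN a _)) derive_dist2.
by ring.
Qed.

Lemma elem_differentiable f : elem f -> (forall x, differentiable f x) /\
  forall i, elem (fun x => 'D_(delta_mx ord0 i) f x).
Proof.
elim=> {f} [c|i|a c a0|f g _ [df df'] _ [dg dg']|f g ef [df df'] eg [dg dg']|phi f [S [Sphi SP]] ef [df df']].
- split=> [x|i]; first exact: differentiable_cst.
  rewrite (_ : (fun x => _) = (fun=> 0) :> ('rV[R]_n -> R)); first exact: elem_cst.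
  by apply/funext => x; exact: derive_cst.
- split=> [x|j]; first exact: differentiable_coord.
  rewrite (_ : (fun _ => _) = (fun=> (i == j)%:R)); first exact: elem_cst.
  by apply/funext => x; exact: derive_coord.
- split=> [x|i]; first exact: differentiable_gauss.
  rewrite (_ : (fun _ => _) = (fun x => expR (- (a * dotp (x - c) (x - c))) * (- (2 * a) * (x ord0 i + - c ord0 i)))); last first.
    by apply/funext => x; rewrite derive_gauss.
  apply: elemM; first exact: elem_gauss.
  by apply: elemM; [exact: elem_cst|apply: elemD; [exact: elem_coord|exact: elem_cst]].
- split=> [x|i]; first exact: differentiableD.
  rewrite (_ : (fun _ => _) = (fun x => 'D_(delta_mx ord0 i) f x + 'D_(delta_mx ord0 i) g x)); first exact: elemD.
  by apply/funext => x; rewrite deriveDv.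
- split=> [x|i]; first exact: differentiableM.
  rewrite (_ : (fun _ => _) = (fun x => f x * 'D_(delta_mx ord0 i) g x + g x * 'D_(delta_mx ord0 i) f x)).
    by apply: elemD; exact: elemM.
  by apply/funext => x; rewrite deriveMv.
- have [_ [phi' Sphi' dphi]] := SP _ Sphi.
  split=> [x|i]; first exact: (differentiable_comp1 (df x) (dphi _)).
  rewrite (_ : (fun _ => _) = (fun x => phi' (f x) * 'D_(delta_mx ord0 i) f x)).
    by apply: elemM => //; apply: elem_comp => //; exists S.
  by apply/funext => x; rewrite (derive_comp1 _ (df x) (dphi _)).
Qed.

Lemma elem_partial f s : elem f -> elem (partial s f).
Proof. by elim: s => [//|i s IH] /IH /elem_differentiable[_]; exact. Qed.

Lemma elem_smooth f : elem f -> smooth f.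
Proof. by move=> ef s x; have [+ _] := elem_differentiable (elem_partial s ef); exact. Qed.

Lemma elem_growth f : elem f -> exists C k, 0 <= C /\ forall x, `|f x| <= C * (1 + enorm x) ^+ k.
Proof.
have E1 x : 1 <= 1 + enorm x by rewrite lerDl enorm_ge0.
elim=> {f} [c|i|a c a0|f g _ [C [k [C0 hC]]] _ [D [l [D0 hD]]]|f g _ [C [k [C0 hC]]] _ [D [l [D0 hD]]]|phi f [S [Sphi SP]] ef _].
- by exists `|c|, 0%N; split=> // x; rewrite expr0 mulr1.
- exists 1, 1%N; split=> // x; rewrite expr1 mul1r (le_trans (normr_coord_le _ _))//; lra.
- exists 1, 0%N; split=> // x; rewrite expr0 mulr1 ger0_norm ?expR_ge0// -expR0 ler_expR oppr_le0.
  by rewrite mulr_ge0// dotp_ge0.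
- exists (C + D), (k + l)%N; split=> [|x]; first exact: addr_ge0.
  rewrite (le_trans (ler_normD _ _))// mulrDl; apply: lerD.
    by apply: le_trans (hC x) _; apply: ler_wpM2l => //; apply: ler_weXn2l => //; rewrite leq_addr.
  by apply: le_trans (hD x) _; apply: ler_wpM2l => //; apply: ler_weXn2l => //; rewrite leq_addl.
- exists (C * D), (k + l)%N; split=> [|x]; first exact: mulr_ge0.
  rewrite normrM exprD mulrACA; apply: ler_pM => //.
- have [[C hC] _] := SP _ Sphi; exists `|C|, 0%N; split=> // x.
  by rewrite expr0 mulr1 (le_trans (hC _))// ler_norm.
Qed.

(** Every derivative keeps the Gaussian as a factor and leaves a cofactor of polynomial growth;
    rapid decay follows from this. *)
Lemma elem_gauss_partial a c f s : 0 <= a -> elem f -> exists2 g, elem g &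
  partial s (fun x => expR (- (a * dotp (x - c) (x - c))) * f x) =
  (fun x => expR (- (a * dotp (x - c) (x - c))) * g x).
Proof.
move=> a0 ef; elim: s => [|i s [g eg IH]]; first by exists f.
have [dg eg'] := elem_differentiable eg.
exists (fun x => 'D_(delta_mx ord0 i) g x + g x * (- (2 * a) * (x ord0 i + - c ord0 i))).
  apply: elemD => //; apply: elemM => //.
  by apply: elemM; [exact: elem_cst|apply: elemD; [exact: elem_coord|exact: elem_cst]].
rewrite /= -/(partial _ _) IH; apply/funext => x.
by rewrite deriveMv ?derive_gauss//; [ring|exact: differentiable_gauss].
Qed.

End derive_comp.

Lemma exprn_le_expR (M : nat) (y : R) : 0 <= y -> y ^+ M <= M`!%:R * expR y.
Proof.
move=> y0; case: M => [|M].
  by rewrite expr0 mul1r -expR0 ler_expR.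
have := expR_ge1Dxn M y0; have f0 : 0 < (M.+1)`!%:R :> R by rewrite ltr0n fact_gt0.
move=> h; have : y ^+ M.+1 / (M.+1)`!%:R <= expR y by lra.
by rewrite ler_pdivrMr// mulrC.
Qed.

(** From 1 + r <= 2 + 2 r^2 and y^M <= M! exp(y) at y = a + a r^2; the summand a of y leaves the
    factor exp(a) in the constant. *)
Lemma gauss_growth (a : R) (M : nat) : 0 < a -> exists C, forall r, 0 <= r ->
  (1 + r) ^+ M * expR (- (a * r ^+ 2)) <= C.
Proof.
move=> a0; exists ((2 / a) ^+ M * M`!%:R * expR a) => r r0.
have h1 : (1 + r) ^+ M <= (2 + 2 * r ^+ 2) ^+ M.
  by apply: lerXn2r; rewrite ?nnegrE; [lra|have := sqr_ge0 r; lra|have := sqr_ge0 (1 - r); nra].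
have h2 : (2 + 2 * r ^+ 2) ^+ M = (2 / a) ^+ M * (a + a * r ^+ 2) ^+ M.
  by rewrite -exprMn; congr (_ ^+ _); field; rewrite gt_eqF.
have h3 : (a + a * r ^+ 2) ^+ M <= M`!%:R * expR (a + a * r ^+ 2).
  by apply: exprn_le_expR; have := sqr_ge0 r; nra.
have h4 : expR (a + a * r ^+ 2) * expR (- (a * r ^+ 2)) = expR a by rewrite -expRD addrK.
apply: (@le_trans _ _ ((2 / a) ^+ M * (M`!%:R * expR (a + a * r ^+ 2)) * expR (- (a * r ^+ 2)))).
  apply: ler_wpM2r; rewrite ?expR_ge0//; apply: (le_trans h1); rewrite h2.
  by apply: ler_wpM2l => //; rewrite exprn_ge0// divr_ge0// ltW.
by rewrite -!mulrA h4.
Qed.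

Lemma elem_gauss_rapidly n (a : R) (f : 'rV[R]_n -> R) : 0 < a -> elem f ->
  rapidly_decreasing (fun x => expR (- (a * dotp (x - 0) (x - 0))) * f x).
Proof.
move=> a0 ef s k; have [g eg ->] := elem_gauss_partial 0 s (ltW a0) ef.
have [C [l [C0 hC]]] := elem_growth eg; have [D hD] := gauss_growth (k + l) a0.
exists (C * D) => x; have r0 := enorm_ge0 x; rewrite subr0 -sqr_enorm.
apply: le_trans (ler_wpM2l C0 (hD _ r0)); rewrite normrM (ger0_norm (expR_ge0 _)).
apply: (@le_trans _ _ ((1 + enorm x) ^+ k * (expR (- (a * enorm x ^+ 2)) * (C * (1 + enorm x) ^+ l)))).
  apply: ler_pM; rewrite ?exprn_ge0 ?mulr_ge0 ?expR_ge0//.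
    by apply: lerXn2r; rewrite ?nnegrE; lra.
  by apply: ler_wpM2l => //; exact: expR_ge0.
by rewrite le_eqVlt; apply/orP; left; apply/eqP; rewrite exprD; ring.
Qed.

Lemma bsmooth_cos : bsmooth (@cos R).
Proof.
exists [set h | exists s t, h = fun x => s * cos x + t * sin x]; split.
  by exists 1, 0; apply/funext => x; rewrite mul1r mul0r addr0.
move=> _ [s [t ->]]; split.
  exists (`|s| + `|t|) => x; rewrite (le_trans (ler_normD _ _))// !normrM lerD//.
    by rewrite ler_piMr// ler_norml cos_geN1 cos_le1.
  by rewrite ler_piMr// ler_norml sin_geN1 sin_le1.
exists (fun x => t * cos x + - s * sin x); first by exists t, (- s).
move=> x; apply: is_derive_eq; rewrite /GRing.scale/=; ring.
Qed.

Lemma elem_dotp n (z : 'rV[R]_n) : elem (dotp z).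
Proof.
have h s : elem (fun x : 'rV[R]_n => \sum_(i <- s) z ord0 i * x ord0 i).
  elim: s => [|i s IH].
    by rewrite (_ : (fun _ => _) = fun=> 0); [exact: elem_cst|apply/funext => x; rewrite big_nil].
  rewrite (_ : (fun _ => _) = fun x : 'rV[R]_n => z ord0 i * x ord0 i + \sum_(i <- s) z ord0 i * x ord0 i); last first.
    by apply/funext => x; rewrite big_cons.
  by apply: elemD => //; apply: elemM; [exact: elem_cst|exact: elem_coord].
exact: h.
Qed.

Lemma elem_dotp2 n : elem (fun x : 'rV[R]_n => dotp x x).
Proof.
have h s : elem (fun x : 'rV[R]_n => \sum_(i <- s) x ord0 i * x ord0 i).
  elim: s => [|i s IH].
    by rewrite (_ : (fun _ => _) = fun=> 0); [exact: elem_cst|apply/funext => x; rewrite big_nil].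
  rewrite (_ : (fun _ => _) = fun x : 'rV[R]_n => x ord0 i * x ord0 i + \sum_(i <- s) x ord0 i * x ord0 i); last first.
    by apply/funext => x; rewrite big_cons.
  by apply: elemD => //; apply: elemM; exact: elem_coord.
exact: h.
Qed.

(** These are the functions against which the Fourier hypothesis on W is tested: their own
    transforms are sums of two Gaussians, centred at z and -z. *)
Lemma schwartz_gauss_cos n (a : R) (z : 'rV[R]_n) : 0 < a ->
  schwartz (fun x => (expR (- (a * dotp x x)) * cos (dotp z x))%:C%C).
Proof.
move=> a0.
have E : (fun x : 'rV[R]_n => expR (- (a * dotp x x)) * cos (dotp z x)) =
         (fun x => expR (- (a * dotp (x - 0) (x - 0))) * cos (dotp z x)).
  by apply/funext => x; rewrite subr0.
have ec : elem (fun x : 'rV[R]_n => cos (dotp z x)).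
  by apply: elem_comp; [exact: bsmooth_cos|exact: elem_dotp].
have eg : elem (fun x : 'rV[R]_n => expR (- (a * dotp (x - 0) (x - 0)))).
  by apply: elem_gauss; exact: ltW.
have e0 : elem ((fun=> 0) : 'rV[R]_n -> R) by exact: elem_cst.
have pc0 s : partial s (fun=> 0 : R) = (fun=> 0) :> ('rV[R]_n -> R).
  by elim: s => //= i s ->; apply/funext => x; exact: derive_cst.
split => /=.
- by rewrite E; apply: elem_smooth; exact: elemM.
- exact: elem_smooth.
- by rewrite E; exact: elem_gauss_rapidly.
- by move=> s k; exists 0 => x; rewrite pc0 normr0 mulr0.
Qed.

End elementary.

(** * Smooth cutoffs *)

Section bump.
Variable R : realType.

(** Allowing all polynomials p makes the family closed under differentiation: p becomes X^2 (p -
    p'). *)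
Definition expinv (p : {poly R}) (x : R) : R :=
  if 0 < x then p.[x^-1] * expR (- x^-1) else 0.

Lemma horner_expRN_bounded (p : {poly R}) :
  exists C, forall u, 0 <= u -> `|p.[u]| * expR (- u) <= C.
Proof.
exists (\sum_(i < size p) `|p`_i| * i`!%:R) => u u0.
rewrite horner_coef; apply: le_trans (ler_wpM2r (expR_ge0 _) (ler_norm_sum _ _ _)) _.
rewrite mulr_suml; apply: ler_sum => i _; rewrite normrM -mulrA; apply: ler_wpM2l => //.
rewrite ger0_norm ?exprn_ge0// expRN ler_pdivrMr ?expR_gt0//.
exact: exprn_le_expR.
Qed.

Lemma expinv_bounded (p : {poly R}) : exists C, forall x, `|expinv p x| <= C.
Proof.
have [C hC] := horner_expRN_bounded p; exists C => x; rewrite /expinv; case: ifPn => x0.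
  by rewrite normrM (ger0_norm (expR_ge0 _)); apply: hC; rewrite invr_ge0 ltW.
by rewrite normr0; apply: le_trans (hC 0 (lexx _)); rewrite mulr_ge0 ?expR_ge0.
Qed.

(** Boundedness of the member of the family with polynomial X^2 p. This quadratic flatness gives
    differentiability at 0, with derivative 0. *)
Lemma expinv_sqr (p : {poly R}) : exists C, forall x, `|expinv p x| <= C * x ^+ 2.
Proof.
have [C hC] := expinv_bounded ('X ^+ 2 * p); exists C => x; have := hC x; rewrite /expinv.
case: ifPn => x0; last first.
  by rewrite normr0 => C0; rewrite mulr_ge0 ?sqr_ge0.
rewrite hornerM hornerXn exprVn -mulrA normrM => h.
have x2 : 0 < x ^+ 2 by rewrite exprn_gt0.
by rewrite (ger0_norm (_ : 0 <= (x ^+ 2)^-1)) ?invr_ge0 ?(ltW x2)// mulrC ler_pdivrMr// in h.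
Qed.

Lemma is_derive0_sqr (f : R -> R) (C : R) : (forall x, `|f x| <= C * x ^+ 2) ->
  is_derive (0 : R) 1 f 0.
Proof.
move=> hf; have f0 : f 0 = 0.
  by apply/eqP; have := hf 0; rewrite expr0n mulr0 normr_le0.
have lim : h^-1 *: (f (h + 0) - f 0) @[h --> (0 : R)^'] --> (0 : R).
  apply/cvgrPdist_le => e e0; rewrite f0.
  near=> h; rewrite sub0r normrN subr0 addr0 normrM.
  have h0 : h != 0 by near: h; exact: nbhs_dnbhs_neq.
  rewrite normfV ler_pdivrMl ?normr_gt0//; apply: le_trans (hf h) _.
  rewrite -(real_normK (num_real h)) expr2 mulrCA; apply: ler_wpM2l => //.
  have hh : `|h| <= e / (`|C| + 1).
    near: h; apply: dnbhs0_le; rewrite divr_gt0//; have := normr_ge0 C; lra.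
  apply: le_trans (ler_wpM2r (normr_ge0 h) (ler_norm C)) _.
  apply: le_trans (ler_wpM2l (normr_ge0 C) hh) _.
  have C0 := normr_ge0 C.
  by rewrite mulrA ler_pdivrMr; nra.
split; first by apply/cvg_ex; exists 0; under eq_fun do rewrite scaler1.
by rewrite /derive; apply: cvg_lim => //; under eq_fun do rewrite scaler1.
Unshelve. all: end_near. Qed.

Lemma is_derive_expinv (p : {poly R}) (x : R) :
  is_derive x 1 (expinv p) (expinv ('X ^+ 2 * (p - p^`())) x).
Proof.
have [x0|x0|<-] := ltgtP 0 x.
- have h1 : is_derive x 1 (fun y : R => y^-1) (- x ^- 2).
    by have := @is_deriveV R id x 1 1 _ _; rewrite /= /GRing.scale/= mulr1; apply; rewrite gt_eqF.
  have h2 : is_derive x 1 (fun y : R => p.[y^-1]) (p^`().[x^-1] * - x ^- 2).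
    exact: (@is_derive1_comp R (fun y => p.[y]) (fun y => y^-1) x _ _ (is_derive_poly p _) h1).
  have h3 : is_derive x 1 (fun y : R => - y^-1) (x ^- 2).
    by have := @is_deriveN _ _ _ (fun y : R => y^-1) x 1 _ h1; rewrite opprK.
  have h4 := @is_derive1_comp R expR (fun y => - y^-1) x _ _ (is_derive_expR _) h3.
  have h5 := is_deriveM h2 h4.
  apply: (@near_eq_is_derive R _ _ ((fun y : R => p.[y^-1]) * (expR \o (fun y : R => - y^-1)))).
    near=> y; rewrite /expinv ifT//; near: y; exact: lt_nbhsr.
  apply: (is_derive_eq h5); rewrite /expinv x0 !hornerE /GRing.scale/= exprVn; ring.
- rewrite {2}/expinv ltNge (ltW x0)/=.
  have h0 : is_derive x 1 (cst 0 : R -> R) 0 by exact: is_derive_cst.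
  apply: (near_eq_is_derive _ h0).
  near=> y; rewrite /expinv ltNge ltW//; near: y; exact: lt_nbhsl.
- rewrite {2}/expinv ltxx; have [C hC] := expinv_sqr p; exact: is_derive0_sqr hC.
Unshelve. all: end_near. Qed.

Lemma bsmooth_expinv p : bsmooth (expinv p).
Proof.
exists [set h | exists q, h = expinv q]; split; first by exists p.
move=> _ [q ->]; split; first exact: expinv_bounded.
by exists (expinv ('X ^+ 2 * (q - q^`()))) => [|x]; [eexists|exact: is_derive_expinv].
Qed.

Definition hstep (x : R) := expinv 1 x.

Lemma hstepE x : hstep x = if 0 < x then expR (- x^-1) else 0.
Proof. by rewrite /hstep /expinv hornerC mul1r. Qed.

Lemma hstep_ge0 x : 0 <= hstep x.
Proof. by rewrite hstepE; case: ifP => // _; exact: expR_ge0. Qed.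

(* Equal to 1 on the nonpositive reals, where hstep vanishes, and to 0 beyond 1,
   where the inner 1 - e hstep u is nonpositive. *)
Definition plateau (u : R) := expR 1 * hstep (1 - expR 1 * hstep u).

Lemma plateau_ge0 u : 0 <= plateau u.
Proof. by rewrite mulr_ge0 ?expR_ge0 ?hstep_ge0. Qed.

Lemma plateau1 u : u <= 0 -> plateau u = 1.
Proof.
move=> u0; rewrite /plateau (hstepE u) ltNge u0/= mulr0 subr0 hstepE ltr01 invr1.
by rewrite -expRD subrr expR0.
Qed.

Lemma plateau0 u : 1 <= u -> plateau u = 0.
Proof.
move=> u1; have u0 : 0 < u by lra.
rewrite /plateau [X in _ * X]hstepE ifF ?mulr0//; apply/negbTE; rewrite -leNgt subr_le0.
by rewrite hstepE u0 -expRD -[leLHS]expR0 ler_expR subr_ge0 invf_le1.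
Qed.

Lemma plateau_le u : plateau u <= expR 1.
Proof.
rewrite /plateau ler_piMr ?expR_ge0// hstepE; case: ifP => // h.
by rewrite -[leRHS]expR0 ler_expR oppr_le0 invr_ge0 ltW.
Qed.

(** The squared norm is a polynomial, hence smooth at the origin too; [rho] and [rho + 1] are thus
    squared radii. *)
Definition cutoff n (rho : R) (x : 'rV[R]_n) := plateau (dotp x x - rho).

Lemma elem_cutoff n rho : elem (@cutoff n rho).
Proof.
have e0 : elem (fun x : 'rV[R]_n => hstep (dotp x x + - rho)).
  apply: elem_comp; first exact: bsmooth_expinv.
  by apply: elemD; [exact: elem_dotp2|exact: elem_cst].
apply: elemM; first exact: elem_cst.
apply: elem_comp; first exact: bsmooth_expinv.
rewrite (_ : (fun _ => _) = (fun x : 'rV[R]_n => 1 + - expR 1 * hstep (dotp x x + - rho))).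
  by apply: elemD; [exact: elem_cst|apply: elemM => //; exact: elem_cst].
by apply/funext => x; rewrite mulNr.
Qed.

Lemma continuous_dotp2 n : continuous (fun x : 'rV[R]_n => dotp x x).
Proof.
move=> x; apply: differentiable_continuous.
by have [+ _] := elem_differentiable (elem_dotp2 R n); exact.
Qed.

Lemma compact_dotp_le n (rho : R) : compact [set x : 'rV[R]_n | dotp x x <= rho].
Proof.
apply: bounded_closed_compact.
  exists (1 + `|rho|); split; first exact: num_real.
  move=> M M1 x /= xr; apply: (@le_trans _ _ (1 + `|rho|)); last exact: ltW.
  rewrite {1}/Num.norm/= mx_normrE; apply/bigmax_leP; split=> [|[i j] _ /=].
    by rewrite addr_ge0.
  rewrite ord1; have h := sqr_coord_le x j; have r1 := ler_norm rho.
  rewrite -(@ler_pXn2r _ 2)// ?nnegrE ?addr_ge0// real_normK ?num_real//.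
  by have := normr_ge0 rho; nra.
rewrite (_ : [set x | _] = (fun x : 'rV[R]_n => dotp x x) @^-1` [set y | y <= rho]) //.
by apply: closed_comp => [x _|]; [exact: continuous_dotp2|exact: closed_le].
Qed.

Lemma test_function_cutoff n rho (f : 'rV[R]_n -> R) : elem f ->
  test_function (fun x => cutoff rho x * f x).
Proof.
move=> ef; split; first by apply: elem_smooth; apply: elemM => //; exact: elem_cutoff.
have cp := @compact_dotp_le n (rho + 1).
apply: (subclosed_compact _ cp); first exact: closed_closure.
have cl : closed [set x : 'rV[R]_n | dotp x x <= rho + 1].
  by apply: compact_closed => //; exact: norm_hausdorff.
rewrite closureE; apply: smallest_sub => // x /=.
apply: contraNP => /negP; rewrite -ltNge => h.
by rewrite /cutoff plateau0 ?mul0r//; lra.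
Qed.

End bump.

(** * Heat kernel and Riesz kernels *)

Ltac nneg := rewrite ?lee_fin; repeat first
  [ done | by apply: ltW | apply: adde_ge0 | apply: mule_ge0 | rewrite lee_fin | apply: mulr_ge0 | apply: addr_ge0
  | apply: exprn_ge0 | apply: expR_ge0 | rewrite invr_ge0 | apply: heat_ge0 | apply: sqrtr_ge0 | apply: enorm_ge0 | apply: mulr_gt0 | apply: divr_gt0].

Section heat_convolution.
Variables (R : realType) (n : nat).
Local Notation V := 'rV[R]_n.
Local Notation leb := (lebesgue_rV R n).
Implicit Types (x y z w : V) (t : R) (K : V -> \bar R).

(** The parallelogram identity in the exponent separates the difference from the midpoint. The
    semigroup law and the smoothing of a kernel in both of its arguments reduce to it, the midpoint
    being integrated out. *)
Lemma heat_mul t x y : 0 < t ->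
  heat t x * heat t y = heat (2 * t) (x - y) * heat (t / 2) (2^-1 *: (x + y)).
Proof.
move=> t0; rewrite /heat [LHS]mulrACA [RHS]mulrACA -!exprMn -!expRD.
congr (_ ^+ _ * expR _).
  rewrite -!invfM; congr (_^-1); rewrite -expr2 sqr_sqrtr; last by rewrite !mulr_ge0 ?pi_ge0// ltW.
  rewrite -sqrtrM; last by rewrite !mulr_ge0 ?pi_ge0// ltW.
  rewrite (_ : 2 * pi * (2 * t) * (2 * pi * (t / 2)) = (2 * pi * t) ^+ 2); last by field.
  by rewrite sqrtr_sqr ger0_norm// !mulr_ge0 ?pi_ge0// ltW.
rewrite !dotpZl !dotpZr !(dotpDl, dotpDr, dotpNl, dotpNr) (dotpC y x).
by field; rewrite gt_eqF.
Qed.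

Lemma measurable_heat_sub d (T : measurableType d) t (f g : T -> V) :
  measurable_fun setT f -> measurable_fun setT g ->
  measurable_fun setT (fun p => (heat t (f p - g p))%:E).
Proof. by move=> mf mg; apply/measurable_EFinP; apply: measurable_heat; exact: measurable_rVB. Qed.

Definition hconv K t z : \bar R := (\int[leb]_w (K w * (heat t (w - z)%R)%:E))%E.

Lemma conv_ge0 K t z : 0 < t -> (forall w, 0 <= K w)%E -> (0 <= hconv K t z)%E.
Proof. by move=> t0 K0; apply: integral_ge0 => w _; rewrite mule_ge0 ?lee_fin ?heat_ge0. Qed.

Lemma measurable_conv K t : 0 < t -> measurable_fun setT K -> (forall w, 0 <= K w)%E ->
  measurable_fun setT (hconv K t).
Proof.
move=> t0 mK K0.
apply: (measurable_fun_fubini_tonelli_F (m2 := leb) (fun p : V * V => K p.2 * (heat t (p.2 - p.1)%R)%:E)%E).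
  apply: emeasurable_funM; first by apply: (measurableT_comp mK); exact: measurable_snd.
  by apply: measurable_heat_sub; [exact: measurable_snd|exact: measurable_fst].
by move=> p; rewrite mule_ge0 ?lee_fin ?heat_ge0.
Qed.

Lemma heat_semigroup t y z : 0 < t ->
  (\int[leb]_x ((heat t (x - y)%R)%:E * (heat t (x - z)%R)%:E) = (heat (2 * t) (y - z)%R)%:E)%E.
Proof.
move=> t0; have t20 : 0 < t / 2 by rewrite divr_gt0.
under eq_integral => x _.
  rewrite -EFinM (heat_mul _ _ t0) (_ : x - y - (x - z) = - (y - z)); last by rewrite !opprB; apply/rowP => i; rewrite !mxE; ring.
  rewrite heatN (_ : 2^-1 *: (x - y + (x - z)) = x - 2^-1 *: (y + z)); last by apply/rowP => i; rewrite !mxE; field.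
  rewrite EFinM; over.
rewrite ge0_integralZl_EFin ?heat_ge0 ?mulr_gt0//.
- by rewrite integral_heat_shift// mule1.
- by move=> x _; rewrite lee_fin heat_ge0.
- by apply: measurable_heat_sub => //; exact: measurable_cst.
Qed.

(** In the variables w = x - x' and x', [heat_mul] turns the two Gaussians into one in w at time 2t
    and one in x'. The kernel depends on w only, and the Gaussian in x' has mass 1. *)
Lemma conv_heat2 K t y z : 0 < t -> measurable_fun setT K -> (forall w, 0 <= K w)%E ->
  (\int[leb]_x \int[leb]_x' (K (x - x')%R * (heat t (x - y)%R)%:E * (heat t (x' - z)%R)%:E)
   = hconv K (2 * t) (y - z)%R)%E.
Proof.
move=> t0 mK K0; have t20 : 0 < t / 2 by rewrite divr_gt0.
pose F (p : V * V) := (K (p.1 - p.2)%R * (heat t (p.1 - y)%R)%:E * (heat t (p.2 - z)%R)%:E)%E.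
have m1 : measurable_fun setT (fst : V * V -> V) by exact: measurable_fst.
have m2 : measurable_fun setT (snd : V * V -> V) by exact: measurable_snd.
have mF : measurable_fun setT F.
  apply: emeasurable_funM; last by apply: measurable_heat_sub.
  apply: emeasurable_funM; last by apply: measurable_heat_sub.
  by apply: (measurableT_comp mK); exact: measurable_rVB.
have F0 p : (0 <= F p)%E by rewrite !mule_ge0 ?lee_fin ?heat_ge0.
rewrite (fubini_tonelli F mF F0).
pose G (p : V * V) := (K p.2 * (heat (2 * t) (p.2 - (y - z))%R)%:E * (heat (t / 2) (p.1 - 2^-1 *: (y + z - p.2))%R)%:E)%E.
have mG : measurable_fun setT G.
  apply: emeasurable_funM; last first.
    apply: measurable_heat_sub => //; apply: (measurableT_comp (f := fun w : V => 2^-1 *: (y + z - w))) => //.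
    apply: measurable_fun_rV => i; under eq_fun do rewrite !mxE.
    by apply: measurable_funM => //; apply: measurable_funB => //; exact: measurable_coord.
  apply: emeasurable_funM; last by apply: measurable_heat_sub.
  by apply: (measurableT_comp mK).
have G0 p : (0 <= G p)%E by rewrite !mule_ge0 ?lee_fin ?heat_ge0 ?mulr_gt0.
have e1 (x' w : V) : w + x' - y - (x' - z) = w - (y - z).
  by apply/rowP => i; rewrite !mxE; ring.
have e2 (x' w : V) : 2^-1 *: (w + x' - y + (x' - z)) = x' - 2^-1 *: (y + z - w).
  by apply/rowP => i; rewrite !mxE; field.
transitivity (\int[leb]_x' \int[leb]_w G (x', w))%E.
  apply: eq_integral => x' _.
  rewrite -(ge0_integral_rV_shift x' (h := fun x => F (x, x'))); last 2 first.
  - by apply: (measurableT_comp mF); exact: measurable_fun_pair.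
  - by move=> x; exact: F0.
  apply: eq_integral => w _; rewrite /F /G /= addrK -!muleA -!EFinM; congr (_ * _%:E)%E.
  by rewrite (heat_mul _ _ t0) e1 e2.
rewrite (fubini_tonelli G mG G0); apply: eq_integral => w _; rewrite /G /=.
rewrite ge0_integralZl//.
- by rewrite integral_heat_shift// mule1.
- by apply: measurable_heat_sub => //; exact: measurable_cst.
- by move=> x _; rewrite lee_fin heat_ge0.
- by rewrite mule_ge0 ?lee_fin ?heat_ge0 ?mulr_gt0.
Qed.

(** Half of the exponent, q = |x|^2 / (4t), is spent on exp(-q) <= 1/q, which gains a factor t; the
    other half is the Gaussian at time 2t. The power of sqrt 2 is the ratio of the
    normalizations. *)
Lemma heat_tail t (dlt : R) x : 0 < t -> 0 < dlt -> dlt <= enorm x ->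
  heat t x <= Num.sqrt 2 ^+ n * (4 / dlt ^+ 2) * t * heat (2 * t) x.
Proof.
move=> t0 d0 dx; rewrite /heat.
set s := Num.sqrt (2 * pi * t); set s2 := Num.sqrt (2 * pi * (2 * t)).
have s0 : 0 < s by rewrite sqrtr_gt0 !mulr_gt0// pi_gt0.
have s20 : 0 < s2 by rewrite sqrtr_gt0 !mulr_gt0// pi_gt0.
have es : s^-1 = Num.sqrt 2 * s2^-1.
  rewrite /s2 (_ : 2 * pi * (2 * t) = 2 * (2 * pi * t)); last by ring.
  by rewrite sqrtrM// invfM mulrA mulfV ?mul1r// gt_eqF// sqrtr_gt0.
rewrite es exprMn.
pose q := dotp x x / (4 * t).
have q0 : 0 < q.
  rewrite divr_gt0 ?mulr_gt0// -sqr_enorm exprn_gt0//; exact: lt_le_trans dx.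
have -> : - (dotp x x / (2 * t)) = - q + - q by rewrite /q; field; rewrite gt_eqF.
have -> : - (dotp x x / (2 * (2 * t))) = - q by rewrite /q; field; rewrite gt_eqF.
rewrite expRD.
have h : expR (- q) <= 4 / dlt ^+ 2 * t.
  rewrite expRN; apply: (@le_trans _ _ q^-1).
    by rewrite lef_pV2 ?posrE ?expR_gt0// expR_ge_id.
  have x0 : 0 < dotp x x by rewrite -sqr_enorm exprn_gt0//; exact: lt_le_trans dx.
  rewrite /q invf_div [leRHS]mulrAC ler_pM2l ?mulr_gt0// lef_pV2 ?posrE ?exprn_gt0//.
  by rewrite -sqr_enorm lerXn2r// nnegrE ltW// (lt_le_trans d0).
have k0 : 0 <= Num.sqrt 2 ^+ n * s2^-1 ^+ n * expR (- q).
  by rewrite !mulr_ge0 ?exprn_ge0 ?sqrtr_ge0 ?invr_ge0 ?expR_ge0// ltW.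
have := ler_wpM2l k0 h; set a := Num.sqrt 2 ^+ n; set b := s2^-1 ^+ n; set e := expR (- q).
by rewrite !mulrA => /le_trans; apply; rewrite le_eqVlt; apply/orP; left; apply/eqP; ring.
Qed.


(** Since [k] may be unbounded, continuity at z says nothing about the tail of the convolution. By
    [heat_tail] this tail is O(t) times the convolution at time 2t, for which a bound M is
    assumed. *)
Lemma approx_identity (k : V -> R) z (M : R) : measurable_fun setT k -> (forall w, 0 <= k w) ->
  {for z, continuous k} -> (forall t, 0 < t <= 1 -> (hconv (EFin \o k) (2 * t) z <= M%:E)%E) ->
  forall e, 0 < e -> exists2 tau, 0 < tau & forall t, 0 < t < tau ->
    ((k z - e)%:E <= hconv (EFin \o k) t z <= (k z + e)%:E)%E.
Proof.
move=> mk k0 ck hM e e0.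
have e20 : 0 < e / 2 by rewrite divr_gt0.
have M0 : 0 <= M.
  by rewrite -lee_fin (le_trans _ (hM 1 _)) ?ltr01 ?lexx// conv_ge0// => w; rewrite lee_fin.
have /cvgrPdist_lt /(_ _ e20) /nbhs_ballP[dlt /= d0 hd] := ck.
have near_k w : enorm (w - z) < dlt -> `|k z - k w| < e / 2.
  move=> h; apply: hd; split=> // i j; rewrite ord1 /ball/= -normrN opprB.
  by apply: le_lt_trans h; have := normr_coord_le (w - z) j; rewrite !mxE.
pose C := Num.sqrt 2 ^+ n * (4 / dlt ^+ 2) : R.
have C0 : 0 <= C by rewrite mulr_ge0 ?exprn_ge0 ?sqrtr_ge0// divr_ge0// exprn_ge0// ltW.
(* For t < tau the tail error C t (M + k z) is at most e / 2; the minimum with 1 keeps t in the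
   range where M is a bound, and the summand 1 keeps the denominator positive. *)
pose tau := Num.min 1 (e / 2 / (C * (M + k z) + 1)).
have kz := k0 z.
have D0 : 0 < C * (M + k z) + 1 by have := mulr_ge0 C0 (addr_ge0 M0 kz); lra.
have tau0 : 0 < tau by rewrite lt_min ltr01 divr_gt0.
exists tau => // t /andP[t0]; rewrite lt_min => /andP[t1 tt].
have t20 : 0 < 2 * t by rewrite mulr_gt0.
have tCe : C * t * (M + k z) <= e / 2.
  have := ltW tt; rewrite ler_pdivlMr//; nra.
have mh s : measurable_fun setT (fun w : V => heat s (w - z)).
  by apply: measurable_heat; apply: measurable_rVB => //; exact: measurable_cst.
have tail w : dlt <= enorm (w - z) -> heat t (w - z) <= C * t * heat (2 * t) (w - z).
  by move=> h; have := heat_tail t0 d0 h; rewrite !mulrA.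
have h0 s w : 0 < s -> 0 <= heat s (w - z) by move=> s0; exact: heat_ge0.
have int1 s (c : R) : 0 < s -> 0 <= c -> (\int[leb]_w (c * heat s (w - z))%:E = c%:E)%E.
  move=> s0 c0; under eq_integral do rewrite EFinM.
  rewrite ge0_integralZl_EFin//; first by rewrite integral_heat_shift// mule1.
  - by move=> w _; rewrite lee_fin h0.
  - by apply/measurable_EFinP; exact: mh.
have intk s (c : R) : 0 < s -> 0 <= c -> (\int[leb]_w (c * (k w * heat s (w - z)))%:E = c%:E * hconv (EFin \o k) s z)%E.
  move=> s0 c0; under eq_integral do rewrite EFinM.
  rewrite ge0_integralZl_EFin//.
  - by move=> w _; rewrite lee_fin mulr_ge0// h0.
  - by apply/measurable_EFinP; exact: measurable_funM.
have convE s : (hconv (EFin \o k) s z = \int[leb]_w (k w * heat s (w - z))%:E)%E by [].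
have Ct0 : 0 <= C * t by rewrite mulr_ge0// ltW.
have Mt : (hconv (EFin \o k) (2 * t) z <= M%:E)%E by apply: hM; rewrite t0 ltW.
apply/andP; split.
- have : (\int[leb]_w (k z * heat t (w - z))%:E <=
      \int[leb]_w ((k w * heat t (w - z))%:E + (e / 2 * heat t (w - z))%:E + (C * t * k z * heat (2 * t) (w - z))%:E))%E.
    apply: ge0_le_integral => //.
    + by move=> w _; nneg.
    + by apply/measurable_EFinP; exact: measurable_funM.
    + by do !apply: emeasurable_funD; apply/measurable_EFinP; exact: measurable_funM.
    + move=> w _; rewrite -!EFinD lee_fin.
      have [wd|wd] := ltP (enorm (w - z)) dlt.
        have /ltW := near_k w wd; rewrite ler_norml => /andP[_ h].
        have := ler_wpM2r (h0 t w t0) h; have := mulr_ge0 (mulr_ge0 Ct0 kz) (h0 _ w t20); lra.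
      have := ler_wpM2l kz (tail w wd); have := mulr_ge0 (k0 w) (h0 _ w t0).
      have := mulr_ge0 (ltW e20) (h0 _ w t0); lra.
  rewrite int1// ge0_integralD//; last 4 first.
  - by move=> w _; nneg.
  - by do !apply: emeasurable_funD; apply/measurable_EFinP; exact: measurable_funM.
  - by move=> w _; nneg.
  - by apply/measurable_EFinP; exact: measurable_funM.
  rewrite ge0_integralD//; last 4 first.
  - by move=> w _; nneg.
  - by apply/measurable_EFinP; exact: measurable_funM.
  - by move=> w _; nneg.
  - by apply/measurable_EFinP; exact: measurable_funM.
  rewrite -convE (int1 t (e / 2))//; last exact: ltW.
  rewrite (int1 (2 * t) (C * t * k z))//; last exact: mulr_ge0.
  have : (0 <= hconv (EFin \o k) t z)%E by apply: conv_ge0 => // w; rewrite lee_fin.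
  case: (hconv _ _ _) => [c| |] //= c0; last by move=> _; rewrite leey.
  rewrite -!EFinD !lee_fin => h; have := mulr_ge0 Ct0 M0; lra.
- have : (\int[leb]_w (k w * heat t (w - z))%:E <=
      \int[leb]_w (((k z + e / 2) * heat t (w - z))%:E + (C * t * (k w * heat (2 * t) (w - z)))%:E))%E.
    apply: ge0_le_integral => //.
    + by move=> w _; nneg.
    + by apply/measurable_EFinP; exact: measurable_funM.
    + by do !apply: emeasurable_funD; apply/measurable_EFinP; do ?[exact: measurable_funM|apply: measurable_funM => //].
    + move=> w _; rewrite -!EFinD lee_fin.
      have [wd|wd] := ltP (enorm (w - z)) dlt.
        have /ltW := near_k w wd; rewrite ler_norml => /andP[h _].
        have := ler_wpM2r (h0 t w t0) h; have := mulr_ge0 Ct0 (mulr_ge0 (k0 w) (h0 _ w t20)); lra.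
      have := ler_wpM2l (k0 w) (tail w wd); have := mulr_ge0 kz (h0 _ w t0).
      have := mulr_ge0 (ltW e20) (h0 _ w t0); lra.
  rewrite ge0_integralD//; last 4 first.
  - by move=> w _; nneg.
  - by apply/measurable_EFinP; exact: measurable_funM.
  - by move=> w _; nneg.
  - by apply/measurable_EFinP; apply: measurable_funM => //; exact: measurable_funM.
  rewrite -convE (int1 t (k z + e / 2))//; last by nneg.
  rewrite intk// => /le_trans; apply.
  apply: (@le_trans _ _ ((k z + e / 2)%:E + (C * t)%:E * M%:E)%E); first by rewrite leeD2l// lee_wpmul2l.
  by rewrite -EFinM -EFinD lee_fin; have := mulr_ge0 Ct0 kz; lra.
Qed.

End heat_convolution.

Lemma measurable_invr (R : realType) : measurable_fun setT (fun u : R => u^-1).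
Proof.
have oU : open [set u : R | u != 0] by exact: open_neq.
have mU : measurable [set u : R | u != 0] by exact: open_measurable.
rewrite -(setUv [set u : R | u != 0]); apply/measurable_funU => //; first exact: measurableC.
split.
  by apply: open_continuous_measurable_fun => // u; rewrite inE /= => u0; exact: inv_continuous.
rewrite (_ : ~` _ = [set 0]); first exact: measurable_fun_set1.
by apply/seteqP; split=> u /=; [move/negP; rewrite negbK => /eqP|move=> ->; rewrite eqxx].
Qed.

Section ge0_integral_real.
Context d (T : measurableType d) (R : realType) (mu : {measure set T -> \bar R}).
Implicit Types f g : T -> R.

Lemma ge0_integralDr_real f g : measurable_fun setT f -> measurable_fun setT g ->
  (forall x, 0 <= f x) -> (forall x, 0 <= g x) ->
  (\int[mu]_x ((f x)%:E + (g x)%:E) = \int[mu]_x (f x)%:E + \int[mu]_x (g x)%:E)%E.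
Proof.
by move=> mf mg f0 g0; rewrite ge0_integralD//; try (by apply/measurable_EFinP); move=> x _; rewrite lee_fin.
Qed.

Lemma ge0_integralZr_real (c : R) f : measurable_fun setT f -> 0 <= c -> (forall x, 0 <= f x) ->
  (\int[mu]_x (c * f x)%:E = c%:E * \int[mu]_x (f x)%:E)%E.
Proof.
move=> mf c0 f0; under eq_integral do rewrite EFinM.
by rewrite ge0_integralZl_EFin//; try (by apply/measurable_EFinP); move=> x _; rewrite lee_fin.
Qed.

Lemma ge0_le_integral_real f g : measurable_fun setT f -> measurable_fun setT g ->
  (forall x, 0 <= f x) -> (forall x, f x <= g x) ->
  (\int[mu]_x (f x)%:E <= \int[mu]_x (g x)%:E)%E.
Proof.
move=> mf mg f0 fg; apply: ge0_le_integral => //; try (by apply/measurable_EFinP);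
  move=> x _; rewrite lee_fin//; exact: le_trans (fg x).
Qed.

End ge0_integral_real.

(** * Riesz kernels: local integrability and convolution with the heat kernel *)

Section singular_kernel.
Variables (R : realType) (n : nat).
Local Notation V := 'rV[R]_n.
Local Notation leb := (lebesgue_rV R n).
Implicit Types (x y z w : V) (t r : R).

(** Cubes rather than balls, because Lebesgue measure is known on product sets. *)
Definition box r : set V := [set x | forall i, `|x ord0 i| < r].

(* For 0 < k, riesz k 0 = 0. *)
Definition riesz (k : nat) x : R := (enorm x)^-1 ^+ k.

Lemma measurable_box r : measurable (box r).
Proof.
rewrite (_ : box r = \bigcap_(i in [set: 'I_n]) (fun x : V => x ord0 i) @^-1` `]-r, r[%classic); last first.
  apply/seteqP; split => x /= h i; have := h i; rewrite /= in_itv/= ltr_norml//.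
  by move=> /(_ I).
apply: fin_bigcap_measurable => // i _.
by rewrite -[X in measurable X]setTI; exact: measurable_coord.
Qed.

Lemma measurable_box_indic r : measurable_fun setT (\1_(box r) : V -> R).
Proof. by apply: measurable_indic; exact: measurable_box. Qed.

Lemma lebesgue_box r : 0 <= r -> leb (box r) = ((2 * r) ^+ n)%:E.
Proof.
move=> r0; rewrite (_ : box r = [set x | forall i, `]-r, r[%classic (x ord0 i)]); last first.
  by apply/seteqP; split => x h i; have := h i; rewrite /= in_itv/= ltr_norml.
rewrite (lebesgue_rV_box (A := fun=> `]-r, r[%classic))// (eq_bigr (fun=> (2 * r)%:E)).
  by rewrite prodEFin prodr_const card_ord.
move=> i _; rewrite lebesgue_measure_itv/= lte_fin.
case: ifPn => [_|]; first by rewrite -EFinD; congr EFin; ring.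
by rewrite -leNgt => h; congr EFin; lra.
Qed.

Lemma riesz_ge0 k x : 0 <= riesz k x.
Proof. by rewrite exprn_ge0// invr_ge0 enorm_ge0. Qed.

Lemma measurable_riesz k : measurable_fun setT (riesz k).
Proof.
apply: measurable_funX; apply: (measurableT_comp (f := fun u : R => u^-1)); last exact: measurable_enorm.
exact: measurable_invr.
Qed.

Lemma box_enorm r x : enorm x < r -> box r x.
Proof. by move=> xr i; apply: le_lt_trans xr; exact: normr_coord_le. Qed.

Lemma not_box_enorm r x : ~ box r x -> r <= enorm x.
Proof. by move=> h; rewrite leNgt; apply/negP => /box_enorm. Qed.

(** Dyadic shells: j is the first index such that x lies outside the cube of size r / 2^(j+1). Being
    outside bounds |x| from below, and minimality keeps x in the preceding cube. *)
Lemma riesz_shell r k x : 0 < r -> (0 < k)%N -> box r x -> exists j,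
  riesz k x <= (2 ^+ j.+1 / r) ^+ k /\ box (r / 2 ^+ j) x.
Proof.
(* The origin belongs to every cube, but there the kernel has the value 0, as 0 < k. *)
move=> r0 k0 bx; have [->|x0] := eqVneq x 0.
  exists 0%N; split; last by rewrite expr0 divr1 => i; rewrite mxE normr0.
  rewrite /riesz (_ : enorm 0 = 0) ?invr0 ?expr0n; last by apply/eqP; rewrite enorm_eq0.
  by rewrite gtn_eqF// exprn_ge0// divr_ge0 ?exprn_ge0// ltW.
have ex0 : 0 < enorm x by rewrite enorm_gt0.
have ex : exists j, ~~ `[< box (r / 2 ^+ j.+1) x >].
  apply: contrapT => h; have hb j : box (r / 2 ^+ j.+1) x.
    by apply: contrapT => hj; apply: h; exists j; apply/asboolPn.
  have [i xi] : exists i, x ord0 i != 0.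
    apply: contrapT => hx; move: x0; apply/negP; rewrite negbK; apply/eqP/rowP => i; rewrite mxE.
    by apply: contrapT => /eqP hi; apply: hx; exists i.
  have xi0 : 0 < `|x ord0 i| by rewrite normr_gt0.
  have [j hj] : exists j : nat, r / `|x ord0 i| < j%:R.
    exists (Num.truncn (r / `|x ord0 i|)).+1.
    by have /andP[] := Num.Theory.truncn_itv (divr_ge0 (ltW r0) (normr_ge0 (x ord0 i))).
  have := hb j i; rewrite ltr_pdivlMr ?exprn_gt0//.
  have : j%:R <= 2 ^+ j.+1 :> R.
    by rewrite -natrX ler_nat; apply: ltnW; apply: ltn_trans (ltn_expl j (isT : (1 < 2)%N)) _; rewrite ltn_exp2l.
  move=> h1 h2; move: hj; rewrite ltr_pdivrMr// => h3.
  have := ler_wpM2l (ltW xi0) h1; lra.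
have [j] := ex_minnP ex => /asboolPn hj hmin; exists j; split.
  have := not_box_enorm hj => h.
  have p2 : 0 < r / 2 ^+ j.+1 by rewrite divr_gt0// exprn_gt0.
  rewrite /riesz; apply: lerXn2r; rewrite ?nnegrE ?invr_ge0 ?enorm_ge0 ?divr_ge0 ?exprn_ge0 ?(ltW r0)//.
  by rewrite -invf_div lef_pV2 ?posrE.
case: j hmin {hj} => [|j] hmin; first by rewrite expr0 divr1.
by apply: contrapT => /asboolPn hb; have := hmin j hb; rewrite ltnn.
Qed.

(** The j-th shell contributes at most 2^(k+n) r^(n-k) / 2^(j(n-k)); as n - k >= 1 this is dominated
    by a geometric series of ratio 1/2, whose sum gives the extra factor 2 in the constant. *)
Lemma integral_riesz_box k r : (0 < k < n)%N -> 0 < r ->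
  (\int[leb]_x (riesz k x * \1_(box r) x)%:E <= (2 ^+ (k + n).+1 * r ^+ (n - k))%:E)%E.
Proof.
move=> /andP[k0 kn] r0.
pose c j : R := (2 ^+ j.+1 / r) ^+ k.
have c0 j : 0 <= c j by rewrite exprn_ge0// divr_ge0 ?exprn_ge0// ltW.
pose g j x : \bar R := ((c j) * \1_(box (r / 2 ^+ j)) x)%:E.
have g0 j x : (0 <= g j x)%E by rewrite lee_fin mulr_ge0.
have mg j : measurable_fun setT (g j).
  by apply/measurable_EFinP; apply: measurable_funM => //; exact: measurable_box_indic.
apply: (@le_trans _ _ (\int[leb]_x (\sum_(j <oo) g j x))%E).
  apply: ge0_le_integral => //.
  - by move=> x _; rewrite lee_fin mulr_ge0// riesz_ge0.
  - by apply/measurable_EFinP; apply: measurable_funM; [exact: measurable_riesz|exact: measurable_box_indic].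
  - by apply: ge0_emeasurable_sum => // j x _ _; exact: g0.
  move=> x _; rewrite indicE; case: (boolP (x \in box r)) => [|_]; last by rewrite mulr0; apply: nneseries_ge0 => *; exact: g0.
  rewrite inE => bx; have [j [h1 h2]] := riesz_shell r0 k0 bx.
  apply: (@le_trans _ _ (g j x)).
    by rewrite /g indicE mem_set//= !mulr1 lee_fin.
  apply: le_trans (nneseries_lim_ge j.+1 (fun i _ _ => g0 i x)).
  by rewrite big_nat_recr//= leeDr// sume_ge0.
rewrite integral_nneseries//.
apply: le_trans (epsilon_trick0 xpredT _); last by rewrite mulr_ge0// exprn_ge0// ltW.
apply: lee_nneseries => [j _ _|j _]; first by apply: integral_ge0 => x _; exact: g0.
rewrite /g; under eq_integral do rewrite EFinM.
rewrite ge0_integralZl_EFin//; last by apply/measurable_EFinP; exact: measurable_box_indic.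
rewrite integral_indic ?setIT//; last exact: measurable_box.
rewrite [X in (_ * X <= _)%E](_ : _ = ((2 * (r / 2 ^+ j)) ^+ n)%:E); last first.
  by apply: lebesgue_box; rewrite divr_ge0 ?exprn_ge0// ltW.
rewrite -EFinM lee_fin /c natrX.
have rn0 : r != 0 by rewrite gt_eqF.
have e1 : (2 ^+ j.+1 / r) ^+ k * (2 * (r / 2 ^+ j)) ^+ n = 2 ^+ (k + n) * r ^+ (n - k) / (2 ^+ j) ^+ (n - k) :> R.
  rewrite (_ : n = n - k + k)%N; last by rewrite subnK// ltnW.
  have gen (a b : R) : a ^+ k * b ^+ (n - k + k) = (a * b) ^+ k * b ^+ (n - k) by rewrite exprD exprMn; ring.
  rewrite addnK gen (_ : 2 ^+ j.+1 / r * (2 * (r / 2 ^+ j)) = 2 * 2); last first.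
    by rewrite exprS; field; rewrite rn0 expf_neq0.
  rewrite !exprMn exprVn !exprD; ring.
rewrite e1 [X in _ <= X](_ : _ = 2 ^+ (k + n) * r ^+ (n - k) / 2 ^+ j); last first.
  by rewrite [2 ^+ (k + n).+1]exprS [2 ^+ j.+1]exprS; field; rewrite expf_neq0.
apply: ler_wpM2l; first by rewrite mulr_ge0 ?exprn_ge0// ltW.
rewrite lef_pV2 ?posrE ?exprn_gt0// ?exprn_gt0//.
by rewrite -exprM ler_weXn2l ?ler1n// leq_pmulr// subn_gt0.
Qed.

(** By scaling the product equals q^n exp(-pi q^2) with q = |x| / sqrt(2 pi t), which involves t
    through q only. *)
Lemma heat_enorm_bounded : exists C, 0 <= C /\ forall t x, 0 < t -> heat t x * enorm x ^+ n <= C.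
Proof.
have [C hC] := gauss_growth n (pi_gt0 R).
exists C; split=> [|t x t0].
  by apply: le_trans (hC 0 (lexx _)); rewrite mulr_ge0 ?expR_ge0// addr0 expr1n.
have s0 : 0 < Num.sqrt (2 * pi * t) by rewrite sqrtr_gt0 !mulr_gt0// pi_gt0.
pose q := enorm x / Num.sqrt (2 * pi * t).
have q0 : 0 <= q by rewrite divr_ge0 ?enorm_ge0// ltW.
apply: le_trans (hC q q0); rewrite /heat.
have -> : - (dotp x x / (2 * t)) = - (pi * q ^+ 2).
  rewrite /q expr_div_n sqr_enorm sqr_sqrtr; last by rewrite !mulr_ge0 ?pi_ge0// ltW.
  move: (pi_gt0 R); move: (@pi R) => p p0.
  by field; rewrite (gt_eqF t0) (gt_eqF p0).
rewrite mulrAC -exprMn (mulrC _ (enorm x)) -/q; apply: ler_wpM2r; first exact: expR_ge0.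
by apply: lerXn2r; rewrite ?nnegrE; lra.
Qed.

Lemma enorm_sub_ge z w : enorm w < enorm z / 2 -> enorm z / 2 <= enorm (w - z).
Proof.
move=> h; have z0 := enorm_ge0 z; have w0 := enorm_ge0 w.
rewrite -(@ler_pXn2r _ 2)// ?nnegrE ?enorm_ge0//; last by lra.
have hw : enorm w ^+ 2 <= (enorm z / 2) ^+ 2 by rewrite lerXn2r// ?nnegrE ?ltW//; lra.
have : dotp z z <= 2 * dotp w w + 2 * dotp (w - z) (w - z).
  have := dotp_ge0 (w + (w - z)); rewrite !(dotpDl, dotpDr, dotpNl, dotpNr) (dotpC z w); lra.
rewrite -!sqr_enorm; move: hw; rewrite expr_div_n; lra.
Qed.

(** Where |w| >= |z|/2 the kernel is at most 2^m times its value at z. Where |w| < |z|/2 the heat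
    kernel is at most a constant times |z|^(-n), while the kernel has integral of order |z|^(n-m)
    there. The constant is uniform in time, which makes it a domination for the limit t -> 0. *)
Lemma conv_riesz_bound m : n = m.+2 -> (0 < m)%N -> exists C, 0 < C /\
  forall t z, 0 < t -> z != 0 -> (hconv (EFin \o riesz m) t z <= (C * riesz m z)%:E)%E.
Proof.
move=> nm m0; have [C [C0 hC]] := heat_enorm_bounded.
pose A : R := 2 ^+ (m + n).+1.
have A0 : 0 < A by rewrite exprn_gt0.
exists (2 ^+ m + C * A * 2 ^+ m); split.
  by rewrite ltr_pwDl ?exprn_gt0// !mulr_ge0// ?exprn_ge0// ltW.
move=> t z t0 z0; have ez : 0 < enorm z by rewrite enorm_gt0.
pose r := enorm z / 2.
have r0 : 0 < r by rewrite divr_gt0.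
have mh : measurable_fun setT (fun w : V => heat t (w - z)).
  by apply: measurable_heat; apply: measurable_rVB => //; exact: measurable_cst.
have k0 := riesz_ge0 m.
have mk := measurable_riesz m.
have rz : riesz m z * 2 ^+ m = r^-1 ^+ m by rewrite /riesz /r invf_div exprMn mulrC.
apply: (@le_trans _ _ (\int[leb]_w ((2 ^+ m * riesz m z * heat t (w - z))%:E +
   (C * r^-1 ^+ n * (riesz m w * \1_(box r) w))%:E))%E).
  apply: ge0_le_integral => //.
  - by move=> w _; rewrite mule_ge0 ?lee_fin ?heat_ge0.
  - by apply: emeasurable_funM; apply/measurable_EFinP.
  - apply: emeasurable_funD; apply/measurable_EFinP; apply: measurable_funM => //.
    by apply: measurable_funM => //; exact: measurable_box_indic.
  move=> w _; rewrite -EFinD /= -EFinM lee_fin.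
  have [wr|wr] := ltP (enorm w) r; last first.
    apply: (@le_trans _ _ (2 ^+ m * riesz m z * heat t (w - z))).
      apply: ler_wpM2r; first exact: heat_ge0.
      rewrite (mulrC (2 ^+ m)) rz; apply: lerXn2r; rewrite ?nnegrE ?invr_ge0 ?enorm_ge0 ?(ltW r0)//.
      by rewrite lef_pV2 ?posrE//; exact: lt_le_trans wr.
    by rewrite lerDl !mulr_ge0// ?exprn_ge0 ?invr_ge0// ltW.
  rewrite indicE mem_set /=; last exact: box_enorm.
  apply: (@le_trans _ _ (C * r^-1 ^+ n * (riesz m w * 1))).
    rewrite mulr1 mulrC; apply: ler_wpM2r => //.
    have h := hC t (w - z) t0; have h2 := enorm_sub_ge wr.
    have ew : 0 < enorm (w - z) by apply: lt_le_trans h2.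
    rewrite exprVn ler_pdivlMr ?exprn_gt0//; apply: le_trans h.
    apply: ler_wpM2l; first exact: heat_ge0.
    by apply: lerXn2r; [rewrite nnegrE ltW|rewrite nnegrE ltW|exact: h2].
  by rewrite lerDr; nneg.
have mkb : measurable_fun setT (fun w => riesz m w * \1_(box r) w).
  by apply: measurable_funM => //; exact: measurable_box_indic.
rewrite ge0_integralDr_real; first last.
- by move=> w; nneg.
- by move=> w; nneg.
- by apply: measurable_funM.
- by apply: measurable_funM.
rewrite mulrDl EFinD; apply: leeD.
  have c0 : 0 <= 2 ^+ m * riesz m z by nneg.
  by rewrite (ge0_integralZr_real _ mh c0) ?integral_heat_shift ?mule1// => w; exact: heat_ge0.
have c0 : 0 <= C * r^-1 ^+ n by nneg.
rewrite (ge0_integralZr_real _ mkb c0); last by move=> w; rewrite mulr_ge0.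
have mn : (0 < m < n)%N by rewrite m0 nm ltnS leqnSn.
apply: (@le_trans _ _ ((C * r^-1 ^+ n)%:E * (A * r ^+ (n - m))%:E)%E).
  apply: lee_wpmul2l; last exact: integral_riesz_box.
  by rewrite lee_fin mulr_ge0// exprn_ge0// invr_ge0 ltW.
rewrite -EFinM lee_fin -!mulrA (mulrC (2 ^+ m)) rz nm (_ : m.+2 - m = 2)%N; last by rewrite -addn2 addKn.
rewrite le_eqVlt; apply/orP; left; apply/eqP.
by rewrite -addn2 exprD; field; rewrite gt_eqF.
Qed.

Lemma integral_riesz2_gauss (a : R) : (2 < n)%N -> 0 < a ->
  (\int[leb]_x (riesz 2 x * expR (- (a * dotp x x)))%:E < +oo)%E.
Proof.
move=> n3 a0.
have mg := @measurable_expR_dotp R n a.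
have mr := measurable_riesz 2.
apply: (@le_lt_trans _ _ (\int[leb]_x ((riesz 2 x * \1_(box 1) x)%:E + (expR (- (a * dotp x x)))%:E))%E).
  apply: ge0_le_integral => //.
  - by move=> x _; rewrite lee_fin mulr_ge0 ?riesz_ge0 ?expR_ge0.
  - by apply/measurable_EFinP; exact: measurable_funM.
  - apply: emeasurable_funD; apply/measurable_EFinP => //; apply: measurable_funM => //; exact: measurable_box_indic.
  move=> x _; rewrite -EFinD lee_fin indicE.
  have e1 : expR (- (a * dotp x x)) <= 1.
    by rewrite -expR0 ler_expR oppr_le0 mulr_ge0 ?dotp_ge0// ltW.
  have e0 := expR_ge0 (- (a * dotp x x)); have r0 := riesz_ge0 2 x.
  case: (boolP (x \in box 1)) => [_|/negP xb]; first by rewrite mulr1; nra.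
  have r1 : riesz 2 x <= 1.
    have h1 : 1 <= enorm x by apply: not_box_enorm => h; apply: xb; rewrite inE.
    rewrite /riesz exprn_ile1 ?invr_ge0 ?enorm_ge0// invf_le1//; lra.
  rewrite mulr0 add0r; nra.
have mrb : measurable_fun setT (fun x => riesz 2 x * \1_(box 1) x).
  by apply: measurable_funM => //; exact: measurable_box_indic.
rewrite ge0_integralDr_real//; last first.
  by move=> x; rewrite mulr_ge0 ?riesz_ge0.
rewrite lte_add_pinfty//.
  apply: le_lt_trans (integral_riesz_box _ ltr01) _; first by rewrite n3.
  by rewrite ltry.
have := @ge0_integral_cos_gauss R n a 0 1 0 0 a0; rewrite normr0 => /(_ ler01) h.
suff -> : (fun x : V => (expR (- (a * dotp x x)))%:E) =
  (fun x => ((1 + 0 * cos (dotp 0 x + 0)) * expR (- (a * dotp x x)))%:E) by rewrite h ltry.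
by apply/funext => x; rewrite mul0r addr0 mul1r.
Qed.

End singular_kernel.

(** * Heat regularization of a measure, in physical and Fourier variables *)

Section density.
Context d (T : measurableType d) (R : realType).

Section dens.
Variables (lam : {measure set T -> \bar R}) (p : T -> R).
Hypothesis mp : measurable_fun setT p.
Hypothesis p0 : forall x, 0 <= p x.
Hypothesis p1 : (\int[lam]_x (p x)%:E = 1)%E.

Definition dens (A : set T) : \bar R := (\int[lam]_(x in A) (p x)%:E)%E.

Let dens0 : dens set0 = 0%E.
Proof. by rewrite /dens integral_set0. Qed.

Let dens_ge0 A : (0 <= dens A)%E.
Proof. by apply: integral_ge0 => x _; rewrite lee_fin. Qed.

Let dens_sigma_additive : semi_sigma_additive dens.
Proof.
move=> /= F mF tF mUF; rewrite /dens; apply: cvg_toP.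
  apply: ereal_nondecreasing_is_cvgn => m n mn.
  by apply: lee_sum_nneg_natr => // k _ _; exact: dens_ge0.
rewrite ge0_integral_bigcup//=.
- by apply: measurable_funTS; apply/measurable_EFinP.
- by move=> x _; rewrite lee_fin.
Qed.

Let dens_setT : dens setT = 1%E. Proof. exact: p1. Qed.

Lemma density_probability0 : exists nu : probability T R, forall A, nu A = dens A.
Proof.
pose m := isMeasure.Build _ _ _ dens dens0 dens_ge0 dens_sigma_additive.
pose q := Measure_isProbability.Build _ _ _ (HB.pack_for {measure set T -> \bar R} dens m) dens_setT.
by exists (HB.pack_for (probability T R) dens m q).
Qed.

End dens.

(** The Radon-Nikodym derivative of the measure with density p equals p almost everywhere, so that
    the change of variables formula for this derivative applies. *)
Lemma density_probability (lam : {sigma_finite_measure set T -> \bar R}) (p : T -> R) :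
  measurable_fun setT p -> (forall x, 0 <= p x) -> (\int[lam]_x (p x)%:E = 1)%E ->
  exists nu : probability T R, forall h, measurable_fun setT h -> (forall x, 0 <= h x)%E ->
    (\int[nu]_x h x = \int[lam]_x (h x * (p x)%:E))%E.
Proof.
move=> mp p0 p1; have [nu nuE] := density_probability0 mp p0 p1.
exists nu => h mh h0.
have mpE : measurable_fun setT (EFin \o p) by apply/measurable_EFinP.
have dom : nu `<< lam.
  apply/null_content_dominatesP => A mA A0; rewrite nuE /dens.
  by apply: null_set_integral => //; exact: measurable_funTS.
rewrite -(Radon_Nikodym_SigmaFinite.change_of_variables (mu := lam) dom)//.
apply: ae_eq_integral => //.
- apply: emeasurable_funM => //; apply: measurable_int; exact: Radon_Nikodym_SigmaFinite.f_integrable.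
- exact: emeasurable_funM.
apply: ae_eqe_mul2l; apply: integral_ae_eq => //; first exact: Radon_Nikodym_SigmaFinite.f_integrable.
move=> E _ mE; rewrite -Radon_Nikodym_SigmaFinite.f_integral//; exact: nuE.
Qed.

End density.

Lemma integralZle d (T : measurableType d) (R : realType) (mu : {measure set T -> \bar R}) (k : \bar R) (f : T -> \bar R) :
  measurable_fun setT f -> (forall x, 0 <= f x)%E -> (0 <= k)%E ->
  (\int[mu]_x (k * f x) = k * \int[mu]_x f x)%E.
Proof. by move=> mf f0 k0; rewrite ge0_integralZl. Qed.

(** * Heat regularization of a probability measure *)

Section smear.
Variables (R : realType) (n : nat).
Local Notation V := 'rV[R]_n.
Local Notation leb := (lebesgue_rV R n).
Variable mu : probability V R.
Implicit Types (x y z w : V) (t : R) (K : V -> \bar R).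

(** The function f_t of the overview. *)
Definition smear t x : \bar R := (\int[mu]_y (heat t (x - y)%R)%:E)%E.

Lemma mheat2 t : measurable_fun setT (fun p : V * V => (heat t (p.1 - p.2))%:E).
Proof. by apply: measurable_heat_sub; [exact: measurable_fst|exact: measurable_snd]. Qed.

Lemma smear_ge0 t x : 0 < t -> (0 <= smear t x)%E.
Proof. by move=> t0; apply: integral_ge0 => y _; rewrite lee_fin heat_ge0. Qed.

Lemma measurable_smear t : 0 < t -> measurable_fun setT (smear t).
Proof.
move=> t0; apply: (measurable_fun_fubini_tonelli_F (m2 := mu) (fun p : V * V => (heat t (p.1 - p.2))%:E)).
  exact: mheat2.
by move=> p; rewrite lee_fin heat_ge0.
Qed.

Lemma smear_le t x : 0 < t -> (smear t x <= ((Num.sqrt (2 * pi * t))^-1 ^+ n)%:E)%E.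
Proof.
move=> t0; apply: (@le_trans _ _ (\int[mu]_y (cst ((Num.sqrt (2 * pi * t))^-1 ^+ n)%:E y))%E).
  apply: ge0_le_integral => //.
  - by move=> y _; rewrite lee_fin heat_ge0.
  - by apply: measurable_heat_sub => //; exact: measurable_cst.
  - by move=> y _; rewrite lee_fin heat_le.
by rewrite integral_cst// [X in (_ * X)%E]probability_setT mule1.
Qed.

Lemma smear_fin t x : 0 < t -> smear t x \is a fin_num.
Proof. by move=> t0; rewrite ge0_fin_numE ?smear_ge0// (le_lt_trans (smear_le x t0))// ltry. Qed.

Lemma integral_smear_mul t (g : V -> \bar R) : 0 < t -> measurable_fun setT g -> (forall x, 0 <= g x)%E ->
  (\int[leb]_x (g x * smear t x) = \int[mu]_y \int[leb]_x (g x * (heat t (x - y)%R)%:E))%E.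
Proof.
move=> t0 mg g0; pose F (p : V * V) := (g p.1 * (heat t (p.1 - p.2)%R)%:E)%E.
have mF : measurable_fun setT F.
  by apply: emeasurable_funM; [apply: (measurableT_comp mg); exact: measurable_fst|exact: mheat2].
have F0 p : (0 <= F p)%E by rewrite mule_ge0// lee_fin heat_ge0.
rewrite -(fubini_tonelli F mF F0); apply: eq_integral => x _; rewrite /F /= ge0_integralZl//.
- by apply: measurable_heat_sub => //; exact: measurable_cst.
- by move=> y _; rewrite lee_fin heat_ge0.
Qed.

Lemma integral_smear t : 0 < t -> (\int[leb]_x smear t x = 1)%E.
Proof.
move=> t0; under eq_integral do rewrite -[smear t _]mul1e.
rewrite (integral_smear_mul (g := cst 1%E))//.
under eq_integral => y _ do (under eq_integral do rewrite mul1e; rewrite integral_heat_shift//).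
by rewrite integral_cst// mul1e [LHS]probability_setT.
Qed.

(** The regularization is put on the kernel instead of the measure; at time 2t this is J(t). *)
Definition energy_heat K t : \bar R := (\int[mu]_y \int[mu]_z hconv K t (y - z)%R)%E.

(** Tonelli moves the two mollifications, one for each copy of mu, onto the kernel, where
    [conv_heat2] merges them into a single one at time 2t. *)
Lemma energy_smear K t : 0 < t -> measurable_fun setT K -> (forall w, 0 <= K w)%E ->
  (\int[leb]_x \int[leb]_x' (K (x - x')%R * smear t x * smear t x') = energy_heat K (2 * t))%E.
Proof.
move=> t0 mK K0.
have ms := measurable_smear t0; have s0 x := smear_ge0 x t0.
have m1 : measurable_fun setT (fst : V * V -> V) by exact: measurable_fst.
have m2 : measurable_fun setT (snd : V * V -> V) by exact: measurable_snd.
have mKs : measurable_fun setT (fun p : V * V => K (p.1 - p.2)%R).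
  by apply: (measurableT_comp mK); exact: measurable_rVB.
pose g x := (\int[leb]_x' (K (x - x')%R * smear t x'))%E.
have mF1 : measurable_fun setT (fun p : V * V => (K (p.1 - p.2)%R * smear t p.2)%E).
  by apply: emeasurable_funM; [exact: mKs|exact: (measurableT_comp ms m2)].
have mg : measurable_fun setT g.
  apply: (measurable_fun_fubini_tonelli_F (m2 := leb) (fun p : V * V => (K (p.1 - p.2)%R * smear t p.2)%E)) => //.
  by move=> p; rewrite mule_ge0.
have g0 x : (0 <= g x)%E by apply: integral_ge0 => x' _; rewrite mule_ge0.
have mKc x : measurable_fun setT (fun x' : V => K (x - x')%R).
  by apply: (measurableT_comp mK); apply: measurable_rVB => //; exact: measurable_cst.
transitivity (\int[leb]_x (g x * smear t x))%E.
  apply: eq_integral => x _; rewrite /g muleC -(integralZle leb (f := fun x' => (K (x - x')%R * smear t x')%E)) //.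
  - by apply: eq_integral => x' _; rewrite [LHS]muleAC [LHS]muleC.
  - by apply: emeasurable_funM; [exact: mKc|exact: ms].
  - by move=> x'; exact: mule_ge0.
rewrite integral_smear_mul//; apply: eq_integral => y _.
have mh u : measurable_fun setT (fun x : V => (heat t (x - u)%R)%:E).
  by apply: measurable_heat_sub => //; exact: measurable_cst.
have h0 x : (0 <= (heat t x)%:E)%E by rewrite lee_fin heat_ge0.
pose F (p : V * V) := (\int[leb]_x' (K (p.1 - x')%R * (heat t (p.1 - y)%R)%:E * (heat t (x' - p.2)%R)%:E))%E.
transitivity (\int[leb]_x \int[mu]_z F (x, z))%E.
  apply: eq_integral => x _; rewrite /g integral_smear_mul//.
  pose G z := (\int[leb]_x' (K (x - x')%R * (heat t (x' - z)%R)%:E))%E.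
  have G0 z : (0 <= G z)%E by apply: integral_ge0 => x' _; exact: mule_ge0.
  have mG : measurable_fun setT G.
    apply: (measurable_fun_fubini_tonelli_F (m2 := leb) (fun p : V * V => (K (x - p.2)%R * (heat t (p.2 - p.1)%R)%:E)%E)).
      by apply: emeasurable_funM; [exact: (measurableT_comp (mKc x) m2)|exact: measurable_heat_sub].
    by move=> p; exact: mule_ge0.
  rewrite muleC -(integralZle mu mG G0 (h0 _)).
  apply: eq_integral => z _; rewrite /F /=.
  have mk : measurable_fun setT (fun x' => K (x - x')%R * (heat t (x' - z)%R)%:E)%E.
    by apply: emeasurable_funM; [exact: mKc|exact: mh].
  rewrite -(integralZle leb mk _ (h0 _)); last by move=> x'; exact: mule_ge0.
  by apply: eq_integral => x' _; rewrite [RHS]muleAC [RHS]muleC.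
have F0 p : (0 <= F p)%E by apply: integral_ge0 => x' _; rewrite !mule_ge0.
have mF : measurable_fun setT F.
  apply: (measurable_fun_fubini_tonelli_F (m2 := leb) (fun q : (V * V) * V =>
    (K (q.1.1 - q.2)%R * (heat t (q.1.1 - y)%R)%:E * (heat t (q.2 - q.1.2)%R)%:E)%E)).
    have q1 : measurable_fun setT (fun q : (V * V) * V => q.1.1) by apply: (measurableT_comp m1); exact: measurable_fst.
    have q2 : measurable_fun setT (fun q : (V * V) * V => q.1.2) by apply: (measurableT_comp m2); exact: measurable_fst.
    have q3 : measurable_fun setT (fun q : (V * V) * V => q.2) by exact: measurable_snd.
    apply: emeasurable_funM; last exact: measurable_heat_sub.
    apply: emeasurable_funM; last by apply: measurable_heat_sub.
    by apply: (measurableT_comp mK); exact: measurable_rVB.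
  by move=> q; rewrite !mule_ge0.
rewrite (fubini_tonelli F mF F0); apply: eq_integral => z _.
by rewrite /F /= conv_heat2.
Qed.

(** At time 2t this is A(t), by the semigroup law. *)
Definition heat_mass t : \bar R := (\int[mu]_y \int[mu]_z (heat t (y - z)%R)%:E)%E.

Lemma integral_smear_sqr t : 0 < t -> (\int[leb]_x (smear t x * smear t x) = heat_mass (2 * t))%E.
Proof.
move=> t0; have ms := measurable_smear t0; have s0 x := smear_ge0 x t0.
rewrite integral_smear_mul//; apply: eq_integral => y _.
have mh u : measurable_fun setT (fun x : V => (heat t (x - u)%R)%:E).
  by apply: measurable_heat_sub => //; exact: measurable_cst.
under eq_integral do rewrite muleC.
rewrite integral_smear_mul//; last by move=> x; rewrite lee_fin heat_ge0.
by apply: eq_integral => z _; rewrite heat_semigroup.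
Qed.

End smear.

Lemma integral_cst_probability d (T : measurableType d) (R : realType) (mu : probability T R) (k : R) :
  (\int[mu]_x k%:E = k%:E)%E.
Proof.
by rewrite integral_cst// [X in (_ * X)%E]probability_setT mule1.
Qed.

Lemma integralDe d (T : measurableType d) (R : realType) (mu : {measure set T -> \bar R}) (f g : T -> \bar R) :
  measurable_fun setT f -> measurable_fun setT g -> (forall x, 0 <= f x)%E -> (forall x, 0 <= g x)%E ->
  (\int[mu]_x (f x + g x) = \int[mu]_x f x + \int[mu]_x g x)%E.
Proof. by move=> mf mg f0 g0; rewrite ge0_integralD. Qed.

Lemma bounded_integrable d (T : measurableType d) (R : realType) (mu : probability T R) (f : T -> R) (M : R) :
  measurable_fun setT f -> (forall x, `|f x| <= M) -> mu.-integrable setT (EFin \o f).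
Proof.
move=> mf fM; apply: (integrable_dominated mf _ fM).
exact: (finite_measure_integrable_cst mu M).
Qed.

Lemma integrable_addr d (T : measurableType d) (R : realType) (mu : {measure set T -> \bar R}) (f g : T -> R) :
  mu.-integrable setT (EFin \o f) -> mu.-integrable setT (EFin \o g) ->
  mu.-integrable setT (EFin \o (fun x => f x + g x)).
Proof. by move=> fi gi; exact: (integrableD measurableT fi gi). Qed.

Lemma EFin_Rintegral d (T : measurableType d) (R : realType) (mu : {measure set T -> \bar R}) (f : T -> R) :
  mu.-integrable setT (EFin \o f) -> (\int[mu]_x (f x)%:E = (\int[mu]_x f x)%:E)%E.
Proof. by move=> fi; rewrite /Rintegral fineK//; exact: (integrable_fin_num measurableT fi). Qed.

(** * The squared Fourier transform of a measure *)

Section power_spectrum.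
Variables (R : realType) (n : nat).
Local Notation V := 'rV[R]_n.
Local Notation leb := (lebesgue_rV R n).
Variable mu : probability V R.
Implicit Types (x y z xi : V) (t : R).

(* qmu is the squared modulus of the Fourier transform cmu - i smu of mu. *)
Definition cmu xi : R := \int[mu]_y cos (dotp y xi).
Definition smu xi : R := \int[mu]_y sin (dotp y xi).
Definition qmu xi : R := cmu xi ^+ 2 + smu xi ^+ 2.

Let mcos d (T : measurableType d) (f g : T -> V) : measurable_fun setT f -> measurable_fun setT g ->
  measurable_fun setT (fun p => cos (dotp (f p) (g p))).
Proof. by move=> mf mg; apply: (measurableT_comp (@measurable_cos R)); exact: measurable_dotp. Qed.

Let msin d (T : measurableType d) (f g : T -> V) : measurable_fun setT f -> measurable_fun setT g ->
  measurable_fun setT (fun p => sin (dotp (f p) (g p))).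
Proof. by move=> mf mg; apply: (measurableT_comp (@measurable_sin R)); exact: measurable_dotp. Qed.

Let mcosc xi : measurable_fun setT (fun y : V => cos (dotp y xi)).
Proof. by apply: mcos => //; exact: measurable_cst. Qed.

Let msinc xi : measurable_fun setT (fun y : V => sin (dotp y xi)).
Proof. by apply: msin => //; exact: measurable_cst. Qed.

Let cos1 u : `|cos u| <= 1 :> R. Proof. by rewrite ler_norml cos_geN1 cos_le1. Qed.
Let sin1 u : `|sin u| <= 1 :> R. Proof. by rewrite ler_norml sin_geN1 sin_le1. Qed.

Let icos xi : mu.-integrable setT (EFin \o (fun y : V => cos (dotp y xi))).
Proof. by apply: (bounded_integrable mu (mcosc xi)) => y. Qed.

Let isin xi : mu.-integrable setT (EFin \o (fun y : V => sin (dotp y xi))).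
Proof. by apply: (bounded_integrable mu (msinc xi)) => y. Qed.

Let i1 : mu.-integrable setT (EFin \o cst 1).
Proof. exact: (finite_measure_integrable_cst mu 1). Qed.

Let int1 : \int[mu]_y (1 : R) = 1.
Proof. by rewrite Rintegral_cst// mul1r -[RHS]/(fine 1%E); congr fine; exact: probability_setT. Qed.

Lemma Rintegral_cosD (a b xi : V) (k c s : R) :
  \int[mu]_z (k + c * cos (dotp z xi) + s * sin (dotp z xi)) = k + c * cmu xi + s * smu xi.
Proof.
have ik : mu.-integrable setT (EFin \o (fun=> k)) by exact: (finite_measure_integrable_cst mu k).
rewrite RintegralD//; [|by apply: integrable_addr => //; exact: integrable_mulrl|exact: integrable_mulrl].
rewrite RintegralD//; last exact: integrable_mulrl.
rewrite !RintegralZl//; congr (_ + _ + _); rewrite Rintegral_cst//.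
by rewrite (_ : fine _ = 1) ?mulr1// -[RHS]/(fine 1%E); congr fine; exact: probability_setT.
Qed.

Lemma qmu_ge0 xi : 0 <= qmu xi.
Proof. by rewrite addr_ge0 ?sqr_ge0. Qed.

(** The subtraction formula for the cosine splits the double integral into products of single
    ones. *)
Lemma integral_cos_qmu xi :
  (\int[mu]_y \int[mu]_z (1 + cos (dotp (y - z)%R xi))%:E = (1 + qmu xi)%:E)%E.
Proof.
have ii c s : mu.-integrable setT (EFin \o (fun z : V => 1 + c * cos (dotp z xi) + s * sin (dotp z xi))).
  exact: integrableD (integrableD measurableT i1 (integrable_mulrl c (icos xi))) (integrable_mulrl s (isin xi)).
transitivity (\int[mu]_y (1 + cmu xi * cos (dotp y xi) + smu xi * sin (dotp y xi))%:E)%E.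
  apply: eq_integral => y _.
  transitivity (\int[mu]_z (1 + cos (dotp y xi) * cos (dotp z xi) + sin (dotp y xi) * sin (dotp z xi))%:E)%E.
    by apply: eq_integral => z _; rewrite dotpDl dotpNl cosB addrA.
  by rewrite EFin_Rintegral// Rintegral_cosD// (mulrC (cmu _)) (mulrC (smu _)).
by rewrite EFin_Rintegral// Rintegral_cosD// -!expr2 addrA.
Qed.

Lemma measurable_qmu : measurable_fun setT qmu.
Proof.
have h (f : R -> R) : measurable_fun setT f -> (forall u, `|f u| <= 1) ->
    measurable_fun setT (fun xi => \int[mu]_y f (dotp y xi)).
  move=> mf f1.
  have mfd : measurable_fun setT (fun p : V * V => (1 + f (dotp p.2 p.1))%:E).
    apply/measurable_EFinP; apply: measurable_funD => //; apply: (measurableT_comp mf).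
    by apply: measurable_dotp; [exact: measurable_snd|exact: measurable_fst].
  have f0 u : 0 <= 1 + f u by have := f1 u; rewrite ler_norml => /andP[]; lra.
  (* Tonelli gives measurability in the parameter for nonnegative integrands, hence the shift by
     1. *)
  rewrite (_ : (fun _ => _) = (fun xi => fine (\int[mu]_y (1 + f (dotp y xi))%:E)%E - 1)).
    apply: measurable_funB => //; apply: (measurableT_comp (f := fine)) => //.
    by apply: (measurable_fun_fubini_tonelli_F (m2 := mu) (fun p : V * V => (1 + f (dotp p.2 p.1))%:E)) => // p; rewrite lee_fin.
  apply/funext => xi.
  have mfy : measurable_fun setT (fun y : V => f (dotp y xi)).
    by apply: (measurableT_comp mf); apply: measurable_dotp => //; exact: measurable_cst.
  have iff : mu.-integrable setT (EFin \o (fun y : V => f (dotp y xi))) by apply: (bounded_integrable mu mfy) => y.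
  rewrite -[fine _]/(\int[mu]_y (1 + f (dotp y xi))).
  by rewrite RintegralD// int1; ring.
by apply: measurable_funD; apply: measurable_funX; apply: h => //; [exact: measurable_cos|exact: measurable_sin].
Qed.

(* Only the even part of H is known to have a real, nonnegative Fourier transform,
   but mu x mu is symmetric; adding the total mass of om makes both sides integrals
   of nonnegative functions, so that Tonelli applies. *)
Lemma fourier_double (om H : V -> R) :
  measurable_fun setT om -> (forall xi, 0 <= om xi) -> leb.-integrable setT (EFin \o om) ->
  measurable_fun setT H -> (forall z, 0 <= H z) ->
  (forall z, H z + H (- z) = 2 * \int[leb]_xi (om xi * cos (dotp z xi))) ->
  (\int[mu]_y \int[mu]_z (H (y - z)%R)%:E = \int[leb]_xi (om xi * qmu xi)%:E)%E.
Proof.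
move=> mom om0 iom mH H0 HE.
have m1 : measurable_fun setT (fst : V * V -> V) by exact: measurable_fst.
have m2 : measurable_fun setT (snd : V * V -> V) by exact: measurable_snd.
pose B := \int[leb]_xi om xi.
have BE : (\int[leb]_xi (om xi)%:E = B%:E)%E by exact: EFin_Rintegral.
have c0 u : 0 <= 1 + cos u :> R by have := cos_geN1 u; lra.
have momc z : measurable_fun setT (fun xi => om xi * cos (dotp z xi)).
  by apply: measurable_funM => //; apply: mcos => //; exact: measurable_cst.
have iomc z : leb.-integrable setT (EFin \o (fun xi => om xi * cos (dotp z xi))).
  apply: (integrable_dominated (momc z) iom) => xi.
  by rewrite normrM ger0_norm// ler_piMr.
have E1 z : ((H z)%:E + (H (- z))%:E + (2 * B)%:E = 2%:E * \int[leb]_xi (om xi * (1 + cos (dotp z xi)))%:E)%E.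
  have -> : (fun xi => (om xi * (1 + cos (dotp z xi)))%:E) = (fun xi => (om xi + om xi * cos (dotp z xi))%:E).
    by apply/funext => xi; rewrite mulrDr mulr1.
  rewrite EFin_Rintegral; last exact: integrable_addr.
  by rewrite RintegralD// -EFinM -!EFinD HE; congr EFin; rewrite /B; ring.
pose X := (\int[mu]_y \int[mu]_z (H (y - z)%R)%:E)%E.
pose Y := (\int[leb]_xi (om xi * qmu xi)%:E)%E.
have mHs : measurable_fun setT (fun p : V * V => (H (p.1 - p.2))%:E).
  by apply/measurable_EFinP; apply: (measurableT_comp mH); exact: measurable_rVB.
have mHs' : measurable_fun setT (fun p : V * V => (H (p.2 - p.1))%:E).
  by apply/measurable_EFinP; apply: (measurableT_comp mH); exact: measurable_rVB.
have Hs0 (p : V * V) : (0 <= (H (p.1 - p.2)%R)%:E)%E by rewrite lee_fin.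
have Hs0' (p : V * V) : (0 <= (H (p.2 - p.1)%R)%:E)%E by rewrite lee_fin.
have X' : X = (\int[mu]_y \int[mu]_z (H (z - y)%R)%:E)%E.
  by rewrite /X (fubini_tonelli (fun p : V * V => (H (p.1 - p.2))%:E) mHs Hs0).
have mHy y : measurable_fun setT (fun z : V => H (y - z)).
  by apply: (measurableT_comp mH); apply: measurable_rVB => //; exact: measurable_cst.
have mHy' y : measurable_fun setT (fun z : V => H (z - y)).
  by apply: (measurableT_comp mH); apply: measurable_rVB => //; exact: measurable_cst.
have mF1 : measurable_fun setT (fun y => (\int[mu]_z (H (y - z)%R)%:E)%E).
  exact: (measurable_fun_fubini_tonelli_F (m2 := mu) (fun p : V * V => (H (p.1 - p.2))%:E)).
have mF2 : measurable_fun setT (fun y => (\int[mu]_z (H (z - y)%R)%:E)%E).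
  exact: (measurable_fun_fubini_tonelli_F (m2 := mu) (fun p : V * V => (H (p.2 - p.1))%:E)).
have B0 : 0 <= B by exact: Rintegral_ge0.
have L : (\int[mu]_y \int[mu]_z ((H (y - z)%R)%:E + (H (z - y)%R)%:E + (2 * B)%:E) = X + X + (2 * B)%:E)%E.
  have F10 y : (0 <= \int[mu]_z (H (y - z)%R)%:E)%E by apply: integral_ge0 => z _; rewrite lee_fin.
  have F20 y : (0 <= \int[mu]_z (H (z - y)%R)%:E)%E by apply: integral_ge0 => z _; rewrite lee_fin.
  have B20 : (0 <= (2 * B)%:E)%E by rewrite lee_fin mulr_ge0.
  have mc : measurable_fun setT (fun _ : V => (2 * B)%:E) by exact: measurable_cst.
  have e1 y : (\int[mu]_z ((H (y - z)%R)%:E + (H (z - y)%R)%:E + (2 * B)%:E) =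
      \int[mu]_z (H (y - z)%R)%:E + \int[mu]_z (H (z - y)%R)%:E + (2 * B)%:E)%E.
    have mHE : measurable_fun setT (fun z => (H (y - z)%R)%:E) by apply/measurable_EFinP; exact: mHy.
    have mHE' : measurable_fun setT (fun z => (H (z - y)%R)%:E) by apply/measurable_EFinP; exact: mHy'.
    have h0 z : (0 <= (H (y - z)%R)%:E)%E by rewrite lee_fin.
    have h0' z : (0 <= (H (z - y)%R)%:E)%E by rewrite lee_fin.
    rewrite (integralDe mu (emeasurable_funD mHE mHE') mc (fun z => adde_ge0 (h0 z) (h0' z)) (fun=> B20)).
    by rewrite (integralDe mu mHE mHE' h0 h0') integral_cst_probability.
  under eq_integral do rewrite e1.
  rewrite (integralDe mu (emeasurable_funD mF1 mF2) mc (fun z => adde_ge0 (F10 z) (F20 z)) (fun=> B20)).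
  by rewrite (integralDe mu mF1 mF2 F10 F20) integral_cst_probability -X'.
have Rr : (\int[mu]_y \int[mu]_z ((H (y - z)%R)%:E + (H (z - y)%R)%:E + (2 * B)%:E) = 2%:E * (B%:E + Y))%E.
  pose F (p : V * V) := (\int[leb]_xi (om xi * (1 + cos (dotp (p.1 - p.2) xi)))%:E)%E.
  have mF3 : measurable_fun setT (fun q : (V * V) * V => (om q.2 * (1 + cos (dotp (q.1.1 - q.1.2) q.2)))%:E).
    apply/measurable_EFinP; apply: measurable_funM; first by apply: (measurableT_comp mom); exact: measurable_snd.
    apply: measurable_funD; first exact: measurable_cst.
    apply: mcos; last exact: measurable_snd.
    by apply: measurable_rVB; [apply: (measurableT_comp m1)|apply: (measurableT_comp m2)]; exact: measurable_fst.
  have mF : measurable_fun setT F.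
    apply: (measurable_fun_fubini_tonelli_F (m2 := leb) (fun q : (V * V) * V => (om q.2 * (1 + cos (dotp (q.1.1 - q.1.2) q.2)))%:E)); first exact: mF3.
    by move=> q; rewrite lee_fin; exact: mulr_ge0.
  have F0 p : (0 <= F p)%E by apply: integral_ge0 => xi _; rewrite lee_fin mulr_ge0.
  have lee02 : (0 <= 2%:E :> \bar R)%E by rewrite lee_fin.
  transitivity (\int[mu]_y \int[mu]_z (2%:E * F (y, z)))%E.
    by apply: eq_integral => y _; apply: eq_integral => z _; rewrite /F /= -E1 opprB.
  have mFy y : measurable_fun setT (fun z => F (y, z)) by apply: (measurableT_comp mF); exact: measurable_fun_pair.
  transitivity (\int[mu]_y (2%:E * \int[mu]_z F (y, z)))%E.
    apply: eq_integral => y _.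
    by rewrite (integralZle mu (mFy y) (fun z => F0 (y, z)) lee02).
  have mFI : measurable_fun setT (fun y => \int[mu]_z F (y, z))%E.
    exact: (measurable_fun_fubini_tonelli_F (m2 := mu) F mF F0).
  have FI0 y : (0 <= \int[mu]_z F (y, z))%E by apply: integral_ge0 => z _; exact: F0.
  rewrite (integralZle mu mFI FI0 lee02).
  congr (_ * _)%E.
  (* The frequency integral moves outwards one variable at a time, past z here and past y
     afterwards. *)
  have sw y : (\int[mu]_z F (y, z) = \int[leb]_xi \int[mu]_z (om xi * (1 + cos (dotp (y - z)%R xi)))%:E)%E.
    apply: (fubini_tonelli (fun p : V * V => (om p.2 * (1 + cos (dotp (y - p.1) p.2)))%:E)).
      apply/measurable_EFinP; apply: measurable_funM; first exact: (measurableT_comp mom).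
      apply: measurable_funD; first exact: measurable_cst.
      by apply: mcos; [apply: measurable_rVB; [exact: measurable_cst|exact: m1]|exact: m2].
    by move=> p; rewrite lee_fin; exact: mulr_ge0.
  under eq_integral do rewrite sw.
  have mG3 : measurable_fun setT (fun q : (V * V) * V => (om q.1.2 * (1 + cos (dotp (q.1.1 - q.2) q.1.2)))%:E).
    apply/measurable_EFinP; apply: measurable_funM.
      by apply: (measurableT_comp mom); apply: (measurableT_comp m2); exact: measurable_fst.
    apply: measurable_funD; first exact: measurable_cst.
    apply: mcos; last by apply: (measurableT_comp m2); exact: measurable_fst.
    by apply: measurable_rVB; [apply: (measurableT_comp m1); exact: measurable_fst|exact: measurable_snd].
  pose G (p : V * V) := (\int[mu]_z (om p.2 * (1 + cos (dotp (p.1 - z) p.2)))%:E)%E.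
  have mG : measurable_fun setT G.
    apply: (measurable_fun_fubini_tonelli_F (m2 := mu) (fun q : (V * V) * V => (om q.1.2 * (1 + cos (dotp (q.1.1 - q.2) q.1.2)))%:E)); first exact: mG3.
    by move=> q; rewrite lee_fin; exact: mulr_ge0.
  have G0 p : (0 <= G p)%E by apply: integral_ge0 => z _; rewrite lee_fin mulr_ge0.
  rewrite (fubini_tonelli G mG G0) /G /=.
  transitivity (\int[leb]_xi ((om xi)%:E + (om xi * qmu xi)%:E))%E.
    apply: eq_integral => xi _.
    transitivity ((om xi)%:E * \int[mu]_y \int[mu]_z (1 + cos (dotp (y - z)%R xi))%:E)%E.
      have mc y : measurable_fun setT (fun z => (1 + cos (dotp (y - z) xi))).
        apply: measurable_funD; first exact: measurable_cst.
        apply: mcos; last exact: measurable_cst.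
        by apply: measurable_rVB; [exact: measurable_cst|exact: measurable_id].
      have mI : measurable_fun setT (fun y => \int[mu]_z (1 + cos (dotp (y - z)%R xi))%:E)%E.
        apply: (measurable_fun_fubini_tonelli_F (m2 := mu) (fun p : V * V => (1 + cos (dotp (p.1 - p.2) xi))%:E)).
          apply/measurable_EFinP; apply: measurable_funD; first exact: measurable_cst.
          by apply: mcos; [exact: measurable_rVB|exact: measurable_cst].
        by move=> p; rewrite lee_fin; exact: c0.
      have I0 y : (0 <= \int[mu]_z (1 + cos (dotp (y - z)%R xi))%:E)%E.
        by apply: integral_ge0 => z _; rewrite lee_fin; exact: c0.
      rewrite -(integralZle mu mI I0 (_ : (0 <= (om xi)%:E)%E)); last by rewrite lee_fin.
      apply: eq_integral => y _.
      have h0 (z : V) : 0 <= 1 + cos (dotp (y - z) xi) by exact: c0.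
      exact: (ge0_integralZr_real mu (mc y) (om0 xi) h0).
    by rewrite integral_cos_qmu -EFinM mulrDr mulr1 EFinD.
  have moq : measurable_fun setT (fun xi => om xi * qmu xi).
    by apply: measurable_funM; [exact: mom|exact: measurable_qmu].
  rewrite (ge0_integralDr_real leb mom moq om0 (fun xi => mulr_ge0 (om0 xi) (qmu_ge0 xi))).
  by rewrite BE.
have X0 : (0 <= X)%E by apply: integral_ge0 => y _; apply: integral_ge0 => z _; rewrite lee_fin.
have Y0 : (0 <= Y)%E by apply: integral_ge0 => xi _; rewrite lee_fin; exact: (mulr_ge0 (om0 xi) (qmu_ge0 xi)).
have : (X + X + (2 * B)%:E = 2%:E * (B%:E + Y))%E by rewrite -L -Rr.
(* X and Y may be infinite; since B is finite, the identity makes them infinite together and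
   otherwise lets B cancel. *)
rewrite -/X -/Y; case: X X0 {X' L Rr} => [x| |] //= X0; case: Y Y0 => [y| |] //= Y0.
- by move=> -[E]; congr EFin; lra.
- by rewrite gt0_muley// lte_fin.
Qed.

End power_spectrum.

(** * Regularized energies in Fourier variables *)

Section fourier_kernel.
Variables (R : realType) (n : nat).
Local Notation V := 'rV[R]_n.
Local Notation leb := (lebesgue_rV R n).
Implicit Types (x y z w xi : V) (t s : R).

(** The constant of the Fourier inversion formula. *)
Definition kappa : R := ((2 * pi) ^+ n)^-1.

Lemma kappa_gt0 : 0 < kappa.
Proof. by rewrite invr_gt0 exprn_gt0// mulr_gt0// pi_gt0. Qed.

(** In dimension 0 the measure is the Dirac mass at 0, whence the condition on n. *)
Lemma lebesgue_rV_set1 : (0 < n)%N -> leb [set 0] = 0%E.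
Proof.
move=> n0; rewrite (_ : [set 0] = [set x : V | forall i, [set 0] (x ord0 i)]).
  rewrite (lebesgue_rV_box (A := fun=> [set 0])); last by move=> i; exact: measurable_set1.
  rewrite (eq_bigr (fun=> 0%E)); last by move=> i _; exact: lebesgue_measure_set1.
  by rewrite (bigD1 (Ordinal n0))//= mul0e.
apply/seteqP; split=> x /=; first by move=> -> i; rewrite mxE.
by move=> h; apply/rowP => i; rewrite mxE h.
Qed.

Lemma measurable_rV_set1 : measurable [set 0 : V].
Proof.
rewrite (_ : [set 0] = (fun x : V => dotp x x) @^-1` [set 0]).
  by rewrite -[X in measurable X]setTI; apply: measurable_dotp.
by apply/seteqP; split=> x /=; [move=> ->; apply/eqP; rewrite dotp_eq0|move/eqP; rewrite dotp_eq0 => /eqP].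
Qed.

Lemma ae_neq0 : (0 < n)%N -> {ae leb, forall x : V, x != 0}.
Proof.
move=> n0; exists [set 0]; split; [exact: measurable_rV_set1|exact: lebesgue_rV_set1|].
by move=> x /=; rewrite -[is_true _]/(is_true (x != 0)) => /negP; rewrite negbK => /eqP.
Qed.

(** The Fourier transform of [heat t]. *)
Definition gss t xi : R := expR (- (t / 2 * dotp xi xi)).

Lemma gss_ge0 t xi : 0 <= gss t xi. Proof. exact: expR_ge0. Qed.

Lemma measurable_gss t : measurable_fun setT (gss t).
Proof. exact: measurable_expR_dotp. Qed.

Let sqrt_kappa t : 0 < t -> Num.sqrt (pi / (t / 2)) ^+ n = kappa^-1 * (Num.sqrt (2 * pi * t))^-1 ^+ n.
Proof.
move=> t0; rewrite /kappa invrK -exprMn; congr (_ ^+ _).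
have p0 := pi_gt0 R.
have -> : pi / (t / 2) = (2 * pi) ^+ 2 * (2 * pi * t)^-1.
  by move: p0; move: (@pi R) => p p0; field; rewrite (gt_eqF t0) (gt_eqF p0).
rewrite sqrtrM ?sqr_ge0// sqrtr_sqr ger0_norm ?mulr_ge0 ?pi_ge0//.
by rewrite sqrtrV// !mulr_ge0 ?pi_ge0// ltW.
Qed.

Let int_cos c d y t : 0 < t -> `|d| <= c ->
  (\int[leb]_xi ((c + d * cos (dotp y xi)) * gss t xi)%:E =
   (kappa^-1 * (c * heat t (0 : V) + d * heat t y))%:E)%E.
Proof.
move=> t0 dc; have a0 : 0 < t / 2 by rewrite divr_gt0.
have := ge0_integral_cos_gauss 0 y a0 dc; rewrite sqrt_kappa// cos0 mulr1.
have -> : (fun x => ((c + d * cos (dotp y x + 0)) * expR (- (t / 2 * dotp x x)))%:E) =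
   (fun xi => ((c + d * cos (dotp y xi)) * gss t xi)%:E) by apply/funext => x; rewrite addr0.
move=> ->; congr EFin; rewrite /heat (_ : dotp 0 0 = 0); last by apply/eqP; rewrite dotp_eq0.
rewrite mul0r oppr0 expR0 (_ : 4 * (t / 2) = 2 * t); last by field.
by ring.
Qed.

Lemma integrable_gss t : 0 < t -> leb.-integrable setT (EFin \o gss t).
Proof.
move=> t0; apply/integrableP; split; first by apply/measurable_EFinP; exact: measurable_gss.
under eq_integral do rewrite /= ger0_norm ?gss_ge0//.
have := @int_cos 1 0 0 t t0; rewrite normr0 => /(_ ler01).
have -> : (fun xi => ((1 + 0 * cos (dotp 0 xi)) * gss t xi)%:E) = (fun xi => (gss t xi)%:E).
  by apply/funext => x; rewrite mul0r addr0 mul1r.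
by move=> ->; rewrite ltry.
Qed.

Lemma measurable_cos_dotp y : measurable_fun setT (fun xi => cos (dotp y xi)).
Proof.
by apply: (measurableT_comp (@measurable_cos R)); apply: measurable_dotp; [exact: measurable_cst|exact: measurable_id].
Qed.

Lemma integrable_cos_mul y (om : V -> R) : measurable_fun setT om ->
  leb.-integrable setT (EFin \o om) -> leb.-integrable setT (EFin \o (fun xi => om xi * cos (dotp y xi))).
Proof.
move=> mom iom; have iabs : leb.-integrable setT (EFin \o (fun xi => `|om xi|)) by exact: (integrable_abse iom).
apply: (integrable_dominated _ iabs).
  by apply: measurable_funM; [exact: mom|exact: measurable_cos_dotp].
by move=> xi; rewrite normrM ler_piMr// ler_norml cos_geN1 cos_le1.
Qed.

Lemma Rintegral_cos_gss y t : 0 < t -> \int[leb]_xi (gss t xi * cos (dotp y xi)) = kappa^-1 * heat t y.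
Proof.
move=> t0; have ig := integrable_gss t0; have ic := integrable_cos_mul y (measurable_gss t) ig.
have h1 : \int[leb]_xi gss t xi = kappa^-1 * heat t (0 : V).
  have := @int_cos 1 0 0 t t0; rewrite normr0 => /(_ ler01).
  have -> : (fun xi => ((1 + 0 * cos (dotp 0 xi)) * gss t xi)%:E) = (fun xi => (gss t xi)%:E).
    by apply/funext => x; rewrite mul0r addr0 mul1r.
  by rewrite /Rintegral => ->; rewrite /=; ring.
have := @int_cos 1 1 y t t0; rewrite normr1 => /(_ (lexx _)).
have -> : (fun xi => ((1 + 1 * cos (dotp y xi)) * gss t xi)%:E) = (fun xi => (gss t xi + gss t xi * cos (dotp y xi))%:E).
  by apply/funext => x; congr EFin; ring.
rewrite EFin_Rintegral; last exact: integrable_addr.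
by rewrite RintegralD// h1 => -[]; lra.
Qed.

Lemma heat_mass_fourier (mu : probability V R) t : 0 < t ->
  heat_mass mu t = (\int[leb]_xi (kappa * gss t xi * qmu mu xi)%:E)%E.
Proof.
move=> t0; apply: (fourier_double mu (om := fun xi => kappa * gss t xi) (H := heat t)).
- by apply: measurable_funM => //; exact: measurable_gss.
- by move=> xi; rewrite mulr_ge0 ?gss_ge0// ltW// kappa_gt0.
- exact: integrable_mulrl (integrable_gss t0).
- exact: measurable_heat.
- by move=> z; exact: heat_ge0.
move=> z; rewrite heatN.
have -> : \int[leb]_xi (kappa * gss t xi * cos (dotp z xi)) = \int[leb]_xi (kappa * (gss t xi * cos (dotp z xi))).
  by apply: eq_Rintegral => xi _; rewrite mulrA.
rewrite RintegralZl//; last by apply: integrable_cos_mul; [exact: measurable_gss|exact: integrable_gss].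
by rewrite Rintegral_cos_gss// (mulrA kappa) mulfV ?gt_eqF ?kappa_gt0// mul1r; ring.
Qed.

Section kernel.
Variables (W hm : V -> R).
Hypothesis mW : measurable_fun setT W.
Hypothesis W0 : forall x, 0 <= W x.
Hypothesis FW : distributional_fourier (fun x => (W x)%:C%C) (fun xi => (hm xi)%:C%C).
Hypothesis mhm : measurable_fun setT hm.
Hypothesis hm0 : forall xi, 0 <= hm xi.
Hypothesis ihm : forall t, 0 < t -> leb.-integrable setT (EFin \o (fun xi => hm xi * gss t xi)).
Hypothesis Wfin : forall t z, 0 < t -> (hconv (EFin \o W) t z < +oo)%E.

Let H t z := fine (hconv (EFin \o W) t z).

Lemma fine_hconvK t z : 0 < t -> (H t z)%:E = hconv (EFin \o W) t z.
Proof. by move=> t0; rewrite fineK// ge0_fin_numE ?Wfin// conv_ge0. Qed.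

Lemma integrable_hconv t z : 0 < t -> leb.-integrable setT (EFin \o (fun x => W x * heat t (x - z))).
Proof.
move=> t0; apply/integrableP; split.
  apply/measurable_EFinP; apply: measurable_funM; first exact: mW.
  by apply: measurable_heat; apply: measurable_rVB; [exact: measurable_id|exact: measurable_cst].
apply: le_lt_trans (Wfin z t0); apply: ge0_le_integral => //.
- apply: measurableT_comp => //; apply/measurable_EFinP; apply: measurable_funM; first exact: mW.
  by apply: measurable_heat; apply: measurable_rVB; [exact: measurable_id|exact: measurable_cst].
- apply/measurable_EFinP; apply: measurable_funM; first exact: mW.
  by apply: measurable_heat; apply: measurable_rVB; [exact: measurable_id|exact: measurable_cst].
- by move=> x _; rewrite /= ger0_norm// mulr_ge0// heat_ge0.
Qed.

(** The distributional identity is tested against gss t xi cos(z.xi), whose Fourier transform is (2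
    pi)^n times the mean of the heat kernels centred at z and -z. This yields the even part of the
    regularized kernel, the input of [fourier_double]. *)
Lemma hconv_fourier t z : 0 < t ->
  H t z + H t (- z) = 2 * \int[leb]_xi (kappa * hm xi * gss t xi * cos (dotp z xi)).
Proof.
move=> t0; have a0 : 0 < t / 2 by rewrite divr_gt0.
have k0 := kappa_gt0.
have := FW (schwartz_gauss_cos z a0) => /(congr1 (@complex.Re R)).
rewrite [in LHS]/cintegral [in RHS]/cintegral.
set phi := fun x : V => (expR (- (t / 2 * dotp x x)) * cos (dotp z x))%:C%C.
rewrite [LHS]/= [RHS]/=.
have reF x : complex.Re (fourier phi x) = kappa^-1 * (heat t (x - z) + heat t (x - (- z))) / 2.
  rewrite /fourier /cintegral /=.
  transitivity (\int[leb]_xi (2^-1 * (gss t xi * cos (dotp (x - z) xi) + gss t xi * cos (dotp (x - (- z)) xi)))).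
    apply: eq_Rintegral => xi _; rewrite /phi /= mulr0 subr0 cosN -/(gss t xi) (dotpC xi x).
    by rewrite opprK !dotpDl dotpNl cosB cosD; field.
  have i1 := integrable_cos_mul (x - z) (measurable_gss t) (integrable_gss t0).
  have i2 := integrable_cos_mul (x - (- z)) (measurable_gss t) (integrable_gss t0).
  rewrite RintegralZl//; last exact: integrable_addr.
  by rewrite RintegralD// !Rintegral_cos_gss//; ring.
have i1 := integrable_hconv z t0; have i2 := integrable_hconv (- z) t0.
have -> : \int[leb]_x complex.Re ((W x)%:C%C * fourier phi x) = kappa^-1 / 2 * (H t z + H t (- z)).
  transitivity (\int[leb]_x (kappa^-1 / 2 * (W x * heat t (x - z) + W x * heat t (x - - z)))).
    apply: eq_Rintegral => x _.
    have -> : complex.Re ((W x)%:C%C * fourier phi x) = W x * complex.Re (fourier phi x).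
      by case: (fourier phi x) => a b /=; rewrite mul0r subr0.
    by rewrite reF; ring.
  rewrite RintegralZl//; last exact: integrable_addr.
  by rewrite RintegralD.
have -> : \int[leb]_xi complex.Re ((hm xi)%:C%C * phi xi) = \int[leb]_xi (hm xi * gss t xi * cos (dotp z xi)).
  by apply: eq_Rintegral => xi _; rewrite /phi /= mul0r subr0 mulrA.
move=> E.
have -> : \int[leb]_xi (kappa * hm xi * gss t xi * cos (dotp z xi)) = \int[leb]_xi (kappa * (hm xi * gss t xi * cos (dotp z xi))).
  by apply: eq_Rintegral => xi _; rewrite !mulrA.
rewrite RintegralZl//; last first.
  by apply: (integrable_cos_mul z _ (ihm t0)); apply: measurable_funM; [exact: mhm|exact: measurable_gss].
rewrite -E; move: (H t z + H t (- z)) (kappa) k0 => h k k0.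
by field; rewrite gt_eqF.
Qed.

Lemma energy_heat_fourier (mu : probability V R) t : 0 < t ->
  energy_heat mu (EFin \o W) t = (\int[leb]_xi (kappa * hm xi * gss t xi * qmu mu xi)%:E)%E.
Proof.
move=> t0.
have mg : measurable_fun setT (fun xi => hm xi * gss t xi).
  by apply: measurable_funM; [exact: mhm|exact: measurable_gss].
have mEW : measurable_fun setT (EFin \o W) by apply/measurable_EFinP.
have mH : measurable_fun setT (H t).
  by apply: (measurableT_comp (f := fine)) => //; exact: measurable_conv.
transitivity (\int[mu]_y \int[mu]_z (H t (y - z)%R)%:E)%E.
  by apply: eq_integral => y _; apply: eq_integral => z _; rewrite fine_hconvK.
apply: (fourier_double mu (om := fun xi => kappa * hm xi * gss t xi) (H := H t)).
- by apply: measurable_funM; [apply: measurable_funM => //; exact: mhm|exact: measurable_gss].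
- by move=> xi; rewrite !mulr_ge0 ?gss_ge0// ltW// kappa_gt0.
- have -> : (fun xi => kappa * hm xi * gss t xi) = (fun xi => kappa * (hm xi * gss t xi)).
    by apply/funext => xi; rewrite mulrA.
  exact: integrable_mulrl (ihm t0).
- exact: mH.
- by move=> z; rewrite fine_ge0// conv_ge0.
- by move=> z; exact: hconv_fourier.
Qed.

Variables (m0 m1 : R).
Hypothesis m00 : 0 < m0.
Hypothesis hm_ub : forall xi, hm xi * dotp xi xi <= m1.
Hypothesis hm_lb : forall xi, xi != 0 -> m0 <= hm xi * dotp xi xi.
Hypothesis n0 : (0 < n)%N.
Variable mu : probability V R.

(** Read off from [integral_cos_qmu], whose left-hand side is at most 2. *)
Let q1 xi : qmu mu xi <= 1.
Proof.
rewrite -lee_fin -(leeD2lE (x := 1%:E))// -EFinD -integral_cos_qmu.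
have m2 : measurable_fun setT (fun p : V * V => (1 + cos (dotp (p.1 - p.2) xi))%:E).
  apply/measurable_EFinP; apply: measurable_funD; first exact: measurable_cst.
  apply: (measurableT_comp (@measurable_cos R)); apply: measurable_dotp; last exact: measurable_cst.
  by apply: measurable_rVB; [exact: measurable_fst|exact: measurable_snd].
have c0 u : 0 <= 1 + cos u :> R by have := cos_geN1 u; lra.
have p0 (p : V * V) : (0 <= (1 + cos (dotp (p.1 - p.2) xi))%:E)%E by rewrite lee_fin.
have le2 y : (\int[mu]_z (1 + cos (dotp (y - z)%R xi))%:E <= 2%:E)%E.
  rewrite -(integral_cst_probability mu 2); apply: ge0_le_integral => //.
  - apply/measurable_EFinP; apply: measurable_funD; first exact: measurable_cst.
    apply: (measurableT_comp (@measurable_cos R)); apply: measurable_dotp; last exact: measurable_cst.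
    by apply: measurable_rVB; [exact: measurable_cst|exact: measurable_id].
  - by move=> z _; rewrite lee_fin; have := cos_le1 (dotp (y - z) xi); lra.
rewrite -EFinD (_ : 1 + 1 = 2 :> R)// -(integral_cst_probability mu 2); apply: ge0_le_integral => //.
- by move=> y _; apply: integral_ge0 => z _; rewrite lee_fin.
- exact: (measurable_fun_fubini_tonelli_F (m2 := mu) _ m2 p0).
Qed.

Let q0 xi : 0 <= qmu mu xi. Proof. exact: qmu_ge0. Qed.

Let J s : R := fine (energy_heat mu (EFin \o W) (2 * s)).
Let A s : R := fine (heat_mass mu (2 * s)).

Let e s xi : R := expR (- (s * dotp xi xi)).

Let gss2 s xi : gss (2 * s) xi = e s xi.
Proof. by rewrite /gss /e (_ : 2 * s / 2 = s)//; field. Qed.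

Let f s xi := kappa * hm xi * e s xi * qmu mu xi.

Let mf s : measurable_fun setT (f s).
Proof.
apply: measurable_funM; last exact: measurable_qmu.
by apply: measurable_funM; [apply: measurable_funM => //; exact: mhm|exact: measurable_expR_dotp].
Qed.

Let ie s : 0 < s -> leb.-integrable setT (EFin \o e s).
Proof.
move=> s0; have := @integrable_gss (2 * s) (mulr_gt0 (ltr0n R 2) s0).
by rewrite (_ : gss (2 * s) = e s)//; apply/funext => xi; exact: gss2.
Qed.

Let if_ s : 0 < s -> leb.-integrable setT (EFin \o f s).
Proof.
move=> s0; have i := integrable_mulrl kappa (@ihm (2 * s) (mulr_gt0 (ltr0n R 2) s0)).
have k0 := ltW kappa_gt0.
apply: (integrable_dominated (mf s) i) => xi; rewrite gss2 ger0_norm.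
  by rewrite /f -[leRHS]mulr1 !mulrA ler_wpM2l// !mulr_ge0// expR_ge0.
by rewrite !mulr_ge0// expR_ge0.
Qed.

Lemma fine_energy_heat s : 0 < s -> energy_heat mu (EFin \o W) (2 * s) = (J s)%:E.
Proof.
move=> s0; have E : energy_heat mu (EFin \o W) (2 * s) = (\int[leb]_xi (f s xi)%:E)%E.
  rewrite energy_heat_fourier; last exact: mulr_gt0.
  by apply: eq_integral => xi _; rewrite gss2.
by rewrite /J fineK// E; apply: integrable_fin_num => //; exact: if_.
Qed.

Lemma fine_heat_mass s : 0 < s -> heat_mass mu (2 * s) = (A s)%:E.
Proof.
move=> s0; rewrite /A fineK// heat_mass_fourier ?mulr_gt0//.
have k0 := ltW kappa_gt0.
apply: (@integrable_fin_num _ _ _ leb setT measurableT (fun xi => (kappa * gss (2 * s) xi * qmu mu xi)%:E)).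
apply: (integrable_dominated _ (integrable_mulrl kappa (ie s0))).
  by apply: measurable_funM; [apply: measurable_funM => //; exact: measurable_gss|exact: measurable_qmu].
move=> xi; rewrite gss2 ger0_norm; last by rewrite !mulr_ge0// expR_ge0.
by rewrite ler_piMr// mulr_ge0// expR_ge0.
Qed.

(** In frequency, time enters through exp(-s |xi|^2) alone. Its derivative brings down -|xi|^2, and
    hm |xi|^2 >= m0 leaves m0 times the integrand of A. *)
Lemma is_derive_energy_heat s : 0 < s -> exists d, is_derive s 1 J d /\ d <= - (m0 * A s).
Proof.
move=> s0; have k0 := ltW kappa_gt0.
pose df s xi := - (kappa * (hm xi * dotp xi xi) * e s xi * qmu mu xi).
have mdp : measurable_fun setT (fun xi : V => dotp xi xi) by apply: measurable_dotp; exact: measurable_id.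
have mdf r : measurable_fun setT (df r).
  apply: measurableT_comp => //; apply: measurable_funM; last exact: measurable_qmu.
  apply: measurable_funM; last exact: measurable_expR_dotp.
  by apply: measurable_funM => //; apply: measurable_funM; [exact: mhm|exact: mdp].
(* Domination near s: hm |xi|^2 <= m1 and [qmu] at most 1 leave an integrable Gaussian at the
   earlier time s / 2. *)
have df_le r xi : s / 2 < r -> `|df r xi| <= kappa * m1 * e (s / 2) xi.
  move=> sr; rewrite /df normrN ger0_norm; last by rewrite !mulr_ge0 ?expR_ge0 ?dotp_ge0.
  apply: (@le_trans _ _ (kappa * (hm xi * dotp xi xi) * e r xi)).
    by rewrite ler_piMr// !mulr_ge0 ?expR_ge0 ?dotp_ge0.
  apply: ler_pM; rewrite ?mulr_ge0 ?expR_ge0 ?dotp_ge0//.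
    exact: ler_wpM2l.
  by rewrite ler_expR lerN2; apply: ler_wpM2r; [exact: dotp_ge0|exact: ltW].
have s20 : 0 < s / 2 by rewrite divr_gt0.
have idf : leb.-integrable setT (EFin \o df s).
  apply: (integrable_dominated (mdf s) (integrable_mulrl (kappa * m1) (ie s20))) => xi.
  by apply: df_le; lra.
have JE r : 0 < r -> J r = \int[leb]_xi f r xi.
  move=> r0; rewrite /J energy_heat_fourier; last exact: mulr_gt0.
  by congr fine; apply: eq_integral => xi _; rewrite gss2.
exists (\int[leb]_xi df s xi); split.
  have D : is_derive s 1 (fun r => \int[leb]_xi f r xi) (\int[leb]_xi df s xi).
    apply: (@is_derive_under_integral R _ V leb f df (fun xi => kappa * m1 * e (s / 2) xi) s (s / 2) (s + 1)).
    - by apply/andP; split; lra.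
    - by move=> r /andP[r0 _]; apply: if_; lra.
    - move=> r xi _.
      have h0 : is_derive r 1 (fun r : R => - (r * dotp xi xi)) (- dotp xi xi).
        by apply: is_derive_eq; rewrite /GRing.scale/=; ring.
      have h1 := @is_derive1_comp R expR (fun r => - (r * dotp xi xi)) r _ _ (is_derive_expR _) h0.
      have h2 := is_deriveM (is_deriveM (is_derive_cst (kappa * hm xi) r 1) h1) (is_derive_cst (qmu mu xi) r 1).
      by apply: (is_derive_eq h2); rewrite /df /e /GRing.scale/=; ring.
    - exact: (integrable_mulrl (kappa * m1) (ie s20)).
    - by move=> r xi /andP[r0 _]; exact: df_le.
  apply: (near_eq_is_derive _ D).
  by near=> r; rewrite JE//; near: r; exact: lt_nbhsr.
have AE : (A s)%:E = (\int[leb]_xi (kappa * e s xi * qmu mu xi)%:E)%E.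
  rewrite -fine_heat_mass// heat_mass_fourier; last exact: mulr_gt0.
  by apply: eq_integral => xi _; rewrite gss2.
have iA : leb.-integrable setT (EFin \o (fun xi => kappa * e s xi * qmu mu xi)).
  apply: (integrable_dominated _ (integrable_mulrl kappa (ie s0))).
    apply: measurable_funM; last exact: measurable_qmu.
    by apply: measurable_funM => //; exact: measurable_expR_dotp.
  move=> xi; rewrite ger0_norm; last by rewrite !mulr_ge0// expR_ge0.
  by rewrite ler_piMr// mulr_ge0// expR_ge0.
have AE' : A s = \int[leb]_xi (kappa * e s xi * qmu mu xi).
  by apply/eqP; rewrite -eqe AE EFin_Rintegral.
have -> : \int[leb]_xi df s xi = - \int[leb]_xi (- df s xi).
  rewrite -mulN1r -RintegralZl//; first by apply: eq_Rintegral => xi _; rewrite mulN1r opprK.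
  have -> : EFin \o (fun xi => - df s xi) = EFin \o (fun xi => -1 * df s xi) by apply/funext => xi /=; rewrite mulN1r.
  exact: integrable_mulrl.
have iN : leb.-integrable setT (EFin \o (fun xi => - df s xi)).
  have -> : EFin \o (fun xi => - df s xi) = EFin \o (fun xi => -1 * df s xi) by apply/funext => xi /=; rewrite mulN1r.
  exact: integrable_mulrl.
rewrite lerN2 AE' -RintegralZl// -lee_fin -!EFin_Rintegral//; last exact: integrable_mulrl.
apply: ae_ge0_le_integral => //.
- by move=> xi _; rewrite lee_fin !mulr_ge0 ?expR_ge0// ltW.
- exact: (measurable_int leb (integrable_mulrl m0 iA)).
- by move=> xi _; rewrite lee_fin opprK !mulr_ge0 ?expR_ge0 ?dotp_ge0.
- exact: (measurable_int leb iN).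
(* The lower bound by m0 holds off the origin only, that is, almost everywhere. *)
apply: filterS (ae_neq0 n0) => xi xi0 _; rewrite lee_fin opprK.
rewrite !mulrA (mulrC m0); apply: ler_wpM2r => //; apply: ler_wpM2r; first exact: expR_ge0.
by rewrite -mulrA; apply: ler_wpM2l => //; exact: hm_lb.
Unshelve. all: end_near. Qed.

End kernel.

End fourier_kernel.

(** * Heat averages of the potential *)

Section heat_equation.
Variables (R : realType) (n : nat).
Local Notation E := 'rV[R]_n.
Local Notation leb := (lebesgue_rV R n).
Implicit Types (x y z : E) (t : R).

(** The time derivative of the heat kernel, which is also half of its Laplacian. *)
Definition dheat t z : R := (dotp z z / (2 * t ^+ 2) - n%:R / (2 * t)) * heat t z.

Lemma is_derive_heat t z : 0 < t -> is_derive t 1 (fun r => heat r z) (dheat t z).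
Proof.
move=> t0; have p0 := pi_gt0 R.
have s0 : 0 < Num.sqrt (2 * pi * t) by rewrite sqrtr_gt0 !mulr_gt0.
have h1 : is_derive t 1 (fun r : R => 2 * pi * r) (2 * pi).
  by apply: is_derive_eq; rewrite /GRing.scale/=; ring.
have pos : 0 < 2 * pi * t by rewrite !mulr_gt0.
have h2 := @is_derive1_comp R Num.sqrt (fun r => 2 * pi * r) t _ _ (is_derive1_sqrt pos) h1.
have h3 : is_derive t 1 (fun r : R => (Num.sqrt (2 * pi * r))^-1) (- (Num.sqrt (2 * pi * t))^-1 / (2 * t)).
  have := @is_deriveV R _ t _ 1 (lt0r_neq0 s0) h2; move=> h; apply: (is_derive_eq h).
  rewrite /= /GRing.scale/= -exprVn.
  have sq : Num.sqrt (2 * pi * t) ^+ 2 = 2 * pi * t by rewrite sqr_sqrtr// ltW.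
  have -> : (2 * t)^-1 = pi / Num.sqrt (2 * pi * t) ^+ 2.
    by rewrite sq; move: p0; move: (@pi R) => p p0; field; rewrite (gt_eqF t0) (gt_eqF p0).
  move: s0; move: (Num.sqrt _) => u u0; move: (@pi R) => p.
  by field; rewrite gt_eqF.
have h4 : is_derive t 1 (fun r : R => (Num.sqrt (2 * pi * r))^-1 ^+ n) (- (n%:R / (2 * t)) * (Num.sqrt (2 * pi * t))^-1 ^+ n).
  case: (n) => [|k].
    rewrite (_ : (fun _ => _) = cst 1); last by apply/funext => r; rewrite expr0.
    by apply: is_derive_eq; rewrite mul0r oppr0 mul0r.
  have h := @is_deriveX R _ (fun r : R => (Num.sqrt (2 * pi * r))^-1) k.+1 t 1 _ h3.
  have e : (fun r : R => (Num.sqrt (2 * pi * r))^-1) ^+ k.+1 = (fun r : R => (Num.sqrt (2 * pi * r))^-1 ^+ k.+1).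
    apply/funext => r; elim: (k.+1) => [|j IH]; first by rewrite !expr0.
    by rewrite !exprS -IH.
  rewrite e in h.
  by apply: (is_derive_eq h); rewrite /GRing.scale/= exprS; ring.
have h5 : is_derive t 1 (fun r : R => - (dotp z z / (2 * r))) (dotp z z / (2 * t ^+ 2)).
  have h : is_derive t 1 (fun r : R => 2 * r) 2 by apply: is_derive_eq; rewrite /GRing.scale/= mulr1.
  have n2 : 2 * t != 0 by rewrite gt_eqF// mulr_gt0.
  have h' := @is_deriveV R _ t _ 1 n2 h.
  have h'' := is_deriveM (is_derive_cst (- dotp z z) t 1) h'.
  have -> : (fun r : R => - (dotp z z / (2 * r))) = cst (- dotp z z) * (fun r => (2 * r)^-1).
    by apply/funext => r; rewrite /= -mulNr.
  by apply: (is_derive_eq h''); rewrite /GRing.scale/=; field; rewrite gt_eqF.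
have h6 := @is_derive1_comp R expR (fun r => - (dotp z z / (2 * r))) t _ _ (is_derive_expR _) h5.
have h7 := is_deriveM h4 h6.
by apply: (is_derive_eq h7); rewrite /dheat /heat /GRing.scale/=; ring.
Qed.

Lemma measurable_dheat d (T : measurableType d) t (f : T -> E) :
  measurable_fun setT f -> measurable_fun setT (fun p => dheat t (f p)).
Proof.
move=> mf; apply: measurable_funM; last exact: measurable_heat.
apply: measurable_funB; last exact: measurable_cst.
by apply: measurable_funM; [exact: measurable_dotp|exact: measurable_cst].
Qed.

(** With q = |z|^2 / (2t) the function is (q - n/2) exp(-q) / t times the normalization, and q
    exp(-q) <= 1. The bound is uniform in z and in t > t0, hence a domination in time. *)
Lemma dheat_le t0 t z : 0 < t0 -> t0 < t ->
  `|dheat t z| <= (1 + n%:R) / t0 * (Num.sqrt (2 * pi * t0))^-1 ^+ n.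
Proof.
move=> t00 tt; have t1 : 0 < t by lra.
pose q := dotp z z / (2 * t); pose c := (Num.sqrt (2 * pi * t))^-1 ^+ n.
have q0 : 0 <= q by rewrite divr_ge0 ?dotp_ge0// mulr_ge0// ltW.
have c0 : 0 <= c by rewrite exprn_ge0// invr_ge0 sqrtr_ge0.
have -> : dheat t z = t^-1 * ((q - n%:R / 2) * expR (- q)) * c.
  by rewrite /dheat /heat -/q -/c /q; field; rewrite gt_eqF.
have h1 : q * expR (- q) <= 1.
  by rewrite expRN ler_pdivrMr ?expR_gt0// mul1r expR_ge_id.
have h2 : expR (- q) <= 1 by rewrite -expR0 ler_expR oppr_le0.
have h3 : `|(q - n%:R / 2) * expR (- q)| <= 1 + n%:R.
  rewrite mulrBl (le_trans (ler_normB _ _))// lerD//.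
    by rewrite ger0_norm// mulr_ge0// expR_ge0.
  rewrite ger0_norm ?mulr_ge0 ?expR_ge0 ?divr_ge0//.
  by have := ler0n R n; have := expR_ge0 (- q); nra.
rewrite normrM (ger0_norm c0) normrM ger0_norm ?invr_ge0 ?(ltW t1)//.
apply: ler_pM => //.
- by rewrite mulr_ge0// invr_ge0 ltW.
- rewrite mulrC; apply: ler_pM => //; first by rewrite invr_ge0 ltW.
  by rewrite lef_pV2 ?posrE// ltW.
have p0 := pi_gt0 R.
have s0 : 0 < Num.sqrt (2 * pi * t0) by rewrite sqrtr_gt0 !mulr_gt0.
have s1 : 0 < Num.sqrt (2 * pi * t) by rewrite sqrtr_gt0 !mulr_gt0.
apply: lerXn2r; rewrite ?nnegrE ?invr_ge0 ?(ltW s0) ?(ltW s1)//.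
rewrite lef_pV2 ?posrE//; apply: ler_wsqrtr; apply: ler_wpM2l; last exact: ltW.
by rewrite mulr_ge0// ltW.
Qed.

Lemma heat_gaussE t x : (fun y => heat t (y - x)) =
  (fun y => (Num.sqrt (2 * pi * t))^-1 ^+ n * expR (- ((2 * t)^-1 * dotp (y - x) (y - x)))).
Proof. by apply/funext => y; rewrite /heat mulrC [in LHS](mulrC (dotp _ _)) mulrC. Qed.

Lemma elem_heat t x : 0 < t -> elem (fun y => heat t (y - x)).
Proof.
move=> t0; rewrite heat_gaussE; apply: elemM; first exact: elem_cst.
by apply: elem_gauss; rewrite invr_ge0 mulr_ge0// ltW.
Qed.

Lemma derive_heat t x y i : 0 < t ->
  'D_(delta_mx ord0 i) (fun y => heat t (y - x)) y = - ((y ord0 i - x ord0 i) / t) * heat t (y - x).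
Proof.
move=> t0; rewrite heat_gaussE deriveMv; last exact: differentiable_gauss.
  rewrite derive_cst derive_gauss /heat (mulrC _^-1 (dotp _ _)); field.
  by rewrite gt_eqF.
exact: differentiable_cst.
Qed.

Lemma derive2_heat t x y i : 0 < t ->
  'D_(delta_mx ord0 i) (fun w => 'D_(delta_mx ord0 i) (fun y => heat t (y - x)) w) y =
  ((y ord0 i - x ord0 i) ^+ 2 / t ^+ 2 - t^-1) * heat t (y - x).
Proof.
move=> t0.
have -> : (fun w => 'D_(delta_mx ord0 i) (fun y => heat t (y - x)) w) =
  (fun w => (- t^-1 * (w ord0 i + - x ord0 i)) * heat t (w - x)).
  by apply/funext => w; rewrite derive_heat//; congr (_ * _); ring.
have dh : differentiable (fun w => heat t (w - x)) y by have [+ _] := elem_differentiable (elem_heat x t0); exact.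
have dl : differentiable (fun w : E => w ord0 i + - x ord0 i) y.
  by apply: differentiableD; [exact: differentiable_coord|exact: differentiable_cst].
have dm : differentiable (fun w : E => - t^-1 * (w ord0 i + - x ord0 i)) y.
  by apply: differentiableM => //; exact: differentiable_cst.
have dc : differentiable (fun _ : E => - t^-1) y by exact: differentiable_cst.
have dx : differentiable (fun w : E => w ord0 i) y by exact: differentiable_coord.
have dcx : differentiable (fun _ : E => - x ord0 i) y by exact: differentiable_cst.
have e1 : 'D_(delta_mx ord0 i) (fun w : E => w ord0 i + - x ord0 i) y = 1.
  by rewrite (deriveDv _ dx dcx) derive_coord derive_cst eqxx addr0.
have e2 : 'D_(delta_mx ord0 i) (fun _ : E => - t^-1) y = 0 := derive_cst _ _ _.
rewrite (deriveMv _ dm dh) derive_heat// (deriveMv _ dc dl) e1 e2; field.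
by rewrite gt_eqF.
Qed.

Lemma laplacian_heat t x y : 0 < t ->
  \sum_i 'D_(delta_mx ord0 i) (fun w => 'D_(delta_mx ord0 i) (fun y => heat t (y - x)) w) y =
  2 * dheat t (y - x).
Proof.
move=> t0; under eq_bigr do rewrite derive2_heat// mulrBl.
rewrite sumrB -!mulr_suml sumr_const card_ord /dheat.
have -> : \sum_(i < n) (y ord0 i - x ord0 i) ^+ 2 = dotp (y - x) (y - x).
  by apply: eq_bigr => i _; rewrite !mxE expr2.
by rewrite -mulr_natl; field; rewrite gt_eqF.
Qed.

End heat_equation.

(** * The cutoff times the heat kernel as a test function *)

Section cutoff_heat.
Variables (R : realType) (n : nat).
Local Notation E := 'rV[R]_n.
Implicit Types (x y z : E) (t rho : R).

Lemma open_dotp (P : set R) : open P -> open [set x : E | P (dotp x x)].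
Proof.
by move=> oP; move/continuousP: (@continuous_dotp2 R n); exact.
Qed.

Lemma derive_locally_cst (f : E -> R) (U : set E) c y v : open U -> U y ->
  (forall x, U x -> f x = c) -> 'D_v f y = 0.
Proof.
move=> oU Uy fc; rewrite (@near_eq_derive _ _ _ f (cst c)) ?derive_cst//.
have nU : nbhs y U by exact: open_nbhs_nbhs.
by apply: filterS nU; exact: fc.
Qed.

Lemma cutoff1 rho y : dotp y y <= rho -> cutoff rho y = 1.
Proof. by move=> h; rewrite /cutoff plateau1//; lra. Qed.

Lemma cutoff0 rho y : rho + 1 <= dotp y y -> cutoff rho y = 0.
Proof. by move=> h; rewrite /cutoff plateau0//; lra. Qed.

Lemma derive_cutoff0 rho y i : ~ (rho <= dotp y y <= rho + 1) ->
  'D_(delta_mx ord0 i) (@cutoff R n rho) y = 0 /\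
  'D_(delta_mx ord0 i) (fun w => 'D_(delta_mx ord0 i) (@cutoff R n rho) w) y = 0.
Proof.
have key c (P : set R) : open P -> P (dotp y y) -> (forall w : E, P (dotp w w) -> cutoff rho w = c) ->
  'D_(delta_mx ord0 i) (@cutoff R n rho) y = 0 /\
  'D_(delta_mx ord0 i) (fun w => 'D_(delta_mx ord0 i) (@cutoff R n rho) w) y = 0.
  move=> oP Py Pc; have oU := open_dotp oP.
  have d1 w : P (dotp w w) -> 'D_(delta_mx ord0 i) (@cutoff R n rho) w = 0.
    by move=> Pw; apply: (derive_locally_cst _ oU Pw) => u; exact: Pc.
  by split; [exact: d1|exact: (derive_locally_cst _ oU Py d1)].
have [h _|h] := ltP (dotp y y) rho.
  by apply: (key 1 [set u | u < rho]) => //= w wr; rewrite cutoff1// ltW.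
have [h1 /(_ isT)//|h1 _] := leP (dotp y y) (rho + 1).
by apply: (key 0 [set u | u > rho + 1]) => //= w wr; rewrite cutoff0// ltW.
Qed.

Lemma partial_cutoff_heat rho t x y i : 0 < t ->
  partial [:: i; i] (fun y => cutoff rho y * heat t (y - x)) y =
  cutoff rho y * 'D_(delta_mx ord0 i) (fun w => 'D_(delta_mx ord0 i) (fun y => heat t (y - x)) w) y +
  (2 * 'D_(delta_mx ord0 i) (@cutoff R n rho) y * 'D_(delta_mx ord0 i) (fun y => heat t (y - x)) y +
   heat t (y - x) * 'D_(delta_mx ord0 i) (fun w => 'D_(delta_mx ord0 i) (@cutoff R n rho) w) y).
Proof.
move=> t0; rewrite /partial /=.
have ec := @elem_cutoff R n rho; have eh := elem_heat x t0.
have [dc dc'] := elem_differentiable ec; have [dh dh'] := elem_differentiable eh.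
have [dc1 _] := elem_differentiable (elem_partial [:: i] ec).
have [dh1 _] := elem_differentiable (elem_partial [:: i] eh).
have -> : (fun x0 => 'D_(delta_mx ord0 i) (fun y => cutoff rho y * heat t (y - x)) x0) =
  (fun w => cutoff rho w * 'D_(delta_mx ord0 i) (fun y => heat t (y - x)) w +
    heat t (w - x) * 'D_(delta_mx ord0 i) (@cutoff R n rho) w).
  by apply/funext => w; rewrite (deriveMv _ (dc w) (dh w)).
have f1 : differentiable (fun w => cutoff rho w * 'D_(delta_mx ord0 i) (fun y => heat t (y - x)) w) y.
  by apply: differentiableM; [exact: dc|exact: dh1].
have f2 : differentiable (fun w => heat t (w - x) * 'D_(delta_mx ord0 i) (@cutoff R n rho) w) y.
  by apply: differentiableM; [exact: dh|exact: dc1].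
rewrite (deriveDv _ f1 f2) (deriveMv _ (dc y) (dh1 y)) (deriveMv _ (dh y) (dc1 y)).
rewrite /partial /=; move: (cutoff _ _) (heat _ _) => a b.
move: ('D__ _ y) => c; move: ('D__ _ y) => e; move: ('D__ _ y) => f; move: ('D__ _ y) => g.
by ring.
Qed.

(** Origin of the squared radius 4 rho + 4: |y - 2x|^2 >= 0 gives |y - x|^2 >= |y|^2 / 2 - |x|^2 >=
    rho + 2. *)
Lemma far_enorm rho x y : 0 <= rho -> dotp x x <= rho -> 4 * rho + 4 <= dotp y y -> 1 <= enorm (y - x).
Proof.
move=> r0 xr yr; rewrite -(@ler_pXn2r _ 2)// ?nnegrE ?enorm_ge0// expr1n sqr_enorm.
have h := dotp_ge0 (y - x - x); move: h.
rewrite !(dotpDl, dotpDr, dotpNl, dotpNr) (dotpC x y); lra.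
Qed.

(* The derivatives of the cutoff live on an annulus away from x, where the heat
   kernel and its gradient are bounded uniformly in t. *)
Definition remainder rho t x y := \sum_i
  (2 * 'D_(delta_mx ord0 i) (@cutoff R n rho) y * 'D_(delta_mx ord0 i) (fun y => heat t (y - x)) y +
   heat t (y - x) * 'D_(delta_mx ord0 i) (fun w => 'D_(delta_mx ord0 i) (@cutoff R n rho) w) y).

Lemma sum_partial_cutoff_heat rho t x y : 0 < t ->
  \sum_i partial [:: i; i] (fun y => cutoff rho y * heat t (y - x)) y =
  2 * (cutoff rho y * dheat t (y - x)) + remainder rho t x y.
Proof.
move=> t0; under eq_bigr do rewrite partial_cutoff_heat//.
by rewrite big_split/= -mulr_sumr laplacian_heat// /remainder; ring.
Qed.

(** The gradient of the heat kernel carries a factor 1/t; at distance at least 1 [heat_tail] gains a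
    factor t, and [heat_enorm_bounded] controls what is left at time 2t. *)
Lemma heat_far : (0 < n)%N -> exists C, 0 <= C /\ forall t z i, 0 < t -> 1 <= enorm z ->
  heat t z <= C /\ `|z ord0 i / t * heat t z| <= C.
Proof.
move=> n0; have [C [C0 hC]] := heat_enorm_bounded R n.
pose D := Num.sqrt 2 ^+ n * (4 / 1 ^+ 2) : R.
have D0 : 0 <= D by rewrite mulr_ge0 ?exprn_ge0 ?sqrtr_ge0// divr_ge0// exprn_ge0.
have D1 : 1 <= D.
  have : 1 <= Num.sqrt 2 :> R by rewrite -[leLHS]sqrtr1 ler_wsqrtr//; lra.
  by move=> /(@exprn_ege1 _ n); rewrite /D expr1n divr1; lra.
exists (D * C); split=> [|t z i t0 z1]; first exact: mulr_ge0.
have hz s : 0 < s -> heat s z * enorm z <= C.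
  move=> s0; apply: le_trans (hC s z s0); apply: ler_wpM2l; first exact: heat_ge0.
  by rewrite -[leLHS]expr1 ler_weXn2l.
split.
  apply: le_trans (_ : C <= _); last by rewrite ler_peMl.
  by apply: le_trans (hz _ t0); rewrite ler_peMr// heat_ge0.
rewrite normrM normf_div (ger0_norm (heat_ge0 t0 z)) (gtr0_norm t0) mulrAC.
have t2 : 0 < 2 * t by rewrite mulr_gt0.
rewrite ler_pdivrMr//.
apply: le_trans (_ : enorm z * heat t z <= _).
  by apply: ler_wpM2r; [exact: heat_ge0|exact: normr_coord_le].
apply: le_trans (_ : enorm z * (D * t * heat (2 * t) z) <= _).
  by apply: ler_wpM2l; [exact: enorm_ge0|exact: (heat_tail t0 ltr01 z1)].
have -> : enorm z * (D * t * heat (2 * t) z) = D * t * (heat (2 * t) z * enorm z) by ring.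
have -> : D * C * t = D * t * C by ring.
apply: ler_wpM2l; last exact: hz.
by rewrite mulr_ge0// ltW.
Qed.

Lemma remainder_bounded rho : (0 < n)%N -> 0 <= rho -> exists C, 0 <= C /\ forall t x y, 0 < t ->
  dotp x x <= rho ->
  `|remainder (4 * rho + 4) t x y| <= C * \1_[set w : E | dotp w w <= 4 * rho + 4 + 1] y.
Proof.
move=> n0 r0; set r2 := 4 * rho + 4; have [C [C0 hC]] := heat_far n0.
have [B hB] : exists B, forall i y, dotp y y <= r2 + 1 ->
   `|'D_(delta_mx ord0 i) (@cutoff R n r2) y| <= B /\
   `|'D_(delta_mx ord0 i) (fun w => 'D_(delta_mx ord0 i) (@cutoff R n r2) w) y| <= B.
  have g0 (f : E -> R) : elem f -> exists B, 0 <= B /\ forall y, dotp y y <= r2 + 1 -> `|f y| <= B.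
    move=> ef; have [K [k [K0 hK]]] := elem_growth ef.
    exists (K * (1 + Num.sqrt (r2 + 1)) ^+ k); split=> [|y yr].
      by rewrite mulr_ge0// exprn_ge0// addr_ge0// sqrtr_ge0.
    apply: le_trans (hK y) _; apply: ler_wpM2l => //.
    apply: lerXn2r; rewrite ?nnegrE ?addr_ge0 ?enorm_ge0 ?sqrtr_ge0//.
    by rewrite lerD2l; apply: ler_wsqrtr.
  have ec := @elem_cutoff R n r2.
  have h1 i := g0 _ (elem_partial [:: i] ec).
  have h2 i := g0 _ (elem_partial [:: i; i] ec).
  have [B1 hB1] := choice h1; have [B2 hB2] := choice h2.
  exists (\sum_i (B1 i + B2 i)) => i y yr.
  have s0 j : 0 <= B1 j + B2 j by rewrite addr_ge0//; [have [] := hB1 j|have [] := hB2 j].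
  have li : B1 i + B2 i <= \sum_i (B1 i + B2 i).
    by rewrite (bigD1 i)//= lerDl sumr_ge0.
  have [b1 /(_ y yr) c1] := hB1 i; have [b2 /(_ y yr) c2] := hB2 i.
  by split; [apply: le_trans c1 _|apply: le_trans c2 _]; lra.
have B0 : 0 <= B.
  have := hB (Ordinal n0) 0; rewrite (_ : dotp 0 0 = 0); last by apply/eqP; rewrite dotp_eq0.
  case=> [|h _]; first by rewrite /r2; lra.
  by apply: le_trans h.
(* Each of the n directions contributes 2 B C from the product of first derivatives and B C from the
   second derivative of the cutoff. *)
exists (n%:R * (3 * B * C)); split=> [|t x y t0 xr].
  by rewrite !mulr_ge0.
have [|nan] := pselect (r2 <= dotp y y <= r2 + 1); last first.
  rewrite /remainder big1 => [|i _].
    by rewrite normr0 !mulr_ge0// ?indicE.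
  by have [-> ->] := derive_cutoff0 i nan; rewrite !mulr0 mul0r addr0.
move=> /andP[y1 y2]; have far := far_enorm r0 xr y1.
rewrite indicE mem_set// mulr1 /remainder; apply: le_trans (ler_norm_sum _ _ _) _.
apply: le_trans (_ : \sum_(i < n) 3 * B * C <= _); last by rewrite sumr_const card_ord -[X in X <= _]mulr_natl.
apply: ler_sum => i _; have [h1 h2] := hC t (y - x) i t0 far.
have [b1 b2] := hB i y y2; apply: le_trans (ler_normD _ _) _.
rewrite derive_heat//; move: h1 h2 (heat_ge0 t0 (y - x)); rewrite !mxE.
move: (heat _ _) => h h1 h2 h0.
have -> : 3 * B * C = 2 * B * C + C * B by ring.
rewrite mulNr mulrN normrN normrM [X in _ + X]normrM [`|2 * _|]normrM normr_nat (ger0_norm h0).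
apply: lerD; last exact: ler_pM.
by apply: ler_pM => //; rewrite ?mulr_ge0// ler_wpM2l.
Qed.

End cutoff_heat.

(** The function f may take negative values: its positive part is already below g. *)
Lemma integral_le_ge0 d (T : measurableType d) (R : realType) (m : {measure set T -> \bar R}) (f g : T -> \bar R) :
  measurable_fun setT f -> measurable_fun setT g -> (forall x, 0 <= g x)%E ->
  (forall x, f x <= g x)%E -> (\int[m]_x f x <= \int[m]_x g x)%E.
Proof.
move=> mf mg g0 fg; rewrite integralE; apply: (@le_trans _ _ (\int[m]_x f^\+%E x)%E).
  by rewrite -[leRHS]sube0 leeB// integral_ge0.
apply: ge0_le_integral => //; first exact: measurable_funepos.
by move=> x _; rewrite funeposE ge_max fg g0.
Qed.

(** * The potential energy of the regularized measure and its time derivative *)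

Section potential_average.
Variables (R : realType) (n : nat).
Local Notation E := 'rV[R]_n.
Local Notation leb := (lebesgue_rV R n).
Variables (mu : probability E R) (S : set E) (v : E -> R).
Hypotheses (mS : measurable S) (mv : measurable_fun setT v) (v0 : forall y, 0 <= v y).
Hypothesis iv : leb.-integrable setT (EFin \o v).
Implicit Types (x y z : E) (t : R).

(** A single integral over a product space, so that it can be differentiated under the integral
    sign. The indicator of S, later a disk carrying mu, gives access to bounds that hold for x in S
    only. *)
Definition average t : R :=
  \int[(mu \x leb)%E]_p (\1_S p.1 * v p.2 * heat t (p.2 - p.1)).

Definition daverage t : R :=
  \int[(mu \x leb)%E]_p (\1_S p.1 * v p.2 * dheat t (p.2 - p.1)).

Let mdiff : measurable_fun setT (fun p : E * E => p.2 - p.1).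
Proof. by apply: measurable_rVB; [exact: measurable_snd|exact: measurable_fst]. Qed.

Let m1S : measurable_fun setT (fun p : E * E => \1_S p.1 * v p.2).
Proof.
apply: measurable_funM; first by apply: measurableT_comp measurable_fst; exact: measurable_indic.
exact: measurableT_comp mv measurable_snd.
Qed.

Let mheat t : measurable_fun setT (fun p : E * E => \1_S p.1 * v p.2 * heat t (p.2 - p.1)).
Proof. by apply: measurable_funM => //; exact: measurable_heat. Qed.

Let mdheat t : measurable_fun setT (fun p : E * E => \1_S p.1 * v p.2 * dheat t (p.2 - p.1)).
Proof. by apply: measurable_funM => //; exact: measurable_dheat. Qed.

Lemma integrable_snd k : (mu \x leb)%E.-integrable setT (EFin \o (fun p => k * v p.2)).
Proof.
have mf : measurable_fun setT (EFin \o (fun p : E * E => k * v p.2)).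
  apply/measurable_EFinP; apply: measurable_funM; first exact: measurable_cst.
  exact: measurableT_comp mv measurable_snd.
apply/(integrable12ltyP mu leb mf).
under eq_integral => x _.
  rewrite (_ : (\int[leb]_y _)%E = (`|k|)%:E * \int[leb]_y (v y)%:E)%E; last first.
    rewrite -ge0_integralZr_real//; apply: eq_integral => y _.
    by rewrite /= normrM (ger0_norm (v0 y)).
  over.
rewrite [X in (X < _)%E](integral_cst mu measurableT) [X in (_ * X)%E]probability_setT mule1.
have [_] := integrableP _ _ _ iv; under eq_integral do rewrite gee0_abs ?lee_fin//.
have i0 : (0 <= \int[leb]_y (v y)%:E)%E by apply: integral_ge0 => y _; rewrite lee_fin.
by move=> h; rewrite lte_mul_pinfty// lee_fin.
Qed.

Let indic01 (x : E) : ((0 : R) <= \1_S x) && (\1_S x <= (1 : R)).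
Proof. by rewrite indicE; case: (_ \in _); rewrite ?lexx ?ler01. Qed.

Let bound (c : R) (k : E -> R) p : (forall z, `|k z| <= c) ->
  `|\1_S p.1 * v p.2 * k (p.2 - p.1)| <= c * v p.2.
Proof.
move=> kc; have /andP[i0 i1] := indic01 p.1.
rewrite normrM normrM (ger0_norm i0) (ger0_norm (v0 _)) mulrC.
by apply: ler_pM => //; [exact: mulr_ge0|exact: ler_piMl].
Qed.

Lemma integrable_average t : 0 < t ->
  (mu \x leb)%E.-integrable setT (EFin \o (fun p => \1_S p.1 * v p.2 * heat t (p.2 - p.1))).
Proof.
move=> t0; apply: (integrable_dominated (mheat t) (integrable_snd ((Num.sqrt (2 * pi * t))^-1 ^+ n))) => p.
by apply: bound => z; rewrite ger0_norm ?heat_ge0// heat_le.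
Qed.

Lemma integrable_daverage t : 0 < t ->
  (mu \x leb)%E.-integrable setT (EFin \o (fun p => \1_S p.1 * v p.2 * dheat t (p.2 - p.1))).
Proof.
move=> t0; have t2 : 0 < t / 2 by rewrite divr_gt0.
apply: (integrable_dominated (mdheat t) (integrable_snd ((1 + n%:R) / (t / 2) * (Num.sqrt (2 * pi * (t / 2)))^-1 ^+ n))) => p.
by apply: bound => z; apply: dheat_le => //; lra.
Qed.

Lemma is_derive_average t : 0 < t -> is_derive t 1 average (daverage t).
Proof.
move=> t0; have t2 : 0 < t / 2 by rewrite divr_gt0.
apply: (is_derive_under_integral (u := t / 2) (v := 2 * t)
  (G := fun p => (1 + n%:R) / (t / 2) * (Num.sqrt (2 * pi * (t / 2)))^-1 ^+ n * v p.2)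
  (f := fun r p => \1_S p.1 * v p.2 * heat r (p.2 - p.1))
  (df := fun r p => \1_S p.1 * v p.2 * dheat r (p.2 - p.1))).
- lra.
- by move=> r rt; apply: integrable_average; lra.
- move=> r p rt; have r0 : 0 < r by lra.
  have := is_deriveM (is_derive_cst (\1_S p.1 * v p.2) r 1) (is_derive_heat (p.2 - p.1) r0).
  by move=> h; apply: (is_derive_eq h); rewrite /GRing.scale/= mulr0 addr0.
- exact: integrable_snd.
- by move=> r p rt; apply: bound => z; apply: dheat_le => //; lra.
Qed.

Lemma EFin_average t : 0 < t -> (average t)%:E =
  (\int[mu]_x ((\1_S x)%:E * \int[leb]_y (v y * heat t (y - x))%:E))%E.
Proof.
move=> t0; rewrite /average -EFin_Rintegral; last exact: integrable_average.
rewrite fubini_tonelli1.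
- apply: eq_integral => x _; have /andP[i0 i1] := indic01 x.
  rewrite /fubini_F -ge0_integralZr_real//.
  + by apply: eq_integral => y _; rewrite /= mulrA.
  + apply: measurable_funM => //; apply: measurable_heat.
    by apply: measurable_rVB => //; exact: measurable_cst.
  + by move=> y; rewrite mulr_ge0// heat_ge0.
- by apply/measurable_EFinP.
- move=> p; have /andP[i0 i1] := indic01 p.1.
  by rewrite lee_fin !mulr_ge0// heat_ge0.
Qed.

(** The pointwise bound is integrated against mu, and Tonelli turns the term with h into an integral
    against the regularized density, where Young's inequality can be applied. *)
Lemma daverage_le t (b : R) (h : E -> R) : 0 < t -> 0 <= b -> measurable_fun setT h ->
  (forall y, 0 <= h y) ->
  (forall x, S x -> (\int[leb]_y (v y * dheat t (y - x)))%:E <=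
     b%:E + \int[leb]_y (h y * heat t (y - x))%:E)%E ->
  ((daverage t)%:E <= b%:E + \int[leb]_y ((h y)%:E * smear mu t y))%E.
Proof.
move=> t0 b0 mh h0 hS; rewrite /daverage -EFin_Rintegral; last exact: integrable_daverage.
have mhE : measurable_fun setT (fun y => (h y)%:E) by apply/measurable_EFinP.
rewrite -(integral12_prod_meas1 (integrable_daverage t0)) integral_smear_mul//.
have mI : measurable_fun setT (fun x => \int[leb]_y (h y * heat t (y - x))%:E)%E.
  pose F (p : E * E) : \bar R := (h p.2 * heat t (p.2 - p.1))%:E.
  have mF : measurable_fun setT F.
    apply/measurable_EFinP; apply: measurable_funM; last exact: measurable_heat.
    exact: measurableT_comp mh measurable_snd.
  have F0 p : (0 <= F p)%E by rewrite lee_fin mulr_ge0// heat_ge0.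
  exact: (measurable_fun_fubini_tonelli_F F mF F0).
have I0 x : (0 <= \int[leb]_y (h y * heat t (y - x))%:E)%E.
  by apply: integral_ge0 => y _; rewrite lee_fin mulr_ge0// heat_ge0.
have -> : (b%:E + \int[mu]_y \int[leb]_x ((h x)%:E * (heat t (x - y)%R)%:E) =
   \int[mu]_x (b%:E + \int[leb]_y (h y * heat t (y - x))%:E))%E.
  have b0' (x : E) : setT x -> (0 <= (cst b%:E : E -> \bar R) x)%E by rewrite lee_fin.
  rewrite (ge0_integralD mu measurableT b0' (measurable_cst _) (fun x _ => I0 x) mI).
  by rewrite integral_cst_probability.
apply: integral_le_ge0.
- exact: measurable_int (integrable_fubini_F (integrable_daverage t0)).
- by apply: emeasurable_funD => //; exact: measurable_cst.
- by move=> x; rewrite adde_ge0// lee_fin.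
move=> x; rewrite /fubini_F /=.
have [xS|xS] := pselect (S x).
  rewrite indicE (mem_set xS); under eq_integral do rewrite mul1r.
  rewrite EFin_Rintegral; first exact: hS.
  have mk : measurable_fun setT (fun y => v y * dheat t (y - x)).
    apply: measurable_funM => //; apply: measurable_dheat.
    by apply: measurable_rVB => //; exact: measurable_cst.
  have t2 : 0 < t / 2 by rewrite divr_gt0.
  apply: (integrable_dominated mk (integrable_mulrl ((1 + n%:R) / (t / 2) * (Num.sqrt (2 * pi * (t / 2)))^-1 ^+ n) iv)) => y.
  rewrite normrM (ger0_norm (v0 y)) mulrC ler_wpM2r//.
  by apply: dheat_le => //; lra.
rewrite indicE (memNset xS); under eq_integral do rewrite !mul0r.
by rewrite integral0 adde_ge0// lee_fin.
Qed.

End potential_average.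

Lemma Rintegral_sum d (T : measurableType d) (R : realType) (m : {measure set T -> \bar R})
    (I : Type) (s : seq I) (f : I -> T -> R) :
  (forall i, m.-integrable setT (EFin \o f i)) ->
  m.-integrable setT (EFin \o (fun x => \sum_(i <- s) f i x)) /\
  \sum_(i <- s) \int[m]_x f i x = \int[m]_x \sum_(i <- s) f i x.
Proof.
move=> fi; elim: s => [|i s [IH1 IH2]].
  split.
    apply: (eq_integrable measurableT (cst 0%E)); last exact: integrable0.
    by move=> x _; rewrite /= big_nil.
  rewrite big_nil /Rintegral integral0_eq// => x _; by rewrite big_nil.
have e : (fun x => \sum_(j <- i :: s) f j x) = (fun x => f i x + \sum_(j <- s) f j x).
  by apply/funext => x; rewrite big_cons.
rewrite e big_cons IH2; split; first exact: integrable_addr.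
by rewrite RintegralD.
Qed.

(** * The weak Laplacian of the potential *)

Section weak_laplacian.
Variables (R : realType) (n : nat).
Local Notation E := 'rV[R]_n.
Local Notation leb := (lebesgue_rV R n).
Implicit Types (x y z : E) (t r : R) (f g : E -> R).

Lemma continuous_measurable_rV (f : E -> R) : continuous f -> measurable_fun setT f.
Proof.
move=> cf; apply: (measurability _ (RGenOpens.measurableE R)) => _ [_ [a [b ->] <-]].
rewrite setTI; apply: open_measurable_rV.
by move/continuousP: cf; apply; exact: interval_open.
Qed.

Lemma closed_measurable_rV (K : set E) : closed K -> measurable K.
Proof.
by move=> cK; rewrite -[K]setCK; apply: measurableC; apply: open_measurable_rV; exact: closed_openC.
Qed.

(** The parameter is a squared radius, as for [cutoff]. *)
Definition disk r : set E := [set w | dotp w w <= r].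

Lemma measurable_disk r : measurable (disk r).
Proof.
have md := @measurable_dotp R _ _ n (fun w : E => w) (fun w => w) (@measurable_id _ _ setT) (@measurable_id _ _ setT).
have := md measurableT _ (measurable_itv `]-oo, r]); rewrite setTI.
by congr (measurable _); apply/seteqP; split => w /=; rewrite in_itv.
Qed.

Lemma lebesgue_disk r : (leb (disk r) < +oo)%E.
Proof.
have s0 : 0 <= Num.sqrt r + 1 by rewrite addr_ge0 ?sqrtr_ge0.
apply: (@le_lt_trans _ _ (leb (box (Num.sqrt r + 1)))); last by rewrite lebesgue_box// ltry.
apply: le_measure; rewrite ?inE; [exact: measurable_disk|exact: measurable_box|].
move=> w wr; apply: box_enorm; apply: (@le_lt_trans _ _ (Num.sqrt r)); last by rewrite ltrDl.
exact: ler_wsqrtr.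
Qed.

Lemma integrable_disk r k : leb.-integrable setT (EFin \o (fun y => k * \1_(disk r) y)).
Proof.
apply: integrable_mulrl; apply/integrableP; split.
  by apply/measurable_EFinP; exact: measurable_indic (measurable_disk r).
rewrite [X in (X < _)%E](_ : _ = (\int[leb]_x (\1_(disk r) x)%:E)%E).
  rewrite integral_indic ?setIT; [exact: lebesgue_disk|exact: measurableT|exact: measurable_disk].
by apply: eq_integral => x _; rewrite /= ger0_norm// indicE.
Qed.

Lemma integrable_sqr_disk g r k : L2loc g -> leb.-integrable setT (EFin \o (fun y => k * (g y ^+ 2 * \1_(disk r) y))).
Proof.
move=> [mg gK]; apply: integrable_mulrl; apply/integrableP; split.
  apply/measurable_EFinP; apply: measurable_funM; first exact: measurable_funX.
  exact: measurable_indic (measurable_disk r).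
apply: le_lt_trans (gK _ (@compact_dotp_le R n r)).
rewrite [leRHS]integral_mkcond; apply: ge0_le_integral => //.
- apply: measurableT_comp => //; apply/measurable_EFinP; apply: measurable_funM; first exact: measurable_funX.
  exact: measurable_indic (measurable_disk r).
- apply/(measurable_restrictT _ (measurable_disk r)); apply/measurable_EFinP.
  by apply: measurable_funTS; exact: measurable_funX.
- move=> y _; rewrite /= patchE indicE ger0_norm; last by rewrite mulr_ge0// sqr_ge0.
  by case: (_ \in _); rewrite ?mulr1 ?mulr0.
Qed.

(** The inequality |g| <= 1 + g^2 on a disk of finite measure replaces the Cauchy-Schwarz
    inequality. *)
Lemma integrable_L2loc g f (c r : R) : L2loc g -> measurable_fun setT f ->
  (forall y, `|f y| <= c * \1_(disk r) y) -> leb.-integrable setT (EFin \o (fun y => g y * f y)).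
Proof.
move=> Lg mf fc; have [mg _] := Lg.
apply: (integrable_dominated (measurable_funM mg mf)
  (integrable_addr (integrable_disk r c) (integrable_sqr_disk r c Lg))) => y.
have -> : c * \1_(disk r) y + c * (g y ^+ 2 * \1_(disk r) y) = (1 + g y ^+ 2) * (c * \1_(disk r) y) by ring.
rewrite normrM; apply: ler_pM => //.
rewrite -real_normK ?num_real//; have := sqr_ge0 (`|g y| - 1); have := normr_ge0 (g y); nra.
Qed.

Lemma L2loc_sum (I : Type) (s : seq I) (g : I -> E -> R) : (forall i, L2loc (g i)) ->
  L2loc (fun x => \sum_(i <- s) g i x).
Proof.
move=> Lg; elim: s => [|i s [m1 h1]].
  rewrite (_ : (fun _ => _) = cst 0); last by apply/funext => x; rewrite big_nil.
  split; first exact: measurable_cst.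
  by move=> K cK; rewrite integral0_eq// => x _; rewrite expr0n.
have [m2 h2] := Lg i.
rewrite (_ : (fun _ => _) = (fun x => g i x + \sum_(j <- s) g j x)); last first.
  by apply/funext => x; rewrite big_cons.
split; first exact: measurable_funD.
move=> K cK.
have mK : measurable K.
  by apply: closed_measurable_rV; apply: compact_closed => //; exact: norm_hausdorff.
apply: (@le_lt_trans _ _ (\int[leb]_(x in K) (2%:E * (g i x ^+ 2)%:E + 2%:E * ((\sum_(j <- s) g j x) ^+ 2)%:E))%E).
  apply: ge0_le_integral => //.
  - by move=> x _; rewrite lee_fin sqr_ge0.
  - by apply/measurable_EFinP; apply: measurable_funTS; apply: measurable_funX; exact: measurable_funD.
  - apply/measurable_EFinP; apply: measurable_funTS; apply: measurable_funD; apply: measurable_funM;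
      try exact: measurable_cst; exact: measurable_funX.
  - move=> x _; rewrite -!EFinM -EFinD lee_fin; set a := g i x; set b := \sum_(_ <- _) _.
    by have := sqr_ge0 (a - b); nra.
have mm f : measurable_fun setT f -> measurable_fun K (fun x : E => (f x ^+ 2)%:E : \bar R).
  by move=> mf; apply/measurable_EFinP; apply: measurable_funTS; exact: measurable_funX.
rewrite ge0_integralD//; last 4 first.
- by move=> x _; rewrite mule_ge0// lee_fin sqr_ge0.
- by apply: measurable_funeM; exact: mm.
- by move=> x _; rewrite mule_ge0// lee_fin sqr_ge0.
- by apply: measurable_funeM; exact: mm.
rewrite !ge0_integralZl//; try (by move=> x _; rewrite lee_fin sqr_ge0); try exact: mm.
by rewrite lte_add_pinfty// lte_mul_pinfty// ?h1 ?h2// lee_fin.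
Qed.

Lemma elem_supported f r : elem f -> (forall y, r < dotp y y -> f y = 0) ->
  exists c, 0 <= c /\ forall y, `|f y| <= c * \1_(disk r) y.
Proof.
move=> ef f0; have [K [k [K0 hK]]] := elem_growth ef.
have c0 : 0 <= K * (1 + Num.sqrt r) ^+ k by rewrite mulr_ge0// exprn_ge0// addr_ge0// sqrtr_ge0.
exists (K * (1 + Num.sqrt r) ^+ k); split=> // y.
have [yr|yr] := leP (dotp y y) r; last by rewrite f0// normr0 mulr_ge0// indicE.
rewrite indicE mem_set// mulr1; apply: le_trans (hK y) _; apply: ler_wpM2l => //.
apply: lerXn2r; rewrite ?nnegrE ?addr_ge0 ?enorm_ge0 ?sqrtr_ge0//.
by rewrite lerD2l; apply: ler_wsqrtr.
Qed.

Lemma partial_supported f r s : (forall y, r < dotp y y -> f y = 0) ->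
  forall y, r < dotp y y -> partial s f y = 0.
Proof.
move=> f0; elim: s => [|i s IH] y yr /=; first exact: f0.
have oU : open [set w : E | r < dotp w w] by exact: (open_dotp (P := [set u | r < u])).
by apply: (derive_locally_cst _ oU yr) => w; exact: IH.
Qed.

Lemma measurable_elem (f : E -> R) : elem f -> measurable_fun setT f.
Proof.
move=> ef; have [df _] := elem_differentiable ef; apply: continuous_measurable_rV => x.
exact: differentiable_continuous.
Qed.

(** G is the sum of the pure second weak derivatives. Integrability is part of the conclusion
    because the integral is later split into a main term and a remainder. *)
Lemma is_weak_laplacian (V : E -> R) : Hloc 2 V -> exists2 G, L2loc G &
  forall (phi : E -> R) r, elem phi -> test_function phi -> (forall y, r < dotp y y -> phi y = 0) ->
  leb.-integrable setT (EFin \o (fun y => V y * \sum_i partial [:: i; i] phi y)) /\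
  \int[leb]_y (V y * \sum_i partial [:: i; i] phi y) = \int[leb]_y (G y * phi y).
Proof.
move=> [LV hV].
have /choice[g hg] : forall i : 'I_n, exists g, L2loc g /\ weak_partial [:: i; i] V g.
  by move=> i; have [|g Lg wg] := hV [:: i; i]; [|exists g].
exists (fun y => \sum_i g i y); first by apply: L2loc_sum => i; have [] := hg i.
move=> phi r ephi tphi sphi.
have iV i : leb.-integrable setT (EFin \o (fun y => V y * partial [:: i; i] phi y)).
  have ep := elem_partial [:: i; i] ephi.
  have [c [_ hc]] := elem_supported ep (partial_supported [:: i; i] sphi).
  exact: (integrable_L2loc LV (measurable_elem ep) hc).
have ig i : leb.-integrable setT (EFin \o (fun y => g i y * phi y)).
  have [c [_ hc]] := elem_supported ephi sphi.
  by have [Lg _] := hg i; exact: (integrable_L2loc Lg (measurable_elem ephi) hc).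
have [s1 e1] := Rintegral_sum (index_enum _) iV.
have [_ e2] := Rintegral_sum (index_enum _) ig.
have eV : (fun y => V y * \sum_i partial [:: i; i] phi y) = (fun y => \sum_i V y * partial [:: i; i] phi y).
  by apply/funext => y; rewrite mulr_sumr.
have eG : (fun y => (\sum_i g i y) * phi y) = (fun y => \sum_i g i y * phi y).
  by apply/funext => y; rewrite mulr_suml.
rewrite eV eG -e1 -e2; split=> //; apply: eq_bigr => i _.
by have [_ ->] := hg i; rewrite //= expr2 mulN1r opprK mul1r.
Qed.

Lemma integrable_cutoff (V : E -> R) r : L2loc V ->
  leb.-integrable setT (EFin \o (fun y => V y * cutoff r y)).
Proof.
move=> LV; have ec := @elem_cutoff R n r.
have sc y : r + 1 < dotp y y -> cutoff r y = 0 by move=> h; rewrite cutoff0// ltW.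
have [c [_ hc]] := elem_supported ec sc.
exact: (integrable_L2loc LV (measurable_elem ec) hc).
Qed.

(** The Laplacian of the cutoff times the heat kernel is 2 cutoff dheat plus a remainder. Hence V
    cutoff dheat integrates to half the integral of G against the test function, up to a bounded
    term, and Young's inequality separates G from the regularized density with any weight lam. *)
Lemma daverage_cutoff_le (mu : probability E R) (V : E -> R) (rho lam : R) :
  (0 < n)%N -> 0 <= rho -> Hloc 2 V -> (forall y, 0 <= V y) -> 0 < lam ->
  exists C, forall t, 0 < t ->
    daverage mu (disk rho) (fun y => V y * cutoff (4 * rho + 4) y) t <=
    lam * fine (heat_mass mu (2 * t)) + C.
Proof.
move=> n0 r0 HV V0 l0; set r2 := 4 * rho + 4; set v := fun y => _.
have LV : L2loc V by case: HV.
have mV : measurable_fun setT V by case: LV.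
have [G LG wG] := is_weak_laplacian HV.
have mG : measurable_fun setT G by case: LG.
have [Cr [Cr0 hCr]] := remainder_bounded n0 r0.
have ec := @elem_cutoff R n r2.
have mc := measurable_elem ec.
have c0 y : 0 <= cutoff r2 y by exact: plateau_ge0.
have sc (y : E) : r2 + 1 < dotp y y -> cutoff r2 y = 0 by move=> h; rewrite cutoff0// ltW.
have [cc [cc0 hcc]] := elem_supported ec sc.
have iv := integrable_cutoff r2 LV; have mv : measurable_fun setT v by exact: measurable_funM.
have v0 y : 0 <= v y by rewrite mulr_ge0.
have iVK : leb.-integrable setT (EFin \o (fun y => `|V y| * (Cr * \1_(disk (r2 + 1)) y))).
  have mi : measurable_fun setT (fun y : E => Cr * \1_(disk (r2 + 1)) y).
    by apply: measurable_funM; [exact: measurable_cst|exact: measurable_indic (measurable_disk _)].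
  have LaV : L2loc (fun y => `|V y|).
    split; first exact: measurableT_comp.
    by move=> K cK; under eq_integral do rewrite real_normK ?num_real//; have [_ ->] := LV.
  apply: (integrable_L2loc (r := r2 + 1) (c := Cr) LaV mi) => y.
  by rewrite ger0_norm// mulr_ge0// indicE.
(* Half of the bound on the remainder term, uniform in t and in x in the disk. *)
pose b := (\int[leb]_y (`|V y| * (Cr * \1_(disk (r2 + 1)) y))) / 2.
have b0 : 0 <= b.
  by rewrite divr_ge0// Rintegral_ge0// => y _; rewrite !mulr_ge0// indicE.
pose h y := `|G y| * cutoff r2 y / 2.
have h0 y : 0 <= h y by rewrite divr_ge0// mulr_ge0.
have mh : measurable_fun setT h.
  by apply: measurable_funM; [apply: measurable_funM => //; exact: measurableT_comp|exact: measurable_cst].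
(* The time-independent term of Young's inequality for h times the regularized density; [cc] bounds
   the cutoff. *)
pose k y := (4 * lam)^-1 * cc ^+ 2 * (G y ^+ 2 * \1_(disk (r2 + 1)) y).
have ik : leb.-integrable setT (EFin \o k) by exact: integrable_sqr_disk.
have k0 y : 0 <= k y.
  have i0 : 0 <= (4 * lam)^-1 by rewrite invr_ge0 mulr_ge0// ltW.
  have j0 : 0 <= \1_(disk (r2 + 1)) y :> R by rewrite indicE.
  by apply: mulr_ge0; apply: mulr_ge0 => //; exact: sqr_ge0.
exists (b + \int[leb]_y k y) => t t0.
have ediff x : measurable_fun setT (fun y : E => y - x).
  by apply: measurable_rVB => //; exact: measurable_cst.
have key x : disk rho x -> ((\int[leb]_y (v y * dheat t (y - x)))%:E <=
     b%:E + \int[leb]_y (h y * heat t (y - x))%:E)%E.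
  move=> xr; have eh := elem_heat x t0.
  have ephi : elem (fun y => cutoff r2 y * heat t (y - x)) by exact: elemM.
  have tphi := test_function_cutoff r2 eh.
  have sphi y : r2 + 1 < dotp y y -> cutoff r2 y * heat t (y - x) = 0.
    by move=> yr; rewrite sc// mul0r.
  have [iL eL] := wG _ _ ephi tphi sphi.
  have [cp [_ hcp]] := elem_supported ephi sphi.
  have iG := integrable_L2loc LG (measurable_elem ephi) hcp.
  have iD : leb.-integrable setT (EFin \o (fun y => v y * dheat t (y - x))).
    have t2 : 0 < t / 2 by rewrite divr_gt0.
    have mk : measurable_fun setT (fun y => v y * dheat t (y - x)).
      by apply: measurable_funM => //; exact: measurable_dheat.
    apply: (integrable_dominated mk (integrable_mulrl ((1 + n%:R) / (t / 2) * (Num.sqrt (2 * pi * (t / 2)))^-1 ^+ n) iv)) => y.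
    rewrite normrM (ger0_norm (v0 y)) mulrC ler_wpM2r//.
    by apply: dheat_le => //; lra.
  have iD2 := integrable_mulrl 2 iD.
  have iDN := integrable_mulrl (-1) iD2.
  have eR : (fun y => V y * \sum_i partial [:: i; i] (fun y => cutoff r2 y * heat t (y - x)) y) =
     (fun y => 2 * (v y * dheat t (y - x)) + V y * remainder r2 t x y).
    by apply/funext => y; rewrite sum_partial_cutoff_heat// /v; ring.
  have iR : leb.-integrable setT (EFin \o (fun y => V y * remainder r2 t x y)).
    rewrite eR in iL.
    have := integrable_addr iL iDN; congr (_.-integrable setT (EFin \o _)).
    by apply/funext => y; ring.
  have lR : `|\int[leb]_y (V y * remainder r2 t x y)| <= 2 * b.
    rewrite /b mulrC divfK//; apply: le_trans (le_normr_Rintegral _ iR) _ => //.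
    apply: le_Rintegral => //; first exact: (integrable_norm iR).
    by move=> y _; rewrite normrM ler_wpM2l//; exact: hCr.
  have iH : leb.-integrable setT (EFin \o (fun y => h y * heat t (y - x))).
    have := integrable_mulrl 2^-1 (integrable_norm iG); congr (_.-integrable setT (EFin \o _)).
    apply/funext => y; rewrite /h /= normrM (ger0_norm (mulr_ge0 (c0 y) (heat_ge0 t0 (y - x)))).
    by ring.
  have lG : \int[leb]_y (G y * (cutoff r2 y * heat t (y - x))) <= 2 * \int[leb]_y (h y * heat t (y - x)).
    rewrite -RintegralZl//; apply: le_Rintegral => //; first exact: integrable_mulrl.
    move=> y _; have := heat_ge0 t0 (y - x); have := ler_norm (G y); rewrite /h.
    move: (c0 y); move: (cutoff _ _) (heat _ _) (G y) => a c e a0 ee c1.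
    have -> : 2 * (`|e| * a / 2 * c) = `|e| * (a * c) by field.
    by rewrite ler_wpM2r// mulr_ge0.
  move: eL; rewrite eR RintegralD// RintegralZl// => eL.
  rewrite EFin_Rintegral// -EFinD lee_fin; move: lR lG; rewrite -eL ler_norml.
  by move=> /andP[+ _]; lra.
have := daverage_le mu (measurable_disk rho) mv v0 iv t0 b0 mh h0 key.
have sE y : smear mu t y = (fine (smear mu t y))%:E by rewrite fineK// smear_fin.
have Hm := fine_heat_mass mu t0.
have msm := measurable_smear mu t0.
have le2 : (\int[leb]_y ((h y)%:E * smear mu t y) <=
   lam%:E * heat_mass mu (2 * t) + \int[leb]_y (k y)%:E)%E.
  rewrite -integral_smear_sqr//.
  have msq : measurable_fun setT (fun y => smear mu t y * smear mu t y)%E by exact: emeasurable_funM.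
  have sq0 y : (0 <= smear mu t y * smear mu t y)%E by rewrite mule_ge0// smear_ge0.
  have mkE : measurable_fun setT (fun y => (k y)%:E) by exact: measurable_int ik.
  rewrite -ge0_integralZl//; last exact: ltW.
  have mls := measurable_funeM lam%:E msq.
  have ls0 y : (0 <= lam%:E * (smear mu t y * smear mu t y))%E by rewrite mule_ge0// lee_fin ltW.
  have kE0 y : (0 <= (k y)%:E)%E by rewrite lee_fin.
  rewrite -(integralDe leb mls mkE ls0 kE0).
  apply: ge0_le_integral => //.
  - by move=> y _; rewrite mule_ge0 ?lee_fin// smear_ge0.
  - by apply: emeasurable_funM => //; apply/measurable_EFinP.
  - exact: emeasurable_funD.
  - move=> y _; rewrite sE -!EFinM -EFinD lee_fin /h /k.
    have := fine_ge0 (smear_ge0 mu y t0); move: (fine _) => s s0.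
    have := hcc y; rewrite ger0_norm//; have := c0 y; rewrite -(real_normK (num_real (G y))).
    have : 0 <= `|G y| by []; move: (`|G y|) (cutoff _ _) => e a e0 a0 ac.
    have [i0 i1] : \1_(disk (r2 + 1)) y ^+ 2 = \1_(disk (r2 + 1)) y :> R /\ 0 <= \1_(disk (r2 + 1)) y :> R.
      by rewrite indicE; case: (_ \in _); rewrite ?expr1n ?expr0n.
    move: (\1_(disk _) y) i0 i1 ac => I i0 i1 ac.
    apply: (@le_trans _ _ (lam * (s * s) + (4 * lam)^-1 * (e * a) ^+ 2)).
      have q := sqr_ge0 (lam * s - (e * a) / 4).
      (* The excess is a square plus a nonnegative multiple of (e a)^2, since (4 lam)^-1 exceeds the
         optimal constant (16 lam)^-1. *)
      have -> : lam * (s * s) + (4 * lam)^-1 * (e * a) ^+ 2 =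
        (e * a / 2 * s) + ((2 * lam * s - (e * a) / 2) ^+ 2 / (4 * lam) + 3 / 16 * (e * a) ^+ 2 / lam).
        by field; rewrite gt_eqF.
      have l4 : 0 <= 4 * lam by rewrite mulr_ge0// ltW.
      have d1 := divr_ge0 (sqr_ge0 (2 * lam * s - (e * a) / 2)) l4.
      have d2 : 0 <= 3 / 16 * (e * a) ^+ 2 / lam.
        by rewrite divr_ge0 ?(ltW l0)// mulr_ge0 ?sqr_ge0// divr_ge0.
      by rewrite lerDl addr_ge0.
    rewrite lerD2l -mulrA ler_wpM2l ?invr_ge0 ?mulr_ge0 ?(ltW l0)//.
    rewrite -[in leRHS]i0 mulrCA -!exprMn; apply: lerXn2r; rewrite ?nnegrE ?mulr_ge0//.
    by rewrite ler_wpM2l.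
move: le2; rewrite Hm -EFinM EFin_Rintegral// -EFinD => le2 le1.
have := le_trans le1 (leeD2l b%:E le2); rewrite -EFinD lee_fin.
by move/le_trans; apply; rewrite addrCA.
Qed.

End weak_laplacian.

(** * The interaction kernel and the minimizer *)

Section homogeneous_functions.
Variables (R : realType) (n : nat).
Local Notation E := 'rV[R]_n.
Local Notation leb := (lebesgue_rV R n).
Implicit Types (x y z : E) (g : E -> R).

Lemma continuous_enorm : continuous (@enorm R n).
Proof.
move=> x; apply: (@continuous_comp _ _ _ (fun x => dotp x x) Num.sqrt).
  exact: continuous_dotp2.
exact: sqrt_continuous.
Qed.

Lemma closed_usphere : closed (@usphere R n).
Proof.
rewrite (_ : @usphere R n = @enorm R n @^-1` [set 1]) //.
by apply: closed_comp => [x _|]; [exact: continuous_enorm|exact: closed_eq].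
Qed.

Lemma compact_usphere : compact (@usphere R n).
Proof.
apply: (subclosed_compact closed_usphere (@compact_dotp_le R n 1)) => x /= h.
by rewrite -sqr_enorm h expr1n.
Qed.

Lemma usphere_dir x : x != 0 -> usphere ((enorm x)^-1 *: x).
Proof.
move=> x0; rewrite /usphere /= enormZ ger0_norm ?invr_ge0 ?enorm_ge0//.
by rewrite mulVf// gt_eqF// enorm_gt0.
Qed.

Lemma homogeneous0 g k : (0 < k)%N -> homogeneous g k 0 = 0.
Proof.
case: k => // k _; rewrite /homogeneous (_ : enorm 0 = 0) ?expr0n ?invr0 ?mulr0//.
by apply/eqP; rewrite enorm_eq0.
Qed.

(** For 0 < k all three members vanish at the origin, so the comparison holds there as well. *)
Lemma homogeneous_bounds g k a b : (0 < k)%N -> (forall w, usphere w -> a <= g w <= b) ->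
  forall x, a * riesz k x <= homogeneous g k x <= b * riesz k x.
Proof.
move=> k0 ab x; have [->|x0] := eqVneq x 0.
  rewrite homogeneous0// /riesz (_ : enorm 0 = 0); last by apply/eqP; rewrite enorm_eq0.
  by rewrite invr0 expr0n gtn_eqF// !mulr0 lexx.
have /andP[h1 h2] := ab _ (usphere_dir x0).
have r0 : 0 <= (enorm x ^+ k)^-1 by rewrite invr_ge0 exprn_ge0// enorm_ge0.
by rewrite /homogeneous /riesz exprVn !ler_wpM2r.
Qed.

(** Nothing is known of g off the sphere: the function is restricted to the complement of the
    origin, where x/|x| lies on the sphere, and it vanishes at the origin. *)
Lemma measurable_homogeneous g k : (0 < k)%N -> measurable_fun (@usphere R n) g ->
  measurable_fun setT (homogeneous g k).
Proof.
move=> k0 mg; have mD : measurable (~` [set 0 : E]).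
  by apply: measurableC; exact: (@measurable_rV_set1 R n).
have -> : homogeneous g k = homogeneous g k \_ (~` [set 0]).
  apply/funext => x; rewrite patchE; case: ifPn => //.
  by rewrite notin_setE /= => /contrapT ->; rewrite homogeneous0.
apply/(measurable_restrictT _ mD).
have me : measurable_fun setT (@enorm R n) by exact: continuous_measurable_rV continuous_enorm.
have mi := measurableT_comp (@measurable_invr R) me.
apply: measurable_funM.
  apply: (@measurable_comp _ _ _ _ _ _ (@usphere R n)) => //.
  - exact: closed_measurable_rV closed_usphere.
  - by move=> _ [x /= /eqP x0 <-]; exact: usphere_dir.
  - apply: measurable_funTS; apply: measurable_fun_rV => i.
    under eq_fun do rewrite mxE.
    by apply: measurable_funM; [exact: mi|exact: measurable_coord].
apply: measurable_funTS; apply: measurableT_comp; first exact: measurable_invr.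
exact: measurable_funX.
Qed.

Lemma continuous_within_measurable g : {within @usphere R n, continuous g} ->
  measurable_fun (@usphere R n) g.
Proof.
move=> cg; have mS := closed_measurable_rV closed_usphere.
apply: (measurability _ (RGenOpens.measurableE R)) => _ [_ [a [b ->] <-]].
have oI : open (`]a, b[%classic : set R) by exact: interval_open.
have /continuousP/(_ _ oI) := cg.
move/open_subspaceP => [V oV]; rewrite setIC [in RHS]setIC => <-.
by apply: measurableI => //; exact: open_measurable_rV.
Qed.

Lemma continuous_homogeneous g k z : {within @usphere R n, continuous g} -> z != 0 ->
  {for z, continuous (homogeneous g k)}.
Proof.
move=> cg z0; have ce := @continuous_enorm z.
have ez : enorm z != 0 by rewrite enorm_eq0.
have cu : (fun x : E => (enorm x)^-1 *: x) @ z --> (enorm z)^-1 *: z.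
  exact: (@cvgZ _ _ _ (nbhs z) _ (fun x => (enorm x)^-1) id _ _ (cvgV ez ce) cvg_id).
have cg' : g ((enorm x)^-1 *: x) @[x --> z] --> g ((enorm z)^-1 *: z); last first.
  have ek : enorm z ^+ k != 0 by rewrite expf_neq0.
  have ck : (fun x : E => enorm x ^+ k) @ z --> enorm z ^+ k.
    exact: (@continuous_comp _ _ _ (@enorm R n) (fun u => u ^+ k) z ce (@exprn_continuous _ _ _)).
  exact: (@cvgM _ _ (nbhs z) _ (fun x => g ((enorm x)^-1 *: x)) (fun x => (enorm x ^+ k)^-1) _ _ cg' (cvgV ek ck)).
(* Continuity of g is relative to the sphere; it composes with x/|x| because x stays nonzero near z,
   which keeps x/|x| on the sphere. *)
move=> N nN; move/subspace_continuousP: cg => /(_ _ (usphere_dir z0) N nN) /= h.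
have /= h2 := cu _ h.
have nz : nbhs z [set x : E | x != 0].
  have oU : open [set x : E | 0 < dotp x x] by exact: (open_dotp (P := [set u | 0 < u])).
  have Uz : nbhs z [set x : E | 0 < dotp x x].
    by apply: open_nbhs_nbhs; split=> //=; rewrite lt_def dotp_eq0 z0 dotp_ge0.
  by apply: filterS Uz => x /= /lt0r_neq0; rewrite dotp_eq0.
have h3 : nbhs z [set x | usphere ((enorm x)^-1 *: x) -> N (g ((enorm x)^-1 *: x))] := h2.
by apply: (@filterS2 _ (nbhs z) _ _ _ _ _ h3 nz) => x /= hx x0; apply: hx; exact: usphere_dir.
Qed.

Lemma positive_bounds g : (0 < n)%N -> {within @usphere R n, continuous g} ->
  (forall w, usphere w -> 0 < g w) ->
  exists a b, 0 < a /\ 0 < b /\ forall w, usphere w -> a <= g w <= b.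
Proof.
move=> n0 cg g0.
have ne : @usphere R n !=set0.
  exists ((enorm (const_mx 1 : E))^-1 *: const_mx 1); apply: usphere_dir.
  apply/eqP => /rowP/(_ (Ordinal n0)); rewrite !mxE => /eqP; exact/negP/oner_neq0.
have [c cS cmin] := compact_EVT_min ne compact_usphere cg.
have [d dS dmax] := compact_EVT_max ne compact_usphere cg.
rewrite inE in cS; rewrite inE in dS.
exists (g c), (g d); split; [exact: g0|split; first exact: g0].
by move=> w wS; rewrite cmin ?dmax// inE.
Qed.

Lemma le_hconv (K1 K2 : E -> R) (c t : R) z : 0 < t -> measurable_fun setT K1 -> measurable_fun setT K2 ->
  0 <= c -> (forall w, 0 <= K1 w) -> (forall w, 0 <= K2 w) -> (forall w, K1 w <= c * K2 w) ->
  (hconv (EFin \o K1) t z <= c%:E * hconv (EFin \o K2) t z)%E.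
Proof.
move=> t0 m1 m2 c0 p1 p2 le12.
have mh : measurable_fun setT (fun w : E => heat t (w - z)).
  by apply: measurable_heat; apply: measurable_rVB => //; exact: measurable_cst.
rewrite /hconv /=; under eq_integral do rewrite -EFinM.
under [X in (_ <= _ * X)%E]eq_integral do rewrite -EFinM.
rewrite -ge0_integralZr_real//.
- apply: ge0_le_integral_real => //.
  + exact: measurable_funM.
  + by apply: measurable_funM; [exact: measurable_cst|exact: measurable_funM].
  + by move=> w; rewrite mulr_ge0// heat_ge0.
  + by move=> w; rewrite (mulrA c) ler_wpM2r// heat_ge0.
- exact: measurable_funM.
- by move=> w; rewrite mulr_ge0// heat_ge0.
Qed.

(** From |w - z|^2 <= 2 |w|^2 + 2 |z|^2: doubling the time pays for moving the centre. *)
Lemma heat_recentre t z : 0 < t -> exists2 c : R, 0 <= c & forall w : E, heat t w <= c * heat (2 * t) (w - z).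
Proof.
move=> t0; exists (Num.sqrt 2 ^+ n * expR (dotp z z / (2 * t))).
  by rewrite mulr_ge0 ?expR_ge0// exprn_ge0// sqrtr_ge0.
move=> w; rewrite /heat.
have p0 : 0 <= 2 * pi * t by rewrite !mulr_ge0 ?pi_ge0// ltW.
have -> : Num.sqrt (2 * pi * (2 * t)) = Num.sqrt 2 * Num.sqrt (2 * pi * t).
  by rewrite -sqrtrM//; congr Num.sqrt; ring.
rewrite [(Num.sqrt 2 * _)^-1]invfM [(_ * _) ^+ n]exprMn [(Num.sqrt 2)^-1 ^+ n]exprVn.
have s2 : Num.sqrt 2 ^+ n != 0 :> R by rewrite expf_neq0// gt_eqF// sqrtr_gt0.
set a := (Num.sqrt (2 * pi * t))^-1 ^+ n.
have a0 : 0 <= a by rewrite exprn_ge0// invr_ge0 sqrtr_ge0.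
have -> : Num.sqrt 2 ^+ n * expR (dotp z z / (2 * t)) * ((Num.sqrt 2 ^+ n)^-1 * a * expR (- (dotp (w - z) (w - z) / (2 * (2 * t))))) =
  a * (expR (dotp z z / (2 * t)) * expR (- (dotp (w - z) (w - z) / (2 * (2 * t))))).
  by field.
rewrite ler_wpM2l// -expRD ler_expR -subr_ge0.
have -> : dotp z z / (2 * t) - dotp (w - z) (w - z) / (2 * (2 * t)) - - (dotp w w / (2 * t)) =
  dotp (w + z) (w + z) / (4 * t).
  rewrite !(dotpDl, dotpDr, dotpNl, dotpNr) (dotpC z w).
  by field; rewrite gt_eqF.
by rewrite divr_ge0 ?dotp_ge0// mulr_ge0// ltW.
Qed.

(** The bound of [conv_riesz_bound] excludes z = 0; there the Gaussian is recentred at a nonzero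
    point. *)
Lemma hconv_riesz_lty k t z : n = k.+2 -> (0 < k)%N -> 0 < t ->
  (hconv (EFin \o @riesz R n k) t z < +oo)%E.
Proof.
move=> nk k0 t0; have [C [C0 hC]] := conv_riesz_bound R nk k0.
have [z0|z0] := eqVneq z 0; last by apply: le_lt_trans (hC t z t0 z0) _; rewrite ltry.
pose e : E := const_mx 1.
have e0 : e != 0.
  rewrite /e nk; apply/eqP => /rowP/(_ ord0); rewrite !mxE => /eqP; exact/negP/oner_neq0.
have [c c0 hc] := heat_recentre e t0.
have t2 : 0 < 2 * t by rewrite mulr_gt0.
have m1 : measurable_fun setT (fun w : E => riesz k w * heat (2 * t) (w - e)).
  apply: measurable_funM; first exact: measurable_riesz.
  by apply: measurable_heat; apply: measurable_rVB => //; exact: measurable_cst.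
have m2 : measurable_fun setT (fun w : E => riesz k w * heat t (w - z)).
  apply: measurable_funM; first exact: measurable_riesz.
  by apply: measurable_heat; apply: measurable_rVB => //; exact: measurable_cst.
apply: (@le_lt_trans _ _ (c%:E * hconv (EFin \o @riesz R n k) (2 * t) e)%E).
  rewrite /hconv /=; under eq_integral do rewrite -EFinM.
  under [X in (_ <= _ * X)%E]eq_integral do rewrite -EFinM.
  rewrite -ge0_integralZr_real//; last by move=> w; rewrite mulr_ge0 ?riesz_ge0 ?heat_ge0.
  apply: ge0_le_integral_real => //.
  - by apply: measurable_funM; [exact: measurable_cst|].
  - by move=> w; rewrite mulr_ge0 ?riesz_ge0 ?heat_ge0.
  - by move=> w; rewrite (mulrCA c) z0 subr0 ler_wpM2l ?riesz_ge0.
rewrite lte_mul_pinfty ?lee_fin//.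
by apply: le_lt_trans (hC _ _ t2 e0) _; rewrite ltry.
Qed.

Lemma integrable_riesz2_gss (hm : E -> R) b t : (2 < n)%N -> measurable_fun setT hm ->
  (forall x, 0 <= hm x <= b * riesz 2 x) -> 0 < t ->
  leb.-integrable setT (EFin \o (fun xi => hm xi * gss t xi)).
Proof.
move=> n2 mhm hb t0; have t2 : 0 < t / 2 by rewrite divr_gt0.
have mr : measurable_fun setT (fun x : E => riesz 2 x * expR (- (t / 2 * dotp x x))).
  by apply: measurable_funM; [exact: measurable_riesz|exact: measurable_expR_dotp].
have ir : leb.-integrable setT (EFin \o (fun x : E => riesz 2 x * expR (- (t / 2 * dotp x x)))).
  apply/integrableP; split; first by apply/measurable_EFinP.
  have := integral_riesz2_gauss (R := R) n2 t2; congr (_ < _)%E; apply: eq_integral => x _.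
  by rewrite /= ger0_norm// mulr_ge0 ?riesz_ge0 ?expR_ge0.
apply: (integrable_dominated _ (integrable_mulrl b ir)).
  by apply: measurable_funM => //; exact: measurable_gss.
move=> x; have /andP[h0 h1] := hb x.
by rewrite ger0_norm ?mulr_ge0 ?gss_ge0// mulrA ler_wpM2r// expR_ge0.
Qed.

End homogeneous_functions.

(** * Competitors, and the support of the minimizer *)

Section competitors.
Variables (R : realType) (n : nat).
Local Notation E := 'rV[R]_n.
Local Notation leb := (lebesgue_rV R n).
Variables (K : E -> \bar R) (V : E -> R).
Hypotheses (mK : measurable_fun setT K) (K0 : forall x, (0 <= K x)%E).
Hypotheses (mV : measurable_fun setT V) (V0 : forall x, 0 <= V x).
Implicit Types (x y z : E) (t : R) (p : E -> R).

Let mVE : measurable_fun setT (fun x => (V x)%:E).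
Proof. exact/measurable_EFinP. Qed.

Let V0E x : (0 <= (V x)%:E)%E. Proof. by rewrite lee_fin. Qed.

Let mK2 : measurable_fun setT (fun q : E * E => K (q.1 - q.2)).
Proof.
apply: measurableT_comp mK _; apply: measurable_rVB; [exact: measurable_fst|exact: measurable_snd].
Qed.

Lemma measurable_potential (lam : {sigma_finite_measure set E -> \bar R}) p :
  measurable_fun setT p -> (forall x, 0 <= p x) ->
  measurable_fun setT (fun x => \int[lam]_y (K (x - y) * (p y)%:E))%E.
Proof.
move=> mp p0; pose F (q : E * E) := (K (q.1 - q.2) * (p q.2)%:E)%E.
have mF : measurable_fun setT F.
  apply: emeasurable_funM => //; apply/measurable_EFinP.
  exact: measurableT_comp mp measurable_snd.
have F0 q : (0 <= F q)%E by rewrite mule_ge0// lee_fin.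
exact: (measurable_fun_fubini_tonelli_F F mF F0).
Qed.

(** The interaction is quadratic and the potential energy linear in the measure, whence the two
    powers of Z. The base measure is mu for restrictions of mu, and Lebesgue measure for truncated
    regularizations. *)
Lemma normalized_energy (lam : {sigma_finite_measure set E -> \bar R}) p (Z : R) :
  measurable_fun setT p -> (forall x, 0 <= p x) -> 0 < Z -> (\int[lam]_x (p x)%:E = Z%:E)%E ->
  exists nu : probability E R, (energy K V nu =
    (Z ^- 2)%:E * (\int[lam]_x \int[lam]_y (K (x - y) * (p x)%:E * (p y)%:E)) +
    (Z^-1)%:E * \int[lam]_x (V x * p x)%:E)%E.
Proof.
move=> mp p0 Z0 pZ; pose q x := Z^-1 * p x.
have Zi : 0 <= Z^-1 by rewrite invr_ge0 ltW.
have mq : measurable_fun setT q by apply: measurable_funM => //; exact: measurable_cst.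
have q0 x : 0 <= q x by rewrite mulr_ge0.
have q1 : (\int[lam]_x (q x)%:E = 1)%E.
  by rewrite ge0_integralZr_real// pZ -EFinM mulVf// gt_eqF.
have mpE : measurable_fun setT (fun x => (p x)%:E) by exact/measurable_EFinP.
have mKx x : measurable_fun setT (fun y => K (x - y)).
  by apply: measurableT_comp mK _; apply: measurable_rVB => //; exact: measurable_cst.
have [nu nuE] := density_probability mq q0 q1; exists nu.
have pot0 x : (0 <= \int[lam]_y (K (x - y) * (p y)%:E))%E.
  by apply: integral_ge0 => y _; rewrite mule_ge0// lee_fin.
have mKp x : measurable_fun setT (fun y => (K (x - y) * (p y)%:E)%E) by exact: emeasurable_funM.
have Kp0 x y : (0 <= K (x - y) * (p y)%:E)%E by rewrite mule_ge0// lee_fin.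
have mpot := measurable_potential lam mp p0.
have e0 x : (\int[nu]_y K (x - y) = Z^-1%:E * \int[lam]_y (K (x - y) * (p y)%:E))%E.
  rewrite nuE// -ge0_integralZl ?lee_fin//.
  by apply: eq_integral => y _; rewrite EFinM muleCA.
have e1 x : (\int[lam]_y (K (x - y) * (p x)%:E * (p y)%:E) = (p x)%:E * \int[lam]_y (K (x - y) * (p y)%:E))%E.
  rewrite -ge0_integralZl ?lee_fin//.
  by apply: eq_integral => y _; rewrite muleAC muleC.
have e2 : (\int[nu]_x \int[nu]_y K (x - y)%R =
    (Z ^- 2)%:E * \int[lam]_x \int[lam]_y (K (x - y) * (p x)%:E * (p y)%:E))%E.
  under eq_integral => x _ do rewrite e0.
  under [in RHS]eq_integral => x _ do rewrite e1.
  rewrite nuE; last 2 first.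
  - exact: measurable_funeM.
  - by move=> x; rewrite mule_ge0// lee_fin.
  rewrite -ge0_integralZl//.
  - have -> : ((Z ^- 2)%:E = (Z^-1)%:E * (Z^-1)%:E)%E by rewrite -EFinM -invfM expr2.
    apply: eq_integral => x _; rewrite /q EFinM -!muleA; congr (_ * _)%E.
    by rewrite muleCA; congr (_ * _)%E; rewrite muleC.
  - exact: emeasurable_funM.
  - by move=> x _; rewrite mule_ge0// lee_fin.
  - by rewrite lee_fin invr_ge0 exprn_ge0// ltW.
have e3 : (\int[nu]_x (V x)%:E = (Z^-1)%:E * \int[lam]_x (V x * p x)%:E)%E.
  rewrite nuE// -ge0_integralZr_real//.
  - by apply: eq_integral => x _; rewrite -EFinM mulrCA.
  - exact: measurable_funM.
  - by move=> x; rewrite mulr_ge0.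
by rewrite /energy e2 e3.
Qed.

Variable mu : probability E R.

Lemma energy_restricted_smear t (B : set E) (Z : R) : 0 < t -> measurable B -> 0 < Z ->
  (\int[leb]_x ((\1_B x)%:E * smear mu t x) = Z%:E)%E ->
  exists nu : probability E R, (energy K V nu <=
    (Z ^- 2)%:E * energy_heat mu K (2 * t) +
    (Z^-1)%:E * \int[leb]_x ((V x * \1_B x)%:E * smear mu t x))%E.
Proof.
move=> t0 mB Z0 BZ; pose s x := fine (smear mu t x); pose p x := \1_B x * s x.
have sE x : smear mu t x = (s x)%:E by rewrite /s fineK// smear_fin.
have s0 x : 0 <= s x by rewrite fine_ge0// smear_ge0.
have ms : measurable_fun setT s by apply: measurableT_comp (measurable_smear mu t0).
have m1 : measurable_fun setT (\1_B : E -> R) by exact: measurable_indic.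
have i0 x : 0 <= \1_B x :> R by rewrite indicE.
have i1 x : \1_B x <= 1 :> R by rewrite indicE; case: (_ \in _).
have mp : measurable_fun setT p by exact: measurable_funM.
have p0 x : 0 <= p x by rewrite mulr_ge0.
have ps x : p x <= s x by rewrite /p ler_piMl.
have pZ : (\int[leb]_x (p x)%:E = Z%:E)%E.
  by rewrite -BZ; apply: eq_integral => x _; rewrite sE -EFinM.
have [nu nuE] := normalized_energy mp p0 Z0 pZ; exists nu; rewrite nuE; apply: leeD.
  apply: lee_wpmul2l; first by rewrite lee_fin invr_ge0 exprn_ge0// ltW.
  have mI (h : E -> R) : measurable_fun setT h -> (forall x, 0 <= h x) ->
      measurable_fun setT (fun x => \int[leb]_y (K (x - y) * (h x)%:E * (h y)%:E))%E.
    move=> mh h0; pose F (q : E * E) := (K (q.1 - q.2) * (h q.1)%:E * (h q.2)%:E)%E.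
    have mF : measurable_fun setT F.
      apply: emeasurable_funM; first apply: emeasurable_funM => //.
        by apply/measurable_EFinP; exact: measurableT_comp mh measurable_fst.
      by apply/measurable_EFinP; exact: measurableT_comp mh measurable_snd.
    have F0 q : (0 <= F q)%E by rewrite !mule_ge0// lee_fin.
    exact: (measurable_fun_fubini_tonelli_F F mF F0).
  have mKx x : measurable_fun setT (fun y => K (x - y)).
    by apply: measurableT_comp mK _; apply: measurable_rVB => //; exact: measurable_cst.
  have mKh (h : E -> R) x : measurable_fun setT h ->
      measurable_fun setT (fun y => K (x - y) * (h x)%:E * (h y)%:E)%E.
    move=> mh; apply: emeasurable_funM; last exact/measurable_EFinP.
    by apply: emeasurable_funM => //; exact: measurable_cst.
  rewrite -energy_smear//; under [leRHS]eq_integral => x _ do under eq_integral => y _ do rewrite !sE.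
  apply: ge0_le_integral => //.
  - by move=> x _; apply: integral_ge0 => y _; rewrite !mule_ge0// lee_fin.
  - exact: mI.
  - exact: mI.
  move=> x _; apply: ge0_le_integral => //.
  - by move=> y _; rewrite !mule_ge0// lee_fin.
  - exact: mKh.
  - exact: mKh.
  move=> y _; rewrite -!muleA lee_wpmul2l// -!EFinM lee_fin; exact: ler_pM.
apply: lee_wpmul2l; first by rewrite lee_fin invr_ge0 ltW.
by under [leRHS]eq_integral do rewrite sE -EFinM -mulrA.
Qed.

(* If th is the mass of B, comparing mu with its normalized restriction to B bounds
   the potential energy outside B by (th^-2 - 1) E(mu), whereas V > 8 E(mu) there. *)
Lemma minimizer_supported : minimizer (energy K V) mu -> (energy K V mu < +oo)%E -> coercive V ->
  exists2 rho, 0 <= rho & mu (~` disk rho) = 0%E.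
Proof.
move=> mu_min efin coV.
pose I := (\int[mu]_x \int[mu]_y K (x - y)%R)%E.
have I0 : (0 <= I)%E by apply: integral_ge0 => x _; exact: integral_ge0.
have vE0 : (0 <= \int[mu]_x (V x)%:E)%E by exact: integral_ge0.
have eE : energy K V mu = (I + \int[mu]_x (V x)%:E)%E by [].
pose e := fine (energy K V mu).
have e0E : (0 <= energy K V mu)%E by rewrite eE adde_ge0.
have e0 : 0 <= e by rewrite fine_ge0.
have eEF : energy K V mu = e%:E by rewrite fineK// ge0_fin_numE.
(* The factor 8 first gives th >= 7/8 and then exceeds the 3 of the closing comparison; the summand
   1 covers e = 0. *)
have [r hr] := coV (8 * e + 1).
pose r' := Num.max r 0; have r'0 : 0 <= r' by rewrite le_max lexx orbT.
exists (r' ^+ 2); first exact: sqr_ge0.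
set B := disk _; have mB : measurable B by exact: measurable_disk.
have mB' : measurable (~` B) by exact: measurableC.
have VB x : ~ B x -> 8 * e + 1 <= V x.
  move=> /negP; rewrite /B /disk /= -ltNge => h; apply: hr.
  apply: (@le_trans _ _ r'); first by rewrite le_max lexx.
  by rewrite -(@ler_pXn2r _ 2)// ?nnegrE ?enorm_ge0// sqr_enorm ltW.
have m1 : measurable_fun setT (\1_B : E -> R) by exact: measurable_indic.
have m1' : measurable_fun setT (\1_(~` B) : E -> R) by exact: measurable_indic.
have [i0 i0'] : (forall x, 0 <= \1_B x :> R) /\ (forall x, 0 <= \1_(~` B) x :> R).
  by split=> x; rewrite indicE.
have i1 x : \1_B x <= 1 :> R by rewrite indicE; case: (_ \in _).
pose vi := (\int[mu]_x (V x * \1_B x)%:E)%E; pose vo := (\int[mu]_x (V x * \1_(~` B) x)%:E)%E.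
have vi0 : (0 <= vi)%E by apply: integral_ge0 => x _; rewrite lee_fin mulr_ge0.
have vo0 : (0 <= vo)%E by apply: integral_ge0 => x _; rewrite lee_fin mulr_ge0.
have vE : (\int[mu]_x (V x)%:E = vi + vo)%E.
  rewrite /vi /vo -ge0_integralDr_real//; try exact: measurable_funM; try by move=> x; rewrite mulr_ge0.
  apply: eq_integral => x _; rewrite -EFinD -mulrDr; congr EFin.
  by rewrite !indicE in_setC; case: (_ \in _); rewrite ?addr0 ?add0r mulr1.
have [fI [fi fo]] : I \is a fin_num /\ vi \is a fin_num /\ vo \is a fin_num.
  move: efin; rewrite eE vE => efin.
  split; first by rewrite ge0_fin_numE//; apply: le_lt_trans efin; rewrite leeDl// adde_ge0.
  split; rewrite ge0_fin_numE//; apply: le_lt_trans efin; rewrite -[leLHS]add0e; apply: leeD => //.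
    by rewrite leeDl.
  by rewrite leeDr.
have sum : e = fine I + fine vi + fine vo.
  have fio : (vi + vo)%E \is a fin_num by rewrite fin_numD fi fo.
  by rewrite /e eE vE (fineD fI fio) (fineD fi fo) addrA.
have [pI [pi' po]] : 0 <= fine I /\ 0 <= fine vi /\ 0 <= fine vo by rewrite !fine_ge0.
pose th := fine (mu B).
have muB : mu B = th%:E by rewrite fineK// fin_num_measure.
have muB' : mu (~` B) = (1 - th)%:E by rewrite probability_setC// muB.
have th1 : 0 <= 1 - th by rewrite -lee_fin -muB'.
have cheb : (8 * e + 1) * (1 - th) <= fine vo.
  rewrite -lee_fin fineK//.
  have -> : ((8 * e + 1) * (1 - th))%:E = ((8 * e + 1)%:E * \int[mu]_x (\1_(~` B) x)%:E)%E.
    by rewrite integral_indic// setIT EFinM; congr (_ * _)%E; exact/esym.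
  rewrite -ge0_integralZr_real//; last by rewrite addr_ge0// mulr_ge0.
  apply: ge0_le_integral_real => //.
  - by apply: measurable_funM => //; exact: measurable_cst.
  - exact: measurable_funM.
  - by move=> x; rewrite mulr_ge0// addr_ge0// mulr_ge0.
  - move=> x; have [Bx|Bx] := pselect (B x); last by rewrite ler_wpM2r// VB.
    by rewrite indicE in_setC mem_set// !mulr0.
(* Chebyshev's inequality and vo <= e give 1 - th <= e / (8 e + 1) < 1/8. *)
have th2 : 7 / 8 <= th by nra.
have th0 : 0 < th by lra.
have BZ : (\int[mu]_x (\1_B x)%:E = th%:E)%E by rewrite integral_indic ?setIT.
have [nu nuE] := normalized_energy m1 i0 th0 BZ.
have := mu_min nu; rewrite nuE eEF sum -/vi => le1.
have le2 : (\int[mu]_x \int[mu]_y (K (x - y) * (\1_B x)%:E * (\1_B y)%:E) <= I)%E.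
  have mKx x : measurable_fun setT (fun y => K (x - y)).
    by apply: measurableT_comp mK _; apply: measurable_rVB => //; exact: measurable_cst.
  have m1E : measurable_fun setT (fun x : E => (\1_B x)%:E : \bar R) by exact/measurable_EFinP.
  have Kb x y : (K (x - y) * (\1_B x)%:E * (\1_B y)%:E <= K (x - y)%R)%E.
    by rewrite -muleA -EFinM -[leRHS]mule1 lee_wpmul2l// lee_fin mulr_ile1.
  have Kb0 x y : (0 <= K (x - y) * (\1_B x)%:E * (\1_B y)%:E)%E.
    by rewrite -muleA -EFinM mule_ge0// lee_fin mulr_ge0.
  apply: ge0_le_integral => //.
  - by move=> x _; exact: integral_ge0.
  - pose F (q : E * E) := (K (q.1 - q.2) * (\1_B q.1)%:E * (\1_B q.2)%:E)%E.
    have mF : measurable_fun setT F.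
      apply: emeasurable_funM; first apply: emeasurable_funM => //.
        exact: measurableT_comp m1E measurable_fst.
      exact: measurableT_comp m1E measurable_snd.
    exact: (measurable_fun_fubini_tonelli_F F mF (fun q => Kb0 q.1 q.2)).
  - exact: (measurable_fun_fubini_tonelli_F (fun q : E * E => K (q.1 - q.2)) mK2 (fun q => K0 _)).
  move=> x _; apply: ge0_le_integral => //.
  by apply: emeasurable_funM => //; apply: emeasurable_funM => //; exact: measurable_cst.
have : fine I + fine vi + fine vo <= th ^- 2 * fine I + th^-1 * fine vi.
  rewrite -lee_fin; apply: le_trans le1 _; rewrite EFinD !EFinM (fineK fI) (fineK fi).
  by rewrite leeD2r// lee_wpmul2l// lee_fin invr_ge0 sqr_ge0.
have /eqP : th^-1 * th = 1 by rewrite mulVf// gt_eqF.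
have : 0 <= th^-1 by rewrite invr_ge0 ltW.
rewrite -exprVn; move: (th^-1) => q q0 /eqP qth le3.
rewrite muB'; congr EFin; apply/eqP; rewrite eq_le th1 andbT.
have q2 : q <= 8 / 7 by nra.
have q1 : 1 <= q by nra.
have qq : q - 1 = q * (1 - th) by rewrite mulrBr qth mulr1.
(* Minimality reads I + vi + vo <= q^2 I + q vi. Raising q vi to q^2 vi and adding (q^2 - 1) vo >= 0
   recovers the whole energy on the right. *)
have l1 : fine vo <= (q ^+ 2 - 1) * e.
  have : 0 <= fine vi * (q ^+ 2 - q) by rewrite mulr_ge0// subr_ge0 expr2 ler_peMl.
  have : 0 <= fine vo * (q ^+ 2 - 1) by rewrite mulr_ge0// subr_ge0 expr2 mulr_ege1.
  by rewrite sum; nra.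
have l2 : q ^+ 2 - 1 = q * (q + 1) * (1 - th).
  have -> : q ^+ 2 - 1 = (q + 1) * (q - 1) by ring.
  by rewrite qq; ring.
have l3 : q * (q + 1) <= 3 by nra.
have l4 : (q ^+ 2 - 1) * e <= 3 * (1 - th) * e.
  by rewrite ler_wpM2r// l2 ler_wpM2r.
have l5 : 0 <= e * (1 - th) by exact: mulr_ge0.
by lra.
Qed.

End competitors.

(** Mean value theorem for J + Phi between s < t1 / 2 and t1, with error t1 at s: the increment is
    at least -(1 + C2) t1 over a length of at least t1 / 2, so some slope is at least -2 (1 + C2),
    while every slope is at most -(m0 / 2) A + C1. *)
Lemma descent_bound (R : realType) (J Phi A : R -> R) (m0 e t0 C1 C2 : R) :
  0 < m0 -> 0 < t0 -> 0 <= C2 ->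
  (forall s : R, 0 < s -> exists d : R, is_derive s 1 J d /\ d <= - (m0 * A s)) ->
  (forall s : R, 0 < s -> exists d : R, is_derive s 1 Phi d /\ d <= m0 / 2 * A s + C1) ->
  (forall t, 0 < t < t0 -> e <= J t + Phi t + C2 * t) ->
  (forall eps t, 0 < eps -> 0 < t -> exists2 s, 0 < s < t & J s + Phi s <= e + eps) ->
  exists C, forall t, 0 < t -> exists2 r, 0 < r < t & A r <= C.
Proof.
move=> m00 t00 C20 hJ hP hlow hlim; exists (2 / m0 * (C1 + 2 + 2 * C2)) => t tp.
pose t1 := Num.min t t0 / 2.
have mt : 0 < Num.min t t0 by rewrite lt_min tp.
have t1p : 0 < t1 by rewrite divr_gt0.
have [mt1 mt2] : Num.min t t0 <= t /\ Num.min t t0 <= t0 by rewrite !ge_min !lexx orbT.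
have t1t : t1 < t by rewrite /t1; lra.
have t1t0 : 0 < t1 < t0 by apply/andP; split => //; rewrite /t1; lra.
have h2 : 0 < t1 / 2 by rewrite divr_gt0.
have [s /andP[s0 st] hs] := hlim _ _ t1p h2.
have hD (r : R) : 0 < r -> exists d : R, is_derive r 1 (fun u => J u + Phi u) d /\ d <= - (m0 / 2 * A r) + C1.
  move=> r0; have [d [id dle]] := hJ r r0; have [d' [id' dle']] := hP r r0.
  by exists (d + d'); split; [exact: is_deriveD|lra].
have /choice[D hD'] : forall r : R, exists d : R, 0 < r ->
    is_derive r 1 (fun u => J u + Phi u) d /\ d <= - (m0 / 2 * A r) + C1.
  move=> r; have [r0|r0] := ltP 0 r; first by have [d hd] := hD r r0; exists d.
  by exists 0.
have st1 : s < t1 by lra.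
have der x : x \in `]s, t1[ -> is_derive x 1 (fun u => J u + Phi u) (D x).
  by rewrite in_itv => /andP[sx _]; have [] := hD' x (lt_trans s0 sx).
have cont : {within `[s, t1], continuous (fun u => J u + Phi u)}.
  apply: derivable_within_continuous => x; rewrite in_itv => /andP[sx _].
  by have [[]] := hD' x (lt_le_trans s0 sx).
have [r rI rE] := MVT st1 der cont.
move: rI; rewrite in_itv => /andP[sr rt]; have r0 : 0 < r by exact: lt_trans sr.
exists r; first by rewrite r0 (lt_trans rt).
have [_ Dr] := hD' r r0.
have low := hlow _ t1t0.
have l1 : D r * (t1 - s) <= (- (m0 / 2 * A r) + C1) * (t1 - s) by rewrite ler_wpM2r//; lra.
have l2 : (m0 / 2 * A r - C1) * (t1 - s) <= (1 + C2) * t1 by move: l1 rE low hs => /=; lra.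
have l3 : m0 / 2 * A r - C1 <= 2 * (1 + C2).
  rewrite -(@ler_pM2r _ (t1 - s)); last by lra.
  by apply: le_trans l2 _; nra.
have -> : A r = 2 / m0 * (m0 / 2 * A r) by field; rewrite gt_eqF.
by rewrite ler_wpM2l ?divr_ge0 ?(ltW m00)//; lra.
Qed.

(** * Limits as the regularization vanishes *)

Section smoothing_limits.
Variables (R : realType) (n : nat).
Local Notation E := 'rV[R]_n.
Local Notation leb := (lebesgue_rV R n).
Variables (u : nat -> R).
Hypotheses (u0 : forall k, 0 < u k) (cu : u @ \oo --> 0).
Implicit Types (x y z : E) (t : R) (f : E -> R).

Lemma cvg_hconv f z (M : R) : measurable_fun setT f -> (forall w, 0 <= f w) -> {for z, continuous f} ->
  (forall t, 0 < t <= 1 -> (hconv (EFin \o f) (2 * t) z <= M%:E)%E) ->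
  (fun k => hconv (EFin \o f) (u k) z) @ \oo --> (f z)%:E.
Proof.
move=> mf f0 cf fM.
have near_u e : 0 < e -> \forall k \near \oo,
    ((f z - e)%:E <= hconv (EFin \o f) (u k) z <= (f z + e)%:E)%E.
  move=> e0; have [tau tau0 htau] := approx_identity mf f0 cf fM e0.
  have ut : \forall k \near \oo, u k < tau by exact: (cvgr_lt 0 cu).
  apply: filterS ut => k uk; apply: htau.
  by rewrite u0.
have fin_h r k (h : ((f z - r)%:E <= hconv (EFin \o f) (u k) z <= (f z + r)%:E)%E) :
    hconv (EFin \o f) (u k) z \is a fin_num.
  move: h => /andP[h1 h2]; rewrite fin_numElt (lt_le_trans _ h1) ?ltNyr//=.
  by rewrite (le_lt_trans h2)// ltry.
apply/fine_cvgP; split.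
  by have := near_u 1 ltr01; apply: filterS => k; exact: fin_h.
apply/cvgrPdist_le => e e0; have := near_u e e0; apply: filterS => k h.
have fk := fin_h _ _ h; move: h; rewrite -(fineK fk) !lee_fin => /andP[h1 h2].
by rewrite /= ler_norml; apply/andP; split; lra.
Qed.

Lemma hconv_bounded f (M t : R) z : 0 < t -> measurable_fun setT f -> (forall w, 0 <= f w <= M) ->
  (hconv (EFin \o f) t z <= M%:E)%E.
Proof.
move=> t0 mf fM; have M0 : 0 <= M by have /andP[h1 h2] := fM 0; exact: le_trans h2.
have mh : measurable_fun setT (fun w : E => heat t (w - z)).
  by apply: measurable_heat; apply: measurable_rVB => //; exact: measurable_cst.
apply: (@le_trans _ _ (\int[leb]_w (M * heat t (w - z))%:E)%E).
  rewrite /hconv /=; under eq_integral do rewrite -EFinM.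
  apply: ge0_le_integral_real => //.
  - exact: measurable_funM.
  - by apply: measurable_funM => //; exact: measurable_cst.
  - by move=> w; have /andP[h1 _] := fM w; rewrite mulr_ge0// heat_ge0.
  - by move=> w; have /andP[_ h1] := fM w; rewrite ler_wpM2r// heat_ge0.
by rewrite ge0_integralZr_real ?integral_heat_shift ?mule1// => w; exact: heat_ge0.
Qed.

(** Asking for continuity on S only covers both the truncated potential and the indicator of an open
    set S. *)
Lemma cvg_integral_hconv (mu : probability E R) f (S : set E) (M : R) :
  measurable S -> measurable_fun setT f -> (forall w, 0 <= f w <= M) ->
  (forall z, S z -> {for z, continuous f}) ->
  (fun k => \int[mu]_x ((\1_S x)%:E * hconv (EFin \o f) (u k) x))%E @ \oo -->
  (\int[mu]_x (\1_S x * f x)%:E)%E.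
Proof.
move=> mS mf fM cf.
have f0 w : 0 <= f w by have /andP[] := fM w.
have M0 : 0 <= M by have /andP[h1 h2] := fM 0; exact: le_trans h2.
have m1 : measurable_fun setT (\1_S : E -> R) by exact: measurable_indic.
have m1E : measurable_fun setT (fun x => (\1_S x)%:E : \bar R) by exact/measurable_EFinP.
have mfE : measurable_fun setT (EFin \o f) by exact/measurable_EFinP.
have f0E w : (0 <= (EFin \o f) w)%E by rewrite lee_fin.
have mh t : 0 < t -> measurable_fun setT (hconv (EFin \o f) t) by move=> t0; exact: measurable_conv.
have h0 t x : 0 < t -> (0 <= hconv (EFin \o f) t x)%E by move=> t0; exact: conv_ge0.
have i0 x : 0 <= \1_S x :> R by rewrite indicE.
have i1 x : \1_S x <= 1 :> R by rewrite indicE; case: (_ \in _).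
have [|||||_ _] := @dominated_convergence _ _ _ mu setT measurableT
  (fun k x => (\1_S x)%:E * hconv (EFin \o f) (u k) x)%E (fun x => (\1_S x * f x)%:E) (cst M%:E).
- by move=> k; apply: emeasurable_funM => //; exact: mh.
- by apply/measurable_EFinP; exact: measurable_funM.
- apply: aeW => x _; have [Sx|Sx] := pselect (S x).
    rewrite indicE mem_set// mul1r; under eq_fun do rewrite mul1e.
    by apply: (cvg_hconv (M := M)) => // [|t /andP[t0 _]]; [exact: cf|apply: hconv_bounded => //; exact: mulr_gt0].
  rewrite indicE memNset// mul0r; under eq_fun do rewrite mul0e.
  exact: cvg_cst.
- apply/integrableP; split; first exact: measurable_cst.
  under eq_integral do rewrite /= ger0_norm//.
  by rewrite integral_cst_probability ltry.
- apply: aeW => x k _; rewrite gee0_abs ?mule_ge0 ?h0 ?lee_fin//.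
  rewrite -[leRHS]mul1e; apply: lee_pmul => //; rewrite ?lee_fin ?h0//.
  exact: hconv_bounded.
- by [].
Qed.

(** Dominated convergence on the product space, with dominating function C K. As K is infinite at 0,
    finiteness of the energy makes the diagonal negligible, and off the diagonal W is continuous. *)
Lemma cvg_energy_heat (mu : probability E R) (K : E -> \bar R) (W : E -> R) (C : R) :
  measurable_fun setT W -> (forall x, 0 <= W x) -> (forall z, z != 0 -> {for z, continuous W}) ->
  measurable_fun setT K -> K 0 = +oo%E -> (forall z, z != 0 -> K z = (W z)%:E) ->
  (0 < n)%N ->
  (forall t z, 0 < t -> z != 0 -> (hconv (EFin \o W) t z <= (C * W z)%:E)%E) ->
  0 < C -> (\int[mu]_x \int[mu]_y K (x - y)%R < +oo)%E ->
  (fun k => energy_heat mu (EFin \o W) (u k)) @ \oo --> (\int[mu]_x \int[mu]_y K (x - y)%R)%E.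
Proof.
move=> mW W0 cW mK Ky KW n0 hC C0 Ifin.
have K0 z : (0 <= K z)%E.
  by have [->|z0] := eqVneq z 0; [rewrite Ky|rewrite KW// lee_fin].
have mWE : measurable_fun setT (EFin \o W) by exact/measurable_EFinP.
have W0E w : (0 <= (EFin \o W) w)%E by rewrite lee_fin.
have md : measurable_fun setT (fun q : E * E => q.1 - q.2).
  by apply: measurable_rVB; [exact: measurable_fst|exact: measurable_snd].
have mT : measurable_fun setT (fun q : E * E => K (q.1 - q.2)) by exact: measurableT_comp mK md.
have T0 (q : E * E) : (0 <= K (q.1 - q.2)%R)%E by [].
have mh k : measurable_fun setT (fun q : E * E => hconv (EFin \o W) (u k) (q.1 - q.2)).
  by apply: measurableT_comp md; exact: measurable_conv.
have h0 k z : (0 <= hconv (EFin \o W) (u k) z)%E by exact: conv_ge0.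
have IE := fubini_tonelli1 (m1 := mu) (m2 := mu) _ mT T0.
have JE k : energy_heat mu (EFin \o W) (u k) =
    (\int[(mu \x mu)]_q hconv (EFin \o W) (u k) (q.1 - q.2)%R)%E.
  by rewrite (fubini_tonelli1 (m1 := mu) (m2 := mu) _ (mh k) (fun q => h0 k _)).
have iT : (mu \x mu)%E.-integrable setT (fun q : E * E => K (q.1 - q.2)).
  apply/integrableP; split=> //; under eq_integral do rewrite gee0_abs//.
  by rewrite IE.
rewrite [X in _ --> X](_ : _ = \int[(mu \x mu)]_q K (q.1 - q.2)%R)%E; last by rewrite IE.
under eq_fun do rewrite JE.
have [|||||_ _] := @dominated_convergence _ _ _ (mu \x mu)%E setT measurableT
  (fun k (q : E * E) => hconv (EFin \o W) (u k) (q.1 - q.2)) (fun q : E * E => K (q.1 - q.2))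
  (fun q : E * E => C%:E * K (q.1 - q.2)%R)%E.
- exact: mh.
- exact: mT.
- have := integrable_ae measurableT iT; apply: filterS => q /(_ I) fq _.
  have [q0|q0] := eqVneq (q.1 - q.2) 0; first by move: fq; rewrite q0 Ky.
  rewrite (KW _ q0); apply: (cvg_hconv (M := C * W (q.1 - q.2))) => //; first exact: cW.
  by move=> t /andP[t0 _]; apply: hC => //; exact: mulr_gt0.
- by have := integrableZl measurableT C iT.
- apply: aeW => q k _; rewrite gee0_abs//.
  have [->|q0] := eqVneq (q.1 - q.2) 0; first by rewrite Ky gt0_muley ?leey// lte_fin.
  by rewrite (KW _ q0) -EFinM hC.
- by [].
Qed.

End smoothing_limits.

(** * Energy bounds for the minimizer *)

Section minimizer_energy.
Variables (R : realType) (n : nat).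
Local Notation E := 'rV[R]_n.
Local Notation leb := (lebesgue_rV R n).
Variables (K : E -> \bar R) (V : E -> R).
Hypotheses (mK : measurable_fun setT K) (K0 : forall x, (0 <= K x)%E).
Hypotheses (LV : L2loc V) (V0 : forall x, 0 <= V x).
Variable mu : probability E R.
Hypothesis mu_min : minimizer (energy K V) mu.
Implicit Types (x y z : E) (t : R).

Let mV : measurable_fun setT V. Proof. by case: LV. Qed.

(** The competitor is uniform on a cube. Its density is at most a multiple of the Gaussian at time
    1, the regularization of a Dirac mass, whose interaction energy is the convolution at time 2
    evaluated at 0. *)
Lemma minimizer_lty (M : R) : (forall x, box 1 x -> V x <= M) -> (hconv K 2 0 < +oo)%E ->
  (energy K V mu < +oo)%E.
Proof.
move=> VM hK; pose p : E -> R := \1_(box 1).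
have mp : measurable_fun setT p by exact: measurable_box_indic.
have p0 x : 0 <= p x by rewrite /p indicE.
have Z0 : 0 < 2 ^+ n :> R by rewrite exprn_gt0.
have mb := @measurable_box R n 1.
have pZ : (\int[leb]_x (p x)%:E = (2 ^+ n)%:E)%E.
  by rewrite integral_indic// setIT -[2 in RHS]mulr1; exact: lebesgue_box.
have [nu nuE] := normalized_energy mK K0 mV V0 mp p0 Z0 pZ.
apply: le_lt_trans (mu_min nu) _; rewrite nuE.
have t1 : 0 < 1 :> R by exact: ltr01.
(* A lower bound for the Gaussian on the cube, where |x|^2 <= n. *)
pose c := heat 1 (0 : E) * expR (- (n%:R / 2)).
have c0 : 0 < c by rewrite mulr_gt0 ?expR_gt0 ?heat_gt0.
have pc x : p x <= c^-1 * heat 1 (x - 0).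
  rewrite subr0 /p indicE; case: (boolP (x \in _)) => [|_]; last first.
    by rewrite mulr_ge0 ?heat_ge0// invr_ge0 ltW.
  rewrite inE => bx; rewrite mulrC ler_pdivlMr// mul1r /c.
  have hE (z : E) : heat 1 z = (Num.sqrt (2 * pi))^-1 ^+ n * expR (- (dotp z z / 2)).
    by rewrite /heat !mulr1.
  rewrite !hE (_ : dotp (0 : E) 0 = 0); last by apply/eqP; rewrite dotp_eq0.
  rewrite (_ : - (0 / 2) = 0 :> R) ?mul0r ?oppr0// expR0.
  rewrite mulr1 ler_wpM2l ?exprn_ge0 ?invr_ge0 ?sqrtr_ge0//.
  rewrite ler_expR lerN2 ler_wpM2r ?invr_ge0//.
  rewrite -[leRHS]mulr1 mulr_natl -[n in leRHS]card_ord -sumr_const.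
  apply: ler_sum => i _; have := bx i; rewrite -expr2 -real_normK ?num_real// => h.
  by rewrite expr_le1// ltW.
have Ifin : (\int[leb]_x \int[leb]_y (K (x - y) * (p x)%:E * (p y)%:E) < +oo)%E.
  pose d0 : probability E R := \d_(0 : E).
  have sE x : smear d0 1 x = (heat 1 (x - 0))%:E.
    by rewrite /smear integral_dirac ?diracT ?mul1e//; apply/measurable_EFinP;
      apply: measurable_heat; apply: measurable_rVB => //; exact: measurable_cst.
  have fin : (energy_heat d0 K (2 * 1) < +oo)%E.
    rewrite /energy_heat mulr1.
    have mh y : measurable_fun setT (fun z => hconv K 2 (y - z)).
      apply: (measurableT_comp (measurable_conv (ltr0n R 2) mK K0)).
      by apply: measurable_rVB => //; exact: measurable_cst.
    have e y : (\int[d0]_z hconv K 2 (y - z) = hconv K 2 (y - 0))%E.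
      by rewrite integral_dirac ?diracT ?mul1e.
    under eq_integral do rewrite e.
    rewrite integral_dirac ?diracT ?mul1e ?subr0//.
    by under eq_fun do rewrite subr0; exact: measurable_conv.
  have ci : 0 <= c^-1 by rewrite invr_ge0 ltW.
  have pp x y : (p x * p y <= c^-1 ^+ 2 * (heat 1 (x - 0) * heat 1 (y - 0))).
    by rewrite expr2 mulrACA; apply: ler_pM.
  have mH x : measurable_fun setT (fun y => K (x - y) * smear d0 1 x * smear d0 1 y)%E.
    apply: emeasurable_funM; last exact: measurable_smear.
    apply: emeasurable_funM; last exact: measurable_cst.
    by apply: measurableT_comp mK _; apply: measurable_rVB => //; exact: measurable_cst.
  have H0 x y : (0 <= K (x - y) * smear d0 1 x * smear d0 1 y)%E.
    by rewrite !mule_ge0// smear_ge0.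
  have mHH : measurable_fun setT (fun x => \int[leb]_y (K (x - y) * smear d0 1 x * smear d0 1 y))%E.
    pose F (q : E * E) := (K (q.1 - q.2) * smear d0 1 q.1 * smear d0 1 q.2)%E.
    have mF : measurable_fun setT F.
      apply: emeasurable_funM; first apply: emeasurable_funM.
      - apply: measurableT_comp mK _; apply: measurable_rVB; [exact: measurable_fst|exact: measurable_snd].
      - exact: measurableT_comp (measurable_smear _ t1) measurable_fst.
      - exact: measurableT_comp (measurable_smear _ t1) measurable_snd.
    exact: (measurable_fun_fubini_tonelli_F F mF (fun q => H0 q.1 q.2)).
  have mpE : measurable_fun setT (fun x => (p x)%:E) by exact/measurable_EFinP.
  have mP : measurable_fun setT (fun x => \int[leb]_y (K (x - y) * (p x)%:E * (p y)%:E))%E.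
    pose F (q : E * E) := (K (q.1 - q.2) * (p q.1)%:E * (p q.2)%:E)%E.
    have mF : measurable_fun setT F.
      apply: emeasurable_funM; first apply: emeasurable_funM.
      - apply: measurableT_comp mK _; apply: measurable_rVB; [exact: measurable_fst|exact: measurable_snd].
      - exact: measurableT_comp mpE measurable_fst.
      - exact: measurableT_comp mpE measurable_snd.
    have F0 q : (0 <= F q)%E by rewrite !mule_ge0// lee_fin.
    exact: (measurable_fun_fubini_tonelli_F F mF F0).
  apply: (@le_lt_trans _ _ ((c^-1 ^+ 2)%:E * energy_heat d0 K (2 * 1))%E); last first.
    by rewrite lte_mul_pinfty// lee_fin exprn_ge0.
  rewrite -energy_smear// -ge0_integralZl//; last 2 first.
  - by move=> x _; apply: integral_ge0 => y _.
  - by rewrite lee_fin exprn_ge0.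
  apply: ge0_le_integral => //.
  - by move=> x _; apply: integral_ge0 => y _; rewrite !mule_ge0// lee_fin.
  - exact: measurable_funeM.
  move=> x _; rewrite -ge0_integralZl ?lee_fin ?exprn_ge0//.
  apply: ge0_le_integral => //.
  - by move=> y _; rewrite !mule_ge0// lee_fin.
  - apply: emeasurable_funM => //; apply: emeasurable_funM; last exact: measurable_cst.
    by apply: measurableT_comp mK _; apply: measurable_rVB => //; exact: measurable_cst.
  - exact: measurable_funeM.
  move=> y _; rewrite !sE -muleA -EFinM -[X in (_ <= _ * X)%E]muleA -EFinM muleCA -EFinM.
  by rewrite lee_wpmul2l// lee_fin.
have Vfin : (\int[leb]_x (V x * p x)%:E < +oo)%E.
  apply: (@le_lt_trans _ _ (\int[leb]_x (`|M| * p x)%:E)%E); last first.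
    by rewrite ge0_integralZr_real// pZ -EFinM ltry.
  apply: ge0_le_integral_real => //.
  - exact: measurable_funM.
  - by apply: measurable_funM => //; exact: measurable_cst.
  - by move=> x; rewrite mulr_ge0.
  - move=> x; rewrite /p indicE; case: (boolP (x \in _)) => [|_]; last by rewrite !mulr0.
    by rewrite inE !mulr1 => /VM h; apply: le_trans h _; exact: ler_norm.
by rewrite lte_add_pinfty// lte_mul_pinfty// ?lee_fin ?invr_ge0 ?exprn_ge0.
Qed.

Variables (rho : R) (r0 : 0 <= rho) (suppmu : mu (~` disk rho) = 0%E).
Let r2 := 4 * rho + 4.
Let v y := V y * cutoff r2 y.

Lemma integral_supported (f : E -> \bar R) : measurable_fun setT f -> (forall x, 0 <= f x)%E ->
  (\int[mu]_x f x = \int[mu]_x ((\1_(disk rho) x)%:E * f x))%E.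
Proof.
move=> mf f0; have mS := @measurable_disk R n rho.
apply: ae_eq_integral => //.
  by apply: emeasurable_funM => //; apply/measurable_EFinP; exact: measurable_indic.
exists (~` disk rho); split; [exact: measurableC|exact: suppmu|].
move=> x /= h Sx; apply: h => _.
by rewrite indicE mem_set// mul1e.
Qed.

(** Points outside the larger disk are at distance at least 1 from the support of mu, and
    [heat_tail] gains a factor t there. *)
Lemma smear_tail : exists2 D : R, 0 <= D & forall t, 0 < t ->
  (\int[leb]_x ((\1_(~` disk r2) x)%:E * smear mu t x) <= (D * t)%:E)%E.
Proof.
exists (Num.sqrt 2 ^+ n * (4 / 1 ^+ 2)).
  by rewrite mulr_ge0 ?exprn_ge0 ?sqrtr_ge0// divr_ge0// exprn_ge0.
move=> t t0; set D := _ * (_ / _).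
have D0 : 0 <= D * t.
  by rewrite !mulr_ge0 ?exprn_ge0 ?sqrtr_ge0 ?invr_ge0 ?exprn_ge0// ltW.
have t2 : 0 < 2 * t by rewrite mulr_gt0.
have mB' : measurable (~` disk r2 : set E) by apply: measurableC; exact: measurable_disk.
have m1 : measurable_fun setT (\1_(~` disk r2) : E -> R) by exact: measurable_indic.
have i0 x : 0 <= \1_(~` disk r2) x :> R by rewrite indicE.
have i1 x : \1_(~` disk r2) x <= 1 :> R by rewrite indicE; case: (_ \in _).
have mh s y : measurable_fun setT (fun x : E => heat s (x - y)).
  by apply: measurable_heat; apply: measurable_rVB => //; exact: measurable_cst.
have m1E : measurable_fun setT (fun x : E => (\1_(~` disk r2) x)%:E : \bar R) by exact/measurable_EFinP.
have i0E x : (0 <= (\1_(~` disk r2) x)%:E :> \bar R)%E by rewrite lee_fin.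
rewrite integral_smear_mul//.
pose H y := (\int[leb]_x ((\1_(~` disk r2) x)%:E * (heat t (x - y)%R)%:E))%E.
have H0 y : (0 <= H y)%E by apply: integral_ge0 => x _; rewrite mule_ge0// lee_fin heat_ge0.
have mH : measurable_fun setT H by exact: (measurable_conv t0 m1E i0E).
have HD y : disk rho y -> (H y <= (D * t)%:E)%E.
  move=> yr; apply: (@le_trans _ _ (\int[leb]_x (D * t * heat (2 * t) (x - y))%:E)%E).
    rewrite /H; under eq_integral do rewrite -EFinM.
    apply: ge0_le_integral_real => //.
    - exact: measurable_funM.
    - by apply: measurable_funM => //; exact: measurable_cst.
    - by move=> x; rewrite mulr_ge0// heat_ge0.
    - move=> x; rewrite indicE; case: (boolP (x \in _)) => [|_]; last first.
        by rewrite mul0r mulr_ge0// heat_ge0.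
      rewrite inE mul1r => /= /negP; rewrite -ltNge => /ltW xr.
      exact: (heat_tail t0 ltr01 (far_enorm r0 yr xr)).
  rewrite ge0_integralZr_real ?integral_heat_shift ?mule1//.
  by move=> x; exact: heat_ge0.
rewrite (integral_supported mH H0) -[leRHS](integral_cst_probability mu).
apply: ge0_le_integral => //.
- by move=> x _; rewrite mule_ge0// lee_fin indicE.
- apply: emeasurable_funM => //; apply/measurable_EFinP; apply: measurable_indic.
  exact: measurable_disk.
move=> x _; rewrite indicE; case: (boolP (x \in _)) => [|_]; last by rewrite mul0e lee_fin.
by rewrite inE mul1e => /HD.
Qed.

Lemma EFin_average_smear t : 0 < t ->
  (average mu (disk rho) v t)%:E = (\int[leb]_y ((v y)%:E * smear mu t y))%E.
Proof.
move=> t0; have mv : measurable_fun setT v.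
  by apply: measurable_funM => //; apply: measurable_elem; exact: elem_cutoff.
have v0 y : 0 <= v y by rewrite mulr_ge0// plateau_ge0.
have mvE : measurable_fun setT (EFin \o v) by exact/measurable_EFinP.
have v0E y : (0 <= (EFin \o v) y)%E by rewrite lee_fin.
rewrite (EFin_average mu (@measurable_disk R n rho) mv v0 (integrable_cutoff r2 LV) t0).
rewrite (integral_smear_mul mu t0 mvE v0E).
rewrite (@integral_supported (fun y => \int[leb]_x ((v x)%:E * (heat t (x - y)%R)%:E))%E).
- by apply: eq_integral => x _; congr (_ * _)%E; apply: eq_integral => y _; rewrite -EFinM.
- exact: (measurable_conv t0 mvE v0E).
- by move=> x; apply: integral_ge0 => y _; rewrite mule_ge0 ?lee_fin ?heat_ge0.
Qed.

(* If Z is the mass of smear mu t in the disk, comparing mu with the normalized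
   restriction gives Z^2 E(mu) <= J + Z Phi, and 1 - Z is O(t). *)
Lemma minimizer_le_smoothed : (energy K V mu < +oo)%E -> exists C t1, [/\ 0 <= C, 0 < t1 &
  forall t j, 0 < t < t1 -> energy_heat mu K (2 * t) = j%:E ->
    fine (energy K V mu) <= j + average mu (disk rho) v t + C * t].
Proof.
move=> efin; have [D D0 hD] := smear_tail.
have e0E : (0 <= energy K V mu)%E.
  apply: adde_ge0; first by apply: integral_ge0 => x _; exact: integral_ge0.
  by apply: integral_ge0 => x _; rewrite lee_fin.
pose e := fine (energy K V mu).
have e0 : 0 <= e by rewrite fine_ge0.
have eEF : energy K V mu = e%:E by rewrite fineK// ge0_fin_numE.
(* The time bound ensures D t < 1, hence Z > 0, and the constant comes from 1 - Z^2 <= 2 (1 - Z) <=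
   2 D t. *)
exists (2 * D * e), (D + 1)^-1; split; first by rewrite !mulr_ge0.
  by rewrite invr_gt0; lra.
move=> t j /andP[t0 tD] jE; rewrite -/e.
have Dt : D * t < 1.
  have : t * (D + 1) < 1 by rewrite -ltr_pdivlMr ?div1r//; lra.
  by move=> h; lra.
have mB := @measurable_disk R n r2.
have ms := measurable_smear mu t0.
have s0 x := smear_ge0 mu x t0.
have mi (A : set E) : measurable A -> measurable_fun setT (fun x => (\1_A x)%:E * smear mu t x)%E.
  by move=> mA; apply: emeasurable_funM => //; apply/measurable_EFinP; exact: measurable_indic.
have i0 (A : set E) x : (0 <= (\1_A x)%:E * smear mu t x)%E.
  by rewrite mule_ge0// lee_fin indicE.
pose ZE := (\int[leb]_x ((\1_(disk r2) x)%:E * smear mu t x))%E.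
have Zsum : (ZE + \int[leb]_x ((\1_(~` disk r2) x)%:E * smear mu t x) = 1)%E.
  rewrite /ZE -integralDe//; [|exact: mi|by apply: mi; exact: measurableC].
  rewrite -(integral_smear mu t0); apply: eq_integral => x _.
  rewrite !indicE in_setC; case: (_ \in _); first by rewrite mul1e mul0e adde0.
  by rewrite mul1e mul0e add0e.
have ZE0 : (0 <= ZE)%E by apply: integral_ge0.
have tl0 : (0 <= \int[leb]_x ((\1_(~` disk r2) x)%:E * smear mu t x))%E by apply: integral_ge0.
have tl1 := hD t t0.
have tlf : (\int[leb]_x ((\1_(~` disk r2) x)%:E * smear mu t x))%E \is a fin_num.
  by rewrite ge0_fin_numE//; apply: le_lt_trans tl1 _; rewrite ltry.
have ZEf : ZE \is a fin_num.
  rewrite ge0_fin_numE//; apply: (@le_lt_trans _ _ 1%E); last exact: ltry.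
  by rewrite -Zsum leeDl.
pose Z := fine ZE; have ZZ : ZE = Z%:E by rewrite fineK.
have [Z1 ZD] : Z <= 1 /\ 1 - D * t <= Z.
  move: Zsum tl0 tl1; rewrite ZZ -(fineK tlf) -EFinD => -[zs]; rewrite !lee_fin => a b.
  by split; lra.
have Z0 : 0 < Z by lra.
have [nu nuE] := energy_restricted_smear mK K0 mV V0 t0 mB Z0 ZZ.
have := le_trans (mu_min nu) nuE; rewrite eEF jE.
pose a := average mu (disk rho) v t.
have c0 y : 0 <= @cutoff R n r2 y by exact: plateau_ge0.
(* The cutoff equals 1 on the disk and is nonnegative elsewhere. *)
have ia : (\int[leb]_x ((V x * \1_(disk r2) x)%:E * smear mu t x) <= a%:E)%E.
  have mv : measurable_fun setT v.
    by apply: measurable_funM => //; apply: measurable_elem; exact: elem_cutoff.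
  have m1 : measurable_fun setT (fun x => V x * \1_(disk r2) x).
    by apply: measurable_funM => //; exact: measurable_indic.
  have mVs (f : E -> R) : measurable_fun setT f -> measurable_fun setT (fun x => (f x)%:E * smear mu t x)%E.
    by move=> mf; apply: emeasurable_funM => //; exact/measurable_EFinP.
  rewrite /a EFin_average_smear//.
  apply: (ge0_le_integral leb measurableT _ (mVs _ m1) (mVs _ mv)).
  - by move=> x _; rewrite mule_ge0// lee_fin mulr_ge0// indicE.
  move=> x _; apply: lee_wpmul2r => //; rewrite lee_fin /v ler_wpM2l//.
  rewrite indicE; case: (boolP (x \in _)) => // ; rewrite inE => xr.
  by rewrite cutoff1.
have a0 : 0 <= a.
  rewrite -lee_fin; apply: le_trans ia; apply: integral_ge0 => x _.
  by rewrite mule_ge0// lee_fin mulr_ge0// indicE.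
have Zi : 0 <= Z^-1 by rewrite invr_ge0 ltW.
move=> /le_trans/(_ (leeD2l _ (lee_wpmul2l _ ia))); rewrite lee_fin => /(_ Zi).
rewrite -!EFinM -EFinD lee_fin => le1.
have le2 : Z ^+ 2 * e <= j + Z * a.
  have -> : j + Z * a = Z ^+ 2 * (Z ^- 2 * j + Z^-1 * a) by field; rewrite gt_eqF.
  by rewrite ler_wpM2l// sqr_ge0.
have le3 : Z * a <= a by rewrite ler_piMl.
have le4 : (1 - Z ^+ 2) * e <= 2 * (D * t) * e.
  by rewrite ler_wpM2r//; nra.
by rewrite -/a; lra.
Qed.

End minimizer_energy.

(** All that the construction of the density needs from minimality: a bounded support, and a bound
    on the regularized L2 norms along times tending to 0. *)
Lemma minimizer_bounded_heat_mass (R : realType) (N : nat) (hN : (3 <= N)%N)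
    (V : 'rV[R]_N -> R) (V_ge0 : forall x, 0 <= V x) (V_coercive : coercive V)
    (V_cont : continuous V) (V_H2loc : Hloc 2 V)
    (Psi : 'rV[R]_N -> R) (Psi_cont : {within @usphere R N, continuous Psi})
    (Psi_gt0 : forall w, usphere w -> 0 < Psi w)
    (m : 'rV[R]_N -> R) (m0 m1 : R) (m_meas : measurable_fun (@usphere R N) m) (m0_gt0 : 0 < m0)
    (m_bounds : forall w, usphere w -> m0 <= m w <= m1)
    (FW : distributional_fourier (fun x => (fine (kernelW Psi x))%:C%C)
            (fun xi => (homogeneous m 2 xi)%:C%C))
    (mu : probability 'rV[R]_N R) (mu_min : minimizer (energy (kernelW Psi) V) mu) :
  exists2 rho, mu (~` disk rho) = 0%E &
  exists C, forall t, 0 < t -> exists2 r, 0 < r < t & fine (heat_mass mu (2 * r)) <= C.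
Proof.
have n0 : (0 < N)%N by exact: leq_trans hN.
set k := (N - 2)%N; have k0 : (0 < k)%N by rewrite subn_gt0.
have Nk : N = k.+2 by rewrite -[k.+2]addn2 subnK// (leq_trans _ hN).
pose W := homogeneous Psi k; pose K := kernelW Psi; pose hm := homogeneous m 2.
have K00 : K 0 = +oo%E by rewrite /K /kernelW eqxx.
have KW z : z != 0 -> K z = (W z)%:E by rewrite /K /kernelW => /negbTE ->.
(* At the origin [fine] turns the infinite value into 0, which is also the dummy value of
   [homogeneous] there. *)
have WE : (fun x => fine (kernelW Psi x)) = W.
  apply/funext => x; have [->|x0] := eqVneq x 0; last by rewrite -/K KW.
  by rewrite -/K K00 /W homogeneous0.
have mW : measurable_fun setT W.
  by apply: measurable_homogeneous => //; exact: continuous_within_measurable.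
have [a [b [a0 [b0 Pab]]]] := positive_bounds n0 Psi_cont Psi_gt0.
have Wab := homogeneous_bounds k0 Pab.
have rz0 j (x : 'rV[R]_N) : 0 <= riesz j x by exact: riesz_ge0.
have W0 x : 0 <= W x.
  by have /andP[h _] := Wab x; apply: le_trans h; rewrite mulr_ge0// ltW.
have W0E x : (0 <= (EFin \o W) x)%E by rewrite lee_fin.
have mWE : measurable_fun setT (EFin \o W) by exact/measurable_EFinP.
have K0 x : (0 <= K x)%E.
  by have [->|x0] := eqVneq x 0; [rewrite K00|rewrite KW// lee_fin].
have mK : measurable_fun setT K.
  have ms := @measurable_rV_set1 R N.
  pose ind : 'rV[R]_N -> \bar R := (cst +oo%E) \_ [set (0 : 'rV[R]_N)].
  have -> : K = (fun x => (W x)%:E + ind x)%E.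
    apply/funext => x; rewrite /ind patchE; have [->|x0] := eqVneq x 0.
      by rewrite K00 mem_set// addey.
    by rewrite memNset ?adde0 ?KW//=; apply/eqP.
  by apply: emeasurable_funD => //; apply/(measurable_restrictT _ ms); exact: measurable_cst.
(* The two kernels differ at the origin only, a null set, so their convolutions agree everywhere. *)
have hKW t z : 0 < t -> hconv K t z = hconv (EFin \o W) t z.
  move=> t0; have mh : measurable_fun setT (fun w : 'rV[R]_N => (heat t (w - z))%:E).
    by apply: measurable_heat_sub => //; exact: measurable_cst.
  apply: ae_eq_integral => //; [exact: emeasurable_funM|exact: emeasurable_funM|].
  by apply: filterS (ae_neq0 R n0) => w w0 _; rewrite KW.
have mr := @measurable_riesz R N k.
have hWr t z (t0 : 0 < t) := le_hconv z t0 mW mr (ltW b0) W0 (rz0 k)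
  (fun w => (elimT andP (Wab w)).2).
have Wfin t z : 0 < t -> (hconv (EFin \o W) t z < +oo)%E.
  move=> t0; apply: le_lt_trans (hWr t z t0) _.
  by rewrite lte_mul_pinfty ?lee_fin ?(ltW b0)// hconv_riesz_lty.
have [C0 [C00 hC0]] := conv_riesz_bound R Nk k0.
(* W lies between a and b times the Riesz kernel, so passing to the Riesz kernel and back costs b /
   a. *)
pose CW := b * C0 / a.
have CW0 : 0 < CW by rewrite divr_gt0// mulr_gt0.
have hCW t z : 0 < t -> z != 0 -> (hconv (EFin \o W) t z <= (CW * W z)%:E)%E.
  move=> t0 z0; apply: le_trans (hWr t z t0) _.
  apply: (@le_trans _ _ (b%:E * (C0 * riesz k z)%:E)%E).
    by rewrite lee_wpmul2l ?lee_fin ?(ltW b0)// hC0.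
  rewrite -EFinM lee_fin; have /andP[h _] := Wab z.
  have -> : CW * W z = b * (C0 * (W z / a)) by rewrite /CW; field; rewrite gt_eqF.
  by rewrite ler_wpM2l ?(ltW b0)// ler_wpM2l ?(ltW C00)// ler_pdivlMr// mulrC.
have mhm : measurable_fun setT hm by exact: measurable_homogeneous.
have hmb := homogeneous_bounds (isT : (0 < 2)%N) m_bounds.
have m0' := ltW m0_gt0.
have hm0 xi : 0 <= hm xi.
  by have /andP[h _] := hmb xi; apply: le_trans h; rewrite mulr_ge0.
have ihm t : 0 < t -> (lebesgue_rV R N).-integrable setT (EFin \o (fun xi => hm xi * gss t xi)).
  move=> t0; apply: (integrable_riesz2_gss (b := m1)) => // x.
  by rewrite hm0/=; have /andP[] := hmb x.
have rd (xi : 'rV[R]_N) : xi != 0 -> riesz 2 xi * dotp xi xi = 1.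
  by move=> x0; rewrite /riesz -sqr_enorm exprVn mulVf// expf_neq0// gt_eqF// enorm_gt0.
have m10 : 0 <= m1.
  pose e : 'rV[R]_N := const_mx 1.
  have e0 : e != 0.
    apply/eqP => /rowP/(_ (Ordinal n0)); rewrite !mxE => /eqP; exact/negP/oner_neq0.
  by have /andP[h1 h2] := m_bounds _ (usphere_dir e0); apply: le_trans m0' (le_trans h1 h2).
have hm_ub xi : hm xi * dotp xi xi <= m1.
  have [->|x0] := eqVneq xi 0; first by rewrite /hm homogeneous0// mul0r.
  rewrite -[leRHS]mulr1 -(rd _ x0) mulrA ler_wpM2r ?dotp_ge0//.
  by have /andP[] := hmb xi.
have hm_lb xi : xi != 0 -> m0 <= hm xi * dotp xi xi.
  move=> x0; rewrite -[leLHS]mulr1 -(rd _ x0) mulrA ler_wpM2r ?dotp_ge0//.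
  by have /andP[] := hmb xi.
have FW' : distributional_fourier (fun x => (W x)%:C%C) (fun xi => (hm xi)%:C%C).
  by rewrite -WE.
have LV : L2loc V by case: V_H2loc.
have mV : measurable_fun setT V by case: LV.
have Vbd r : 0 <= r -> exists M, forall x, disk r x -> V x <= M.
  move=> r0; have ne : @disk R N r !=set0.
    by exists 0; rewrite /disk /= (_ : dotp 0 0 = 0)//; apply/eqP; rewrite dotp_eq0.
  have [c _ hc] := compact_EVT_max ne (@compact_dotp_le R N r) (continuous_subspaceT V_cont).
  by exists (V c) => x xr; apply: hc; rewrite inE.
have efin : (energy K V mu < +oo)%E.
  have [M hM] := Vbd N%:R (ler0n _ _).
  apply: (minimizer_lty mK K0 LV V_ge0 mu_min (M := M)); last by rewrite hKW// Wfin.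
  move=> x bx; apply: hM; rewrite /disk /= -[N in leRHS]card_ord -sumr_const.
  apply: ler_sum => i _; have := bx i; rewrite -expr2 -real_normK ?num_real// => h.
  by rewrite expr_le1// ltW.
have [rho r0 suppmu] := minimizer_supported mK K0 mV V_ge0 mu_min efin V_coercive.
exists rho => //.
set r2 := 4 * rho + 4; pose v y := V y * cutoff r2 y.
have c0 (y : 'rV[R]_N) : 0 <= cutoff r2 y by exact: plateau_ge0.
have v0 y : 0 <= v y by rewrite mulr_ge0.
have ec := @elem_cutoff R N r2; have mc := measurable_elem ec.
have mv : measurable_fun setT v by exact: measurable_funM.
have iv := integrable_cutoff r2 LV.
have r20 : 0 <= r2 + 1 by rewrite /r2; lra.
have [M hM] := Vbd (r2 + 1) r20.
have M0 : 0 <= M.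
  by apply: le_trans (V_ge0 0) (hM _ _); rewrite /disk /= (_ : dotp 0 0 = 0)//; apply/eqP; rewrite dotp_eq0.
have vM y : 0 <= v y <= M * expR 1.
  rewrite v0/=; have [yr|yr] := leP (dotp y y) (r2 + 1).
    by apply: ler_pM => //; [exact: hM|exact: plateau_le].
  by rewrite /v cutoff0 ?mulr0 ?mulr_ge0 ?expR_ge0// ltW.
have cv z : {for z, continuous v}.
  have [dc _] := elem_differentiable ec.
  have dz : {for z, continuous (@cutoff R N r2)} := differentiable_continuous (dc z).
  exact: (@cvgM _ _ (nbhs z) _ V (@cutoff R N r2) _ _ (V_cont z) dz).
have mS := @measurable_disk R N rho.
have eJ s : 0 < s -> energy_heat mu (EFin \o W) (2 * s) = (fine (energy_heat mu (EFin \o W) (2 * s)))%:E.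
  by move=> s0; exact: (fine_energy_heat mW W0 FW' mhm hm0 ihm Wfin mu s0).
have l0 : 0 < m0 / 2 by rewrite divr_gt0.
have [C1 hC1] := daverage_cutoff_le mu n0 r0 V_H2loc V_ge0 l0.
have [C2 [t1 [C20 t10 hlow]]] := minimizer_le_smoothed mK K0 LV V_ge0 mu_min r0 suppmu efin.
have eKW s : 0 < s -> energy_heat mu K (2 * s) = energy_heat mu (EFin \o W) (2 * s).
  move=> s0; apply: eq_integral => y _; apply: eq_integral => z _.
  by rewrite hKW// mulr_gt0.
apply: (@descent_bound R (fun s => fine (energy_heat mu (EFin \o W) (2 * s)))
  (average mu (disk rho) v) (fun s => fine (heat_mass mu (2 * s))) m0
  (fine (energy K V mu)) t1 C1 C2) => //.
- by move=> s s0; apply: (is_derive_energy_heat mW W0 FW' mhm hm0 ihm Wfin m0_gt0 hm_ub hm_lb).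
- move=> s s0; exists (daverage mu (disk rho) v s); split; last exact: hC1.
  exact: is_derive_average.
- move=> t tt; have /andP[t0 _] := tt; apply: hlow => //.
  by rewrite eKW// eJ.
move=> eps t e0 t0.
(* The interaction is smoothed twice and the potential once, so their limits are taken along 2 u and
   u. *)
pose u (j : nat) : R := j.+1%:R^-1.
have u0 j : 0 < u j by rewrite invr_gt0.
have cu : u @ \oo --> 0 by exact: cvg_harmonic.
have u20 j : 0 < 2 * u j by rewrite mulr_gt0.
have cu2 : (fun j => 2 * u j) @ \oo --> 0.
  by rewrite -[X in _ --> X](mulr0 2); apply: cvgM cu; exact: cvg_cst.
have Ifin : (\int[mu]_x \int[mu]_y K (x - y)%R < +oo)%E.
  by apply: le_lt_trans efin; rewrite leeDl//; apply: integral_ge0 => x _; rewrite lee_fin.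
have cvJ := cvg_energy_heat (mu := mu) u20 cu2 mW W0 (fun z z0 => continuous_homogeneous (k := k) Psi_cont z0)
  mK K00 KW n0 hCW CW0 Ifin.
have cvP := cvg_integral_hconv (mu := mu) u0 cu mS mv vM (fun z _ => cv z).
have PE j : (\int[mu]_x ((\1_(disk rho) x)%:E * hconv (EFin \o v) (u j) x) =
   (average mu (disk rho) v (u j))%:E)%E.
  rewrite (EFin_average mu mS mv v0 iv (u0 j)); apply: eq_integral => x _.
  by congr (_ * _)%E; apply: eq_integral => y _.
have VE : (\int[mu]_x (\1_(disk rho) x * v x)%:E = \int[mu]_x (V x)%:E)%E.
  rewrite [RHS](integral_supported suppmu); last 2 first.
  - exact/measurable_EFinP.
  - by move=> x; rewrite lee_fin.
  apply: eq_integral => x _; rewrite EFinM /v indicE; case: (boolP (x \in _)) => [|_].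
    rewrite inE => xr; rewrite cutoff1 ?mulr1//.
    by apply: le_trans xr _; rewrite /r2; lra.
  by rewrite !mul0e.
have eE : ((fine (energy K V mu))%:E = \int[mu]_x \int[mu]_y K (x - y)%R + \int[mu]_x (V x)%:E)%E.
  rewrite fineK// ge0_fin_numE//; apply: adde_ge0.
    by apply: integral_ge0 => x _; exact: integral_ge0.
  by apply: integral_ge0 => x _; rewrite lee_fin.
have cvD : (fun j => (fine (energy_heat mu (EFin \o W) (2 * u j)) + average mu (disk rho) v (u j))%:E) @ \oo
    --> (fine (energy K V mu))%:E.
  rewrite eE; under eq_fun => j do rewrite EFinD -eJ// -PE.
  apply: cvgeD => //; last by rewrite -VE.
  by rewrite ge0_adde_def// inE; apply: integral_ge0 => x _; rewrite ?lee_fin//; exact: integral_ge0.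
have /fine_cvgP[_ cvR] := cvD.
have e1 : fine (energy K V mu) < fine (energy K V mu) + eps by rewrite ltrDl.
have near1 : \forall j \near \oo, fine (energy_heat mu (EFin \o W) (2 * u j)) + average mu (disk rho) v (u j)
    < fine (energy K V mu) + eps.
  exact: (cvgr_lt _ cvR _ e1).
have near2 : \forall j \near \oo, u j < t by exact: (cvgr_lt 0 cu).
have [j [h1 h2]] := filter_ex (filterI near1 near2).
by exists (u j); rewrite ?u0 ?h2// ltW.
Qed.

(** * From bounded regularizations to an L2 density *)

Section regularity.
Variables (R : realType) (n : nat).
Local Notation E := 'rV[R]_n.
Variables (m : {measure set E -> \bar R}) (mfin : (m setT < +oo)%E).

(** Approximation from both sides at once makes the class stable under complements. *)
Definition regular_set (A : set E) := forall e : R, 0 < e ->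
  exists F U : set E, [/\ closed F, open U, F `<=` A, A `<=` U & (m (U `\` F) <= e%:E)%E].

Let meas_lty A : measurable A -> (m A < +oo)%E.
Proof. by move=> mA; apply: le_lt_trans mfin; apply: le_measure; rewrite ?inE. Qed.

Let decreasing_small (G : nat -> set E) (e : R) : (forall k, measurable (G k)) ->
  {homo G : i j / (i <= j)%N >-> (j <= i)%O} -> \bigcap_k G k = set0 -> 0 < e ->
  exists k, (m (G k) <= e%:E)%E.
Proof.
move=> mG dG G0 e0.
have := nonincreasing_cvg_mu (meas_lty (mG 0%N)) mG _ dG; rewrite G0 measure0.
move=> /(_ measurable0)/fine_cvgP[_ cG].
have h : \forall k \near \oo, (fine \o (m \o G)) k < e by exact: (cvgr_lt 0 cG).
have [k /= hk] := filter_ex h; exists k.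
by rewrite -(fineK (x := m (G k))) ?ge0_fin_numE ?meas_lty// lee_fin ltW.
Qed.

(** U is the increasing union of the closed sets of points at distance at least 1/(k+1) from its
    complement; continuity from above of the finite measure does the rest. *)
Lemma regular_open U : open U -> regular_set U.
Proof.
move=> oU e e0.
pose F k := ~` (\bigcup_(z in ~` U) ball z (k.+1%:R^-1 : R)).
have oF k : open (~` F k) by rewrite /F setCK; apply: bigcup_open => z _; exact: ball_open.
have cF k : closed (F k) by rewrite -[F k]setCK; exact: open_closedC.
have FU k : F k `<=` U.
  move=> x Fx; apply: contrapT => Ux; apply: Fx; exists x => //.
  by apply: ballxx; rewrite invr_gt0.
have mUF k : measurable (U `\` F k).
  by apply: measurableD; [exact: open_measurable_rV|exact: closed_measurable_rV].
have [k hk] : exists k, (m (U `\` F k) <= e%:E)%E.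
  apply: decreasing_small => //.
    move=> i j ij; apply/subsetPset => x [Ux /contrapT [z Uz zx]]; split=> //.
    apply; exists z => //; apply: le_ball zx.
    by rewrite lef_pV2 ?posrE// ler_nat.
  apply/seteqP; split=> // x h; have [Ux _] := h 0%N I.
  have /nbhs_ballP[d /= d0 dU] : nbhs x U by exact: open_nbhs_nbhs.
  have [k _ /(_ k (leqnn k)) kd] := near_infty_natSinv_lt (PosNum d0).
  have [_ /contrapT[z Uz zx]] := h k I; apply: Uz; apply: dU; apply: ball_sym.
  by apply: le_ball zx; exact: ltW.
by exists (F k), U; split.
Qed.

Lemma regular_setC A : regular_set A -> regular_set (~` A).
Proof.
move=> rA e e0; have [F [U [cF oU FA AU h]]] := rA e e0.
exists (~` U), (~` F); split; [exact: open_closedC|exact: closed_openC|exact: subsetC|exact: subsetC|].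
by rewrite setDE setCK setIC -setDE.
Qed.

(** One half of e is distributed over the sets as a geometric series. The other half pays for
    replacing the countable union of the closed sets, possibly not closed, by a finite one. *)
Lemma regular_bigcup (A : nat -> set E) : (forall k, regular_set (A k)) -> regular_set (\bigcup_k A k).
Proof.
move=> rA e e0; have e2 : 0 < e / 2 by rewrite divr_gt0.
have ek k : 0 < e / 2 / (2 ^ k.+1)%:R by rewrite divr_gt0// ltr0n expn_gt0.
have /choice[F /choice[U hFU]] := fun k => rA k _ (ek k).
have cF k : closed (F k) by have [] := hFU k.
have oU k : open (U k) by have [] := hFU k.
have mF k := closed_measurable_rV (cF k); have mU k := open_measurable_rV (oU k).
pose V := \bigcup_k U k; have oV : open V by exact: bigcup_open.
pose G k := \bigcup_(i in `I_k) F i.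
have cG k : closed (G k) by apply: closed_bigcup => //; exact: finite_II.
have mG k := closed_measurable_rV (cG k); have mV := open_measurable_rV oV.
pose H := \bigcup_k F k; have mH : measurable H by exact: bigcup_measurable.
have small : (m (V `\` H) <= (e / 2)%:E)%E.
  apply: (@le_trans _ _ (\sum_(0 <= k <oo) m (U k `\` F k))%E).
    apply: measure_sigma_subadditive => [k||]; [exact: measurableD|exact: measurableD|].
    by move=> x [[k _ Ux] Hx]; exists k => //; split=> // Fx; apply: Hx; exists k.
  apply: (@le_trans _ _ (\sum_(0 <= k <oo) (0 + (e / 2 / (2 ^ k.+1)%:R)%:E))%E).
    by apply: lee_nneseries => k // _; rewrite add0e; have [] := hFU k.
  apply: le_trans (epsilon_trick _ _ (ltW e2)) _ => //.
  by rewrite eseries0// add0e.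
have [k hk] : exists k, (m ((V `\` G k) `\` (V `\` H)) <= (e / 2)%:E)%E.
  apply: decreasing_small => //.
  - by move=> k; apply: measurableD; apply: measurableD.
  - move=> i j ij; apply/subsetPset => x [[Vx Gx] Hx]; split=> //; split=> // -[l /= li Fx].
    by apply: Gx; exists l => //=; exact: leq_trans ij.
  - apply/seteqP; split=> // x h; have [[Vx _] Hx] := h 0%N I.
    have [l _ Fl] : H x by apply: contrapT => nH; apply: Hx.
    by have [[_ Gx] _] := h l.+1 I; apply: Gx; exists l => /=.
exists (G k), V; split => //.
- by move=> x [i _ Fx]; exists i => //; have [_ _ FA _ _] := hFU i; exact: FA.
- by move=> x [i _ Ax]; exists i => //; have [_ _ _ AU _] := hFU i; exact: AU.
apply: (@le_trans _ _ (m ((V `\` H) `|` ((V `\` G k) `\` (V `\` H))))).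
  apply: le_measure; rewrite ?inE.
  - exact: measurableD.
  - by apply: measurableU; [exact: measurableD|apply: measurableD; exact: measurableD].
  - by move=> x Vx; have [|nx] := pselect ((V `\` H) x); [left|right].
apply: le_trans (measureU2 _ _ _) _; try by do ?apply: measurableD.
by rewrite [e]splitr EFinD; exact: leeD.
Qed.

Lemma borel_regular A : measurable A -> regular_set A.
Proof.
apply: smallest_sub; last exact: regular_open.
split; [exact: regular_open open0|by move=> B rB; rewrite setTD; exact: regular_setC|exact: regular_bigcup].
Qed.

End regularity.

(** * Quadratic inequality for step functions, and the density *)

Section density.
Variables (R : realType) (n : nat).
Local Notation E := 'rV[R]_n.
Local Notation leb := (lebesgue_rV R n).
Variables (mu : probability E R) (C : R).
Hypothesis hC : forall t : R, 0 < t -> exists2 r, 0 < r < t & fine (heat_mass mu (2 * r)) <= C.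
Implicit Types (x y z : E) (A U : set E).

Let C0 : 0 <= C.
Proof.
have [r /andP[r0 _] h] := hC ltr01; apply: le_trans h; rewrite fine_ge0//.
apply: integral_ge0 => x _; apply: integral_ge0 => y _.
by rewrite lee_fin heat_ge0// mulr_gt0.
Qed.

(** The sets may overlap, so each of them can be enlarged to an open set without touching the
    coefficients. *)
Definition step (I : Type) (s : seq I) (c : I -> R) (A : I -> set E) x : R :=
  \sum_(i <- s) c i * \1_(A i) x.

Section steps.
Variables (I : Type) (s : seq I) (c : I -> R) (A : I -> set E).
Hypotheses (c0 : forall i, 0 <= c i) (mA : forall i, measurable (A i)).

Lemma step_ge0 x : 0 <= step s c A x.
Proof. by apply: sumr_ge0 => i _; rewrite mulr_ge0// indicE. Qed.

Lemma measurable_step : measurable_fun setT (step s c A).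
Proof.
apply: measurable_sum => i; apply: measurable_funM; first exact: measurable_cst.
exact: measurable_indic.
Qed.

Lemma integral_step (m : {measure set E -> \bar R}) :
  (\int[m]_x (step s c A x)%:E = \sum_(i <- s) (c i)%:E * m (A i))%E.
Proof.
under eq_integral do rewrite -sumEFin.
rewrite ge0_integral_sum//; last 2 first.
- move=> i; apply/measurable_EFinP; apply: measurable_funM; first exact: measurable_cst.
  exact: measurable_indic.
- by move=> i x _; rewrite lee_fin mulr_ge0// indicE.
apply: eq_bigr => i _; rewrite ge0_integralZr_real//.
by rewrite integral_indic// setIT.
Qed.

End steps.

(** Before the limit this is 2 psi f <= psi^2 + f^2 integrated, f being the regularized density.
    Openness makes the indicators continuous at the points of their sets, so that the left-hand side
    passes to the limit. *)
Lemma step_open (I : Type) (s : seq I) (c : I -> R) (U : I -> set E) :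
  (forall i, 0 <= c i) -> (forall i, open (U i)) ->
  (2%:E * \int[mu]_x (step s c U x)%:E <= \int[leb]_x (step s c U x ^+ 2)%:E + C%:E)%E.
Proof.
move=> c0 oU; have mU i := open_measurable_rV (oU i).
have u1 k : 0 < k.+1%:R^-1 :> R by rewrite invr_gt0.
have /choice[u hu] : forall k, exists r, 0 < r < k.+1%:R^-1 /\ fine (heat_mass mu (2 * r)) <= C.
  by move=> k; have [r h1 h2] := hC (u1 k); exists r.
have u0 k : 0 < u k by have [/andP[]] := hu k.
have cu : u @ \oo --> 0.
  apply: (@squeeze_cvgr _ _ _ _ (cst 0) (fun k => k.+1%:R^-1)); [|exact: cvg_cst|exact: cvg_harmonic].
  by apply: nearW => k; have [/andP[h1 h2] _] := hu k; rewrite !ltW.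
have m1 i : measurable_fun setT (\1_(U i) : E -> R) by exact: measurable_indic.
have i01 i (x : E) : ((0 : R) <= \1_(U i) x) && (\1_(U i) x <= (1 : R)).
  by rewrite indicE; case: (_ \in _); rewrite /= ?lexx ?ler01.
have ci i z : U i z -> {for z, continuous (\1_(U i) : E -> R)}.
  move=> Uz; have nU : nbhs z (U i) by exact: open_nbhs_nbhs.
  apply: (@cvg_near_cst _ _ _ _ (nbhs z)); apply: filterS nU => x Ux.
  by rewrite !indicE !mem_set.
pose ms := @measurable_step I s c U mU.
have s0 := step_ge0 s U c0.
(* A lower bound for the mass of [U i] under the regularized measure, keeping only points where the
   indicator is continuous; it still tends to the full mass. *)
pose a k i := (\int[mu]_x ((\1_(U i) x)%:E * hconv (EFin \o \1_(U i)) (u k) x))%E.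
have ca i : a ^~ i @ \oo --> mu (U i).
  have -> : mu (U i) = (\int[mu]_x (\1_(U i) x * \1_(U i) x)%:E)%E.
    transitivity (\int[mu]_x (\1_(U i) x)%:E)%E; first by rewrite integral_indic// setIT.
    apply: eq_integral => x _.
    by rewrite indicE; case: (_ \in _); rewrite ?mulr1 ?mulr0.
  exact: (cvg_integral_hconv u0 cu (mU i) (m1 i) (i01 i) (@ci i)).
have i0E i (x : E) : (0 <= (EFin \o \1_(U i)) x :> \bar R)%E.
  by rewrite lee_fin; have /andP[] := i01 i x.
have mE i : measurable_fun setT (EFin \o \1_(U i) : E -> \bar R) by exact/measurable_EFinP.
have h0 i k x : (0 <= hconv (EFin \o \1_(U i)) (u k) x)%E by exact: conv_ge0.
have a0 k i : (0 <= a k i)%E by apply: integral_ge0 => x _; rewrite mule_ge0//; exact: i0E.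
have cL : (fun k => \sum_(i <- s) (c i)%:E * a k i)%E @ \oo --> (\int[mu]_x (step s c U x)%:E)%E.
  rewrite integral_step//; apply: cvg_nnesum => i _.
    by apply: nearW => k; rewrite mule_ge0// lee_fin.
  by apply: cvgeZl => //; exact: ca.
have c2L := cvgeZl (isT : (2%:E : \bar R) \is a fin_num) cL.
apply: cvge_le c2L; apply: nearW => k.
pose sg x := fine (smear mu (u k) x).
have sE x : smear mu (u k) x = (sg x)%:E by rewrite /sg fineK// smear_fin.
have sg0 x : 0 <= sg x by rewrite fine_ge0// smear_ge0.
have msg : measurable_fun setT sg by apply: measurableT_comp (measurable_smear mu (u0 k)).
have ai i : (a k i <= \int[leb]_x (\1_(U i) x * sg x)%:E)%E.
  under [leRHS]eq_integral do rewrite EFinM -sE.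
  rewrite (integral_smear_mul mu (u0 k) (mE i) (i0E i)).
  apply: ge0_le_integral => //.
  - by move=> x _; rewrite mule_ge0//; exact: i0E.
  - by apply: emeasurable_funM; [exact: mE|exact: measurable_conv].
  - exact: (measurable_conv (u0 k) (mE i) (i0E i)).
  - move=> x _; rewrite -[leRHS]mul1e lee_wpmul2r ?h0// lee_fin.
    by have /andP[] := i01 i x.
have le1 : (\sum_(i <- s) (c i)%:E * a k i <= \int[leb]_x (step s c U x * sg x)%:E)%E.
  have -> : (\int[leb]_x (step s c U x * sg x)%:E =
      \sum_(i <- s) (c i)%:E * \int[leb]_x (\1_(U i) x * sg x)%:E)%E.
    under eq_integral => x _.
      rewrite /step mulr_suml -sumEFin; under eq_bigr do rewrite -mulrA; over.
    rewrite ge0_integral_sum//.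
    - apply: eq_bigr => i _; rewrite ge0_integralZr_real//; first exact: measurable_funM.
      by move=> x; rewrite mulr_ge0//; have /andP[] := i01 i x.
    - move=> i; apply/measurable_EFinP; apply: measurable_funM; first exact: measurable_cst.
      exact: measurable_funM.
    - by move=> i x _; rewrite lee_fin !mulr_ge0//; have /andP[] := i01 i x.
  by apply: lee_sum => i _; rewrite lee_wpmul2l// lee_fin.
apply: le_trans (lee_wpmul2l _ le1) _; first by rewrite lee_fin.
have mass : (\int[leb]_x (sg x * sg x)%:E <= C%:E)%E.
  have [_ hk] := hu k; rewrite -lee_fin -fine_heat_mass// -integral_smear_sqr// in hk.
  by apply: le_trans hk; under [leRHS]eq_integral do rewrite sE -EFinM.
rewrite -ge0_integralZr_real//; last 2 first.
- exact: measurable_funM.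
- by move=> x; rewrite mulr_ge0.
apply: le_trans (leeD2l _ mass); rewrite -ge0_integralDr_real.
- apply: ge0_le_integral => //.
  + by move=> x _; rewrite lee_fin !mulr_ge0.
  + apply/measurable_EFinP; apply: measurable_funM; [exact: measurable_cst|exact: measurable_funM].
  + apply: emeasurable_funD; apply/measurable_EFinP; [exact: measurable_funX|exact: measurable_funM].
  + move=> x _; rewrite -EFinD lee_fin.
    by have := sqr_ge0 (step s c U x - sg x); nra.
- exact: measurable_funX.
- exact: measurable_funM.
- by move=> x; exact: sqr_ge0.
- by move=> x; exact: mulr_ge0.
Qed.

Variables (rho : R) (suppmu : mu (~` disk rho) = 0%E).
(** An open set of finite Lebesgue measure that carries mu: regularity is applied to Lebesgue
    measure restricted to it. *)
Let D : set E := [set x | dotp x x < rho + 1].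

Let oD : open D.
Proof. exact: (open_dotp (P := [set r | r < rho + 1])). Qed.

Let mD : measurable D. Proof. exact: open_measurable_rV. Qed.

Let lebD : (leb D < +oo)%E.
Proof.
apply: le_lt_trans (@lebesgue_disk R n (rho + 1)); apply: le_measure; rewrite ?inE//.
  exact: measurable_disk.
by move=> x /ltW.
Qed.

Lemma open_cover A (e : R) : measurable A -> A `<=` D -> 0 < e ->
  exists U, [/\ open U, A `<=` U & (leb (U `\` A) <= e%:E)%E].
Proof.
move=> mA AD e0; pose m : {measure set E -> \bar R} := mrestr leb mD.
have mfin : (m setT < +oo)%E by rewrite /m /= /mrestr setTI.
have [F [U [cF oU FA AU h]]] := borel_regular mfin mA e0.
exists (U `&` D); split; [exact: openI|by move=> x Ax; split; [exact: AU|exact: AD]|].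
apply: le_trans h; rewrite /m /= /mrestr; apply: le_measure; rewrite ?inE.
- by apply: measurableD => //; apply: measurableI => //; exact: open_measurable_rV.
- apply: measurableI => //; apply: measurableD; first exact: open_measurable_rV.
  exact: closed_measurable_rV.
- by move=> x [[Ux Dx] Ax]; split=> //; split=> // /FA.
Qed.

(** Enlarging the sets to open ones changes the step function p into p + q with both at most S, so
    (p + q)^2 <= p^2 + 2 S q, and the integral of q is at most S times the excess measure. *)
Lemma step_borel (I : Type) (s : seq I) (c : I -> R) (A : I -> set E) :
  (forall i, 0 <= c i) -> (forall i, measurable (A i)) -> (forall i, A i `<=` D) ->
  (2%:E * \int[mu]_x (step s c A x)%:E <= \int[leb]_x (step s c A x ^+ 2)%:E + C%:E)%E.
Proof.
move=> c0 mA AD; pose S := \sum_(i <- s) c i.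
have S0 : 0 <= S by exact: sumr_ge0.
apply/lee_addgt0Pr => e e0.
have S1 : 0 < 2 * S ^+ 2 + 1 by rewrite ltr_wpDl// mulr_ge0// sqr_ge0.
(* The total error is 2 S^2 times the excess measure, and the summand 1 allows S = 0. *)
have d0 : 0 < e / (2 * S ^+ 2 + 1) by rewrite divr_gt0.
have /choice[U hU] := fun i => open_cover (mA i) (AD i) d0.
have oU i : open (U i) by have [] := hU i.
have AU i : A i `<=` U i by have [] := hU i.
have mU i := open_measurable_rV (oU i).
have mUA i : measurable (U i `\` A i) by exact: measurableD.
have split_step x : step s c U x = step s c A x + step s c (fun i => U i `\` A i) x.
  rewrite /step -big_split/=; apply: eq_bigr => i _; rewrite -mulrDr; congr (_ * _).
  rewrite !indicE in_setD; case: (boolP (x \in A i)) => [|_]; last by rewrite andbT add0r.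
  by rewrite inE => /AU Ux; rewrite mem_set//= addr0.
have stepS (B : I -> set E) x : step s c B x <= S.
  by apply: ler_sum => i _; rewrite ler_piMr// indicE; case: (_ \in _).
have pA := step_ge0 s A c0; have pU := step_ge0 s U c0.
have pd := step_ge0 s (fun i => U i `\` A i) c0.
have msA := measurable_step s c mA; have msU := measurable_step s c mU.
have msd := measurable_step s c mUA.
apply: (@le_trans _ _ (2%:E * \int[mu]_x (step s c U x)%:E)%E).
  rewrite lee_wpmul2l ?lee_fin//; apply: ge0_le_integral_real => // x.
  by rewrite split_step lerDl.
apply: le_trans (step_open s c0 oU) _.
rewrite [leRHS]addeAC; apply: leeD2r.
apply: (@le_trans _ _ (\int[leb]_x ((step s c A x ^+ 2)%:E + (2 * S * step s c (fun i => U i `\` A i) x)%:E))%E).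
  apply: ge0_le_integral => //.
  - by move=> x _; rewrite lee_fin sqr_ge0.
  - by apply/measurable_EFinP; exact: measurable_funX.
  - apply: emeasurable_funD; apply/measurable_EFinP; first exact: measurable_funX.
    by apply: measurable_funM => //; exact: measurable_cst.
  - move=> x _; rewrite -EFinD lee_fin.
    have := stepS A x; have := stepS U x; have := pA x; have := pd x; rewrite split_step.
    move: (step s c A x) (step s c _ x) => p q q0 p0 h1 h2.
    by have : 0 <= q * (2 * S - (2 * p + q)); [rewrite mulr_ge0//; lra|nra].
have m2 : measurable_fun setT (fun x => step s c A x ^+ 2) by exact: measurable_funX.
have m3 : measurable_fun setT (fun x => 2 * S * step s c (fun i => U i `\` A i) x).
  by apply: measurable_funM => //; exact: measurable_cst.
rewrite (ge0_integralDr_real leb m2 m3); last 2 first.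
- by move=> x; rewrite sqr_ge0.
- by move=> x; rewrite !mulr_ge0.
rewrite leeD2l// ge0_integralZr_real//; last by rewrite mulr_ge0.
rewrite integral_step//.
apply: (@le_trans _ _ ((2 * S)%:E * (S * (e / (2 * S ^+ 2 + 1)))%:E)%E).
  rewrite lee_wpmul2l ?lee_fin ?mulr_ge0// /S mulr_suml -sumEFin; apply: lee_sum => i _.
  by rewrite EFinM lee_wpmul2l ?lee_fin//; have [] := hU i.
rewrite -EFinM lee_fin mulrA (_ : 2 * S * S = 2 * S ^+ 2); last by ring.
by rewrite mulrA ler_pdivrMr// mulrC ler_wpM2l ?(ltW e0)// lerDl.
Qed.

Lemma mu_setID A : measurable A -> mu A = mu (A `&` D).
Proof.
move=> mA; apply/eqP; rewrite eq_le; apply/andP; split; last first.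
  by apply: le_measure; rewrite ?inE//; exact: measurableI.
have mS := @measurable_disk R n rho.
apply: (@le_trans _ _ (mu ((A `&` D) `|` ~` disk rho))).
  apply: le_measure; rewrite ?inE//; first by apply: measurableU; [exact: measurableI|exact: measurableC].
  move=> x Ax; have [xr|xr] := pselect (disk rho x); [left; split=> //|by right].
  by apply: le_lt_trans xr _; rewrite ltrDl.
apply: le_trans (measureU2 _ _ _) _; [exact: measurableI|exact: measurableC|].
by rewrite [X in (_ + X)%E]suppmu adde0.
Qed.

(** On a null set the quadratic term vanishes, and 2 c mu(A) <= C for every c >= 0 forces mu(A) =
    0. *)
Lemma dominated_by_lebesgue : mu `<< leb.
Proof.
apply/null_content_dominatesP => A mA A0; rewrite mu_setID//.
have mB : measurable (A `&` D) by exact: measurableI.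
have B0 : leb (A `&` D) = 0%E by apply: (subset_measure0 mB mA _ A0) => x [].
pose b := fine (mu (A `&` D)).
have bE : mu (A `&` D) = b%:E by rewrite fineK// fin_num_measure.
have b0 : 0 <= b by rewrite fine_ge0.
have key (c : R) : 0 <= c -> 2 * (c * b) <= C.
  move=> c0; have AD : A `&` D `<=` D by move=> x [].
  have := step_borel [:: tt] (fun=> c0) (fun=> mB) (fun=> AD).
  have -> : (\int[mu]_x (step [:: tt] (fun=> c) (fun=> A `&` D) x)%:E = (c * b)%:E)%E.
    by rewrite (integral_step _ (fun=> c0) (fun=> mB)) big_seq1 EFinM -bE.
  rewrite -EFinM.
  have -> : (\int[leb]_x (step [:: tt] (fun=> c) (fun=> A `&` D) x ^+ 2)%:E = 0)%E.
    have m1 : measurable_fun setT (\1_(A `&` D) : E -> R) by exact: measurable_indic.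
    under eq_integral => x _.
      rewrite /step big_seq1 exprMn (_ : \1_(A `&` D) x ^+ 2 = \1_(A `&` D) x); last first.
        by rewrite indicE; case: (_ \in _); rewrite ?expr1n ?expr0n.
      over.
    rewrite ge0_integralZr_real ?sqr_ge0//.
    by rewrite integral_indic// setIT; rewrite [X in (_ * X)%E]B0 mule0.
  by rewrite add0e lee_fin.
rewrite bE; congr EFin; apply/eqP; rewrite eq_le b0 andbT leNgt; apply/negP => bp.
(* This coefficient turns the inequality into 2 (C + 1) <= C. *)
have := key ((C + 1) / b) (divr_ge0 (addr_ge0 C0 ler01) b0).
rewrite (divfK (lt0r_neq0 bp)); apply/negP; rewrite -ltNge.
by apply: (@lt_le_trans _ _ (C + 1)); rewrite ?ltrDl// ler_peMl ?addr_ge0// ler1n.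
Qed.

Import HBNNSimple.

(* For the simple functions h increasing to the density f, step_borel reads
   2 int h f <= int h^2 + C, while int h^2 <= int h f. *)
Lemma L2_density : has_L2_density mu.
Proof.
have dom := dominated_by_lebesgue; split; first exact: dom.
pose rn := Radon_Nikodym_SigmaFinite.f mu leb.
have rnE A : measurable A -> mu A = (\int[leb]_(x in A) rn x)%E.
  by move=> mA; rewrite -(Radon_Nikodym_SigmaFinite.f_integral dom mA).
have rn0 x : (0 <= rn x)%E by exact: Radon_Nikodym_SigmaFinite.f_ge0.
have rnf x : rn x \is a fin_num by exact: Radon_Nikodym_SigmaFinite.f_fin_num.
have mrn : measurable_fun setT rn.
  by have /measurable_int := Radon_Nikodym_SigmaFinite.f_integrable dom.
pose f x := fine (rn x) * \1_D x.
have f0 x : 0 <= f x by rewrite mulr_ge0 ?fine_ge0// indicE.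
have mf : measurable_fun setT f.
  apply: measurable_funM; last exact: measurable_indic.
  exact: measurableT_comp mrn.
have mfE : measurable_fun setT (EFin \o f) by exact/measurable_EFinP.
have f0E x : (0 <= (EFin \o f) x)%E by rewrite lee_fin.
exists f; last first.
  move=> A mA; rewrite mu_setID// rnE; last exact: measurableI.
  rewrite integral_mkcondr; apply: eq_integral => x _.
  by rewrite patchE /f indicE; case: (x \in D); rewrite ?mulr1 ?mulr0 ?fineK.
split=> //.
pose h := nnsfun_approx measurableT mfE.
have hf k x : h k x <= f x.
  rewrite -lee_fin; have cvh := cvg_nnsfun_approx measurableT mfE (fun x _ => f0E x) (I : setT x).
  apply: (cvge_ge _ cvh); exists k => // j /= kj; rewrite lee_fin.
  by have /lefP := nd_nnsfun_approx measurableT mfE kj; exact.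
have h0 k x : 0 <= h k x by [].
have mh k : measurable_fun setT (h k) by [].
have hD k x : ~ D x -> h k x = 0.
  move=> Dx; apply/eqP; rewrite eq_le h0 andbT; apply: le_trans (hf k x) _.
  by rewrite /f indicE memNset// mulr0.
(* The coefficients must be nonnegative for every index, whereas r is known to be so only when it is
   a value of [h k]; hence the absolute value. *)
have hstepE k x : h k x = step (finmap.enum_fset (fset_set (range (h k)))) (fun r => `|r|)
    (fun r => h k @^-1` [set r] `&` D) x.
  rewrite [LHS]fimfunE fsbig_finite//=; apply: eq_bigr => r _.
  have [Dx|Dx] := pselect (D x).
    rewrite !indicE in_setI (mem_set Dx) andbT; case: (boolP (x \in _)) => [|_]; last by rewrite !mulr0.
    by rewrite inE /= => <-; rewrite ger0_norm.
  rewrite [in RHS]indicE memNset => [|[]//]; rewrite mulr0 indicE.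
  case: (boolP (x \in _)) => [|_]; last by rewrite mulr0.
  by rewrite inE /= => <-; rewrite hD// mul0r.
have key k : (\int[leb]_x (h k x ^+ 2)%:E <= C%:E)%E.
  have hb : (2%:E * \int[mu]_x (h k x)%:E <= \int[leb]_x (h k x ^+ 2)%:E + C%:E)%E.
    have := @step_borel R (finmap.enum_fset (fset_set (range (h k)))) (fun r => `|r|)
      (fun r => h k @^-1` [set r] `&` D) (fun r => normr_ge0 r).
    have mA r : measurable (h k @^-1` [set r] `&` D) by apply: measurableI => //; exact: measurable_sfunP.
    move=> /(_ mA (fun r x => @proj2 _ _)).
    by under eq_integral do rewrite -hstepE; under [in leRHS]eq_integral do rewrite -hstepE.
  have le1 : (\int[leb]_x (h k x ^+ 2)%:E <= \int[mu]_x (h k x)%:E)%E.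
    have mhE : measurable_fun setT (fun x => (h k x)%:E) by exact/measurable_EFinP.
    have h0E x : (0 <= (h k x)%:E)%E by rewrite lee_fin.
    rewrite -(Radon_Nikodym_SigmaFinite.change_of_variables dom h0E measurableT mhE).
    have m2 : measurable_fun setT (fun x => (h k x ^+ 2)%:E : \bar R).
      by apply/measurable_EFinP; exact: measurable_funX.
    apply: (ge0_le_integral leb measurableT _ m2 (emeasurable_funM mhE mrn)) => [x _|x _].
      by rewrite lee_fin sqr_ge0.
    rewrite -/rn -(fineK (rnf x)) -EFinM lee_fin expr2 ler_wpM2l//.
    by apply: le_trans (hf k x) _; rewrite /f ler_piMr ?fine_ge0.
  have I0 : (0 <= \int[leb]_x (h k x ^+ 2)%:E)%E by apply: integral_ge0 => x _; rewrite lee_fin sqr_ge0.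
  (* Finiteness allows cancelling the integral on both sides of 2 X <= X + C; it holds because [h k]
     is bounded and vanishes outside D. *)
  have Ifin : (\int[leb]_x (h k x ^+ 2)%:E < +oo)%E.
    have [M [_ hM]] := simple_bounded (h k).
    have hM1 x : h k x <= `|M| + 1.
      apply: le_trans (ler_norm _) (hM (`|M| + 1) _ x I).
      by rewrite ltr_pwDr// ler_norm.
    apply: (@le_lt_trans _ _ (\int[leb]_x ((`|M| + 1) ^+ 2 * \1_D x)%:E)%E).
      apply: ge0_le_integral_real => //.
      - exact: measurable_funX.
      - by apply: measurable_funM; [exact: measurable_cst|exact: measurable_indic].
      - by move=> x; rewrite sqr_ge0.
      - move=> x; have [Dx|Dx] := pselect (D x).
          by rewrite indicE mem_set// mulr1; apply: lerXn2r; rewrite ?nnegrE ?addr_ge0.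
        by rewrite hD// expr0n indicE memNset// mulr0.
    have m1 : measurable_fun setT (\1_D : E -> R) by exact: measurable_indic.
    rewrite ge0_integralZr_real ?sqr_ge0//.
    by rewrite integral_indic// setIT lte_mul_pinfty// lee_fin sqr_ge0.
  have two0 : (0 <= 2%:E :> \bar R)%E by rewrite lee_fin.
  have := le_trans (lee_wpmul2l two0 le1) hb.
  rewrite -(fineK (x := \int[leb]_x (h k x ^+ 2)%:E)%E) ?ge0_fin_numE//.
  by rewrite -EFinM -EFinD !lee_fin; lra.
have f2 : (\int[leb]_x (f x ^+ 2)%:E <= C%:E)%E.
  have mono (x : E) : setT x -> {homo (fun k => (h k x ^+ 2)%:E) : i j / (i <= j)%N >-> (i <= j)%E}.
    move=> _ i j ij; rewrite lee_fin; apply: lerXn2r; rewrite ?nnegrE//.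
    by have /lefP := nd_nnsfun_approx measurableT mfE ij; exact.
  have := @cvg_monotone_convergence _ _ _ leb setT measurableT (fun k x => (h k x ^+ 2)%:E) _ _ mono.
  have -> : (\int[leb]_x limn (fun k => (h k x ^+ 2)%:E) = \int[leb]_x (f x ^+ 2)%:E)%E.
    apply: eq_integral => x _; apply/cvg_lim => //.
    have := cvg_nnsfun_approx measurableT mfE (fun x _ => f0E x) (I : setT x).
    move=> /fine_cvgP[_ cvh]; apply/fine_cvgP; split; first exact: nearW.
    have -> : fine \o (fun k => (h k x ^+ 2)%:E) = (fun k => h k x * h k x) by apply/funext.
    by rewrite expr2; exact: (cvgM cvh cvh).
  move=> /(_ _ _) cvI; apply: cvge_le (cvI _ _).
  - by apply: nearW => k; exact: key.
  - by move=> k; apply/measurable_EFinP; exact: measurable_funX.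
  - by move=> k x _; rewrite lee_fin sqr_ge0.
rewrite inE; apply/andP; split; rewrite inE//=.
rewrite /finite_norm unlock; apply: poweR_lty.
apply: le_lt_trans (_ : (C%:E < +oo)%E); last exact: ltry.
rewrite (eq_integral (fun x => (f x ^+ 2)%:E)) // => x _.
by rewrite /= ger0_norm// powR_mulrn.
Qed.

End density.

Theorem theorem1p1 (R : realType) (N : nat) (hN : (3 <= N)%N)
    (V : 'rV[R]_N -> R)
    (V_ge0 : forall x, 0 <= V x)
    (V_coercive : coercive V)
    (V_cont : continuous V)
    (V_H2loc : Hloc 2 V)
    (Psi : 'rV[R]_N -> R)
    (Psi_cont : {within @usphere R N, continuous Psi})
    (Psi_even : forall w, usphere w -> Psi (- w) = Psi w)
    (Psi_gt0 : forall w, usphere w -> 0 < Psi w)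
    (m : 'rV[R]_N -> R) (m0 m1 : R)
    (m_meas : measurable_fun (@usphere R N) m)
    (m0_gt0 : 0 < m0)
    (m_bounds : forall w, usphere w -> m0 <= m w <= m1)
    (FW : distributional_fourier
            (fun x => (fine (kernelW Psi x))%:C%C)
            (fun xi => (homogeneous m 2 xi)%:C%C))
    (mu : probability 'rV[R]_N R)
    (mu_min : minimizer (energy (kernelW Psi) V) mu) :
  has_L2_density mu.
Proof.
have [rho suppmu [C hC]] := minimizer_bounded_heat_mass hN V_ge0 V_coercive V_cont V_H2loc
  Psi_cont Psi_gt0 m_meas m0_gt0 m_bounds FW mu_min.
exact: (L2_density hC suppmu).
Qed.
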